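(* Let $\mathcal{X} = \mathbb{R}^d$, $\mathcal{Y} = \mathbb{R}$ and let $\mathcal{G}$ be a compact group with an orthogonal representation $\phi$ on $\mathcal{X}$. Let $X \sim \mathcal{N}(0, \sigma_X^2 I)$ and $Y = h_\theta(X) + \xi$ where $h_\theta(x) = \theta^\top x$ is $\mathcal{G}$-invariant with $\theta\in\mathbb{R}^d$ and where $\xi$ has mean $0$, variance $\sigma_\xi^2 < \infty$ and is independent of $X$. Let $w$ be the least squares estimate of $\theta$ from i.i.d.~training examples $((X_i, Y_i): i=1, \dots, n)$ distributed independently of and identically to $(X, Y)$ and let $A$ be the orthogonal complement of the subspace of $\mathcal{G}$-invariant linear predictors. \begin{itemize} \item If $n > d + 1$ then the generalisation gap satisfies \[ \mathbb{E}\left[R[h_w] - R[h_{\bar{w}}]\right] = \sigma_\xi^2\frac{\dim A}{n - d - 1}. \] \item At the interpolation threshold $n \in [d-1, d+1]$, if $h_w$ is not $\mathcal{G}$-invariant then the generalisation gap diverges to $\infty$. \item If $n < d- 1$ the generalisation gap is \[ \mathbb{E}\left[R[h_w] - R[h_{\bar{w}}]\right] = \dim A \left( \sigma_X^2 \|\theta\|_2^2\frac{n(d-n)}{d(d-1)(d+2)} + \sigma_\xi^2\frac{n}{d(d - n - 1)} \right) . \] \end{itemize} The expectations are over the training sample. Each of the three statements in the list above continues to hold with $\ge$ in place of $=$ (respectively, the divergence still holds) when $h_{\bar{w}}$ is replaced by any predictor $h'$ such that $R[h'] \le R[h_{\bar{w}}]$.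
   Context: $h_w(x)=w^\top x$ denotes the linear predictor with parameter $w\in\mathbb{R}^d$. The risk of a predictor $f$ is $R[f]=\mathbb{E}[(f(X)-Y)^2]$ (conditional on any randomness in $f$). $\lambda$ is the normalised Haar measure on $\mathcal{G}$, and $\bar{w} = \Phi(w)$ where $\Phi(w) = \int_\mathcal{G} \phi(g) w \, d\lambda(g)$, so that $h_{\bar w}$ is the orbit-averaged (invariant) version of $h_w$: $h_{\bar w}(x)=\int_\mathcal{G} h_w(\phi(g)x)\,d\lambda(g)$. The least squares estimate is the minimum-norm solution $w=(\mathbf{X}^\top\mathbf{X})^+\mathbf{X}^\top\mathbf{Y}$ with $\mathbf{X}\in\mathbb{R}^{n\times d}$, $\mathbf{Y}\in\mathbb{R}^n$ the row-stacked training inputs/outputs. The orthogonal complement is taken with respect to the inner product $\langle a,b\rangle = a^\top \mathbb{E}[XX^\top] b$ on parameters (here proportional to the Euclidean one); $\dim A = d - \dim\{w: \Phi(w)=w\}$.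
   Formalization: The interpolation-threshold item assumes σ_ξ² > 0: with σ_ξ = 0 and n = d−1 the predictor h_w can be non-invariant while the gap stays finite; also σ_X > 0 is assumed throughout. *)

(* Defs.v *)
From HB Require Import structures.
From mathcomp Require Import all_boot all_order all_algebra.
From mathcomp Require Import all_classical all_reals all_analysis.
From Stdlib Require Import ClassicalEpsilon.

Set Implicit Arguments.
Unset Strict Implicit.
Unset Printing Implicit Defensive.

Import Order.TTheory GRing.Theory Num.Theory.
Import numFieldNormedType.Exports.

Local Open Scope classical_set_scope.
Local Open Scope ring_scope.

Record compact_group := CompactGroup {
  cg_type :> topologicalType;
  cg_mul : cg_type -> cg_type -> cg_type;
  cg_inv : cg_type -> cg_type;
  cg_one : cg_type;
  cg_mulA : associative cg_mul;
  cg_mul1g : left_id cg_one cg_mul;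
  cg_mulVg : left_inverse cg_one cg_inv cg_mul;
  cg_mul_cont : continuous (fun p : cg_type * cg_type => cg_mul p.1 p.2);
  cg_inv_cont : continuous cg_inv;
  cg_hausdorff : hausdorff_space cg_type;
  cg_compact : compact [set: cg_type] }.

Definition orth_rep (R : realType) (d : nat) (G : compact_group)
    (phi : G -> 'M[R]_d) : Prop :=
  [/\ forall g h, phi (cg_mul g h) = phi g *m phi h,
      phi (cg_one G) = 1%:M,
      forall g, phi g *m (phi g)^T = 1%:M &
      forall i j, continuous (fun g => phi g i j)].

(** lam is the normalised Haar integral on G: a positive, normalised,
    left-G_invariant linear functional on the continuous real functions on G
    (i.e. f |-> \int f d(lambda) for the normalised Haar measure lambda). *)
Definition haar_integral (R : realType) (G : compact_group)
    (lam : (G -> R) -> R) : Prop :=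
  [/\ forall f g : G -> R, continuous f -> continuous g ->
        lam (fun x => f x + g x) = lam f + lam g,
      forall (a : R) (f : G -> R), continuous f ->
        lam (fun x => a * f x) = a * lam f,
      forall f : G -> R, continuous f -> (forall x, 0 <= f x) -> 0 <= lam f,
      lam (fun _ => 1) = 1 &
      forall (g : G) (f : G -> R), continuous f ->
        lam (fun x => f (cg_mul g x)) = lam f].

Definition linpred (R : realType) (d : nat) (w : 'cV[R]_d) : 'cV[R]_d -> R :=
  fun x => (w^T *m x) 0 0.

Definition G_invariant (R : realType) (d : nat) (G : compact_group)
    (phi : G -> 'M[R]_d) (f : 'cV[R]_d -> R) : Prop :=
  forall g x, f (phi g *m x) = f x.

Definition avg_mx (R : realType) (d : nat) (G : compact_group)
    (lam : (G -> R) -> R) (phi : G -> 'M[R]_d) : 'M[R]_d :=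
  \matrix_(i, j) lam (fun g => phi g i j).

(** Phi(w) = \int_G phi(g) w d lambda(g) = (\int_G phi(g) d lambda(g)) w *)
Definition Phi (R : realType) (d : nat) (G : compact_group)
    (lam : (G -> R) -> R) (phi : G -> 'M[R]_d) (w : 'cV[R]_d) : 'cV[R]_d :=
  avg_mx lam phi *m w.

(** dim A = d - dim {w | Phi w = w}.  The row space of
    kermx ((avg_mx)^T - 1) is exactly {w^T | Phi w = w}. *)
Definition dimA (R : realType) (d : nat) (G : compact_group)
    (lam : (G -> R) -> R) (phi : G -> 'M[R]_d) : nat :=
  (d - \rank (kermx ((avg_mx lam phi)^T - 1%:M)))%N.

(** Moore-Penrose pseudoinverse (the unique B satisfying Penrose's equations) *)
Definition is_pinv (R : realType) (d : nat) (A B : 'M[R]_d) : Prop :=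
  [/\ A *m B *m A = A, B *m A *m B = B,
      (A *m B)^T = A *m B & (B *m A)^T = B *m A].

Definition mp_pinv (R : realType) (d : nat) (A : 'M[R]_d) : 'M[R]_d :=
  epsilon (inhabits 0) (fun B => is_pinv A B).

(** minimum-norm least squares estimate w = (X^T X)^+ X^T Y, where the
    design matrix X has rows X_i^T *)
Definition design (R : realType) (d n : nat) (Xs : 'I_n -> 'cV[R]_d)
  : 'M[R]_(n, d) := \matrix_(i, j) Xs i j 0.

Definition lse (R : realType) (d n : nat) (Xs : 'I_n -> 'cV[R]_d)
    (Ys : 'I_n -> R) : 'cV[R]_d :=
  mp_pinv ((design Xs)^T *m design Xs) *m (design Xs)^T *m \col_i Ys i.

Definition mutual_indep d (T : measurableType d) (R : realType)
    (P : probability T R) (I : finType) (Z : I -> T -> R) : Prop :=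
  forall B : I -> set R, (forall i, measurable (B i)) ->
    P (\bigcap_(i in [set: I]) (Z i @^-1` B i)) =
    (\prod_(i : I) P (Z i @^-1` B i))%E.

(** the scalar random variables of the problem: all coordinates of the
    inputs X_i (i = None is the test pair (X,Y), Some k the k-th training
    example) and all noises xi_i *)
Definition sample_family d (T : measurableType d) (R : realType) (dd n : nat)
    (X : option 'I_n -> T -> 'cV[R]_dd) (xi : option 'I_n -> T -> R)
  : (option 'I_n * 'I_dd) + option 'I_n -> T -> R :=
  fun k => match k with
           | inl (i, j) => fun t => X i t j 0
           | inr i => xi i
           end.

(* Main.v *)
Require Import Defs.
From HB Require Import structures.
From mathcomp Require Import all_boot all_order all_algebra.
From mathcomp Require Import all_classical all_reals all_analysis.
From mathcomp Require Import perm measurable_realfun ring lra.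

Set Implicit Arguments.
Unset Strict Implicit.
Unset Printing Implicit Defensive.

Import Order.TTheory GRing.Theory Num.Theory.
Import numFieldNormedType.Exports.
Local Open Scope classical_set_scope.
Local Open Scope ring_scope.

(** The gap is [sX^2 E|(1 - Phi) w|^2], since [Phi] is the orthogonal projection
    on the invariant vectors, and almost surely [w = H theta + M xi] where [M] is
    the Moore-Penrose inverse of the design matrix [X] and [H = M X].
    Integrating the noise out first leaves
    [E|(1 - Phi) H theta|^2 + vxi E tr((1 - Phi) M M^T)].

    Gaussian designs are invariant under sign flips and permutations of the
    columns and under rotations by 45 degrees of two columns.  Averaging over
    signs reduces the second term to the diagonal of [M M^T], i.e. to the mean of
    an inverse Wishart matrix: a diagonal entry of [(X^T X)^-1] is [1 / z^T S z]
    with [z] one column and [S] the projection orthogonal to the others, and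
    [1/q = 1/2 int_0^oo e^(-uq/2) du] reduces its mean to Gaussian integrals
    [E e^(-u z^T S z / 2) = (1 + sX^2 u)^(-k/2)] with [k] the rank of [S]; the mean
    is infinite exactly when [k <= 2], which is the interpolation threshold.
    The same invariances determine the second moments of the entries of [H] up to
    two constants, which follow from [H^2 = H] and [tr H = n]. *)

(** * Independent families and their joint law *)

(** Three obstacles shape the proof. Independence is given for scalar variables on an abstract
    sample space, with no product structure to integrate over; since the joint law of a finite
    family is determined by its values on boxes, expectations can be computed on a product space
    that carries an independent copy of some variables, and Tonelli there plays the role of
    conditioning. The estimate is defined through a choice of pseudoinverse and is not known to be
    measurable; off a null set it agrees with a measurable operator which is 0 on degenerate
    designs. The gap may be infinite, so the noise term is handled as a nonnegative extended real
    and never split into entries of unknown integrability, whereas the entries of [H] are bounded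
    and have ordinary means.

    If [n >= d] then [H = 1] almost surely and the first term vanishes. If [n < d], the trace of
    [M M^T] is that of [(X X^T)^-1], so the same inverse Wishart mean applies to the transposed
    design. Sign flips, permutations and 45 degree rotations are preferred to general orthogonal
    matrices because each is checked on one or two coordinates at a time, and they already force the
    second moments of [H] to be isotropic. *)

Section families.
Context {R : realType} (I : finType).

(** The boxes form a pi-system and [mutual_indep] is a statement about their probabilities, which
    makes them the natural generators of the product sigma-algebra [famType]. *)
Definition boxes : set (set (I -> R)) :=
  [set A | exists2 B : I -> set R, (forall i, measurable (B i)) &
           A = [set z | forall i, B i (z i)]].

Definition famType := g_sigma_algebraType boxes.
HB.instance Definition _ := Measurable.copy famType (g_sigma_algebraType boxes).

Lemma measurable_coord i : measurable_fun [set: famType] (fun z : famType => z i).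
Proof.
move=> _ Y mY; rewrite setTI; apply: sub_sigma_algebra.
exists (fun j => if j == i then Y else setT) => [j|]; first by case: ifP.
apply/seteqP; split => z /=.
  by move=> Yz j; case: eqP => // ->.
by move=> /(_ i); rewrite eqxx.
Qed.

Lemma measurable_family d (T : measurableType d) (Z : I -> T -> R) :
  (forall i, measurable_fun setT (Z i)) ->
  measurable_fun setT (fun t => (fun i => Z i t) : famType).
Proof.
move=> mZ; apply: (@measurability _ _ T famType setT _ boxes) => //.
move=> _ [_ [B mB ->] <-]; rewrite setTI.
have -> : (fun t => (fun i => Z i t) : famType) @^-1`
    [set z | forall i, B i (z i)] = \bigcap_(i in [set: I]) (Z i @^-1` B i).
  by apply/seteqP; split => t /= h i; [move=> _; exact: h|exact: h].
apply: fin_bigcap_measurable => // i _.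
by rewrite -[X in measurable X]setTI; exact: mZ.
Qed.

Lemma boxes_setI : setI_closed boxes.
Proof.
move=> _ _ [B mB ->] [C mC ->]; exists (fun i => B i `&` C i).
  by move=> i; exact: measurableI.
by apply/seteqP; split => z /= => [[hB hC] i|h]; split => // i; have [] := h i.
Qed.

(** Independence gives a box the product of its marginal probabilities, so the two laws agree on a
    generating pi-system. *)
Lemma law_unique d (T : measurableType d) (P : probability T R)
    d' (T' : measurableType d') (P' : probability T' R)
    (Z : I -> T -> R) (Z' : I -> T' -> R)
    (mZ : forall i, measurable_fun setT (Z i))
    (mZ' : forall i, measurable_fun setT (Z' i)) :
  (forall i A, measurable A -> P (Z i @^-1` A) = P' (Z' i @^-1` A)) ->
  mutual_indep P Z -> mutual_indep P' Z' ->
  forall A : set famType, measurable A ->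
  pushforward P (fun t => (fun i => Z i t) : famType) A =
  pushforward P' (fun t => (fun i => Z' i t) : famType) A.
Proof.
move=> hm iZ iZ' A mA.
apply: (@measure_unique _ R famType boxes (fun=> setT)) => //.
- exact: boxes_setI.
- by move=> k; exists (fun=> setT) => //; apply/seteqP; split.
- by apply/seteqP; split => // x _; exists 0%N.
- exact: measurable_family.
- exact: measurable_family.
- move=> mf mf' _ [B mB ->]; rewrite /= /pushforward.
  have E U (W : I -> U -> R) : (fun t => (fun i => W i t) : famType) @^-1`
      [set z | forall i, B i (z i)] = \bigcap_(i in [set: I]) (W i @^-1` B i).
    by apply/seteqP; split => t /= h i; [move=> _; exact: h|exact: h].
  rewrite !E iZ// iZ'//.
  by apply: eq_bigr => i _; exact: hm.
- by move=> mf k; rewrite /= /pushforward preimage_setT probability_setT ltry.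
Qed.

Section transfer.
Context d (T : measurableType d) (P : probability T R)
  d' (T' : measurableType d') (P' : probability T' R).
Variables (Z : I -> T -> R) (Z' : I -> T' -> R).
Hypotheses (mZ : forall i, measurable_fun setT (Z i))
  (mZ' : forall i, measurable_fun setT (Z' i))
  (hm : forall i A, measurable A -> P (Z i @^-1` A) = P' (Z' i @^-1` A))
  (iZ : mutual_indep P Z) (iZ' : mutual_indep P' Z').

Lemma ge0_integral_same_law (f : famType -> \bar R) :
  measurable_fun setT f -> (forall z, (0 <= f z)%E) ->
  (\int[P]_t f (fun i => Z i t) = \int[P']_t f (fun i => Z' i t))%E.
Proof.
move=> mf f0.
have := @ge0_integral_pushforward _ _ _ _ _ _ (measurable_family mZ) P setT f
  measurableT mf (fun y _ => f0 y).
rewrite preimage_setT => <-.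
have := @ge0_integral_pushforward _ _ _ _ _ _ (measurable_family mZ') P' setT f
  measurableT mf (fun y _ => f0 y).
rewrite preimage_setT => <-.
apply: eq_measure_integral; [exact: measurable_family..|].
by move=> ? ? A mA _; exact: (law_unique mZ mZ' hm iZ iZ' mA).
Qed.

Lemma probability_same_law (A : set famType) : measurable A ->
  P [set t | A (fun i => Z i t)] = P' [set t | A (fun i => Z' i t)].
Proof. by move=> mA; have := law_unique mZ mZ' hm iZ iZ' mA. Qed.

Lemma integral_same_law (f : famType -> \bar R) :
  measurable_fun setT f ->
  P'.-integrable setT (fun t => f (fun i => Z' i t)) ->
  P.-integrable setT (fun t => f (fun i => Z i t)) /\
  (\int[P]_t f (fun i => Z i t) = \int[P']_t f (fun i => Z' i t))%E.
Proof.
move=> mf; move=> intf'.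
have intf : P.-integrable setT (fun t => f (fun i => Z i t)).
  apply/integrableP; split.
    by apply: measurableT_comp mf _; exact: measurable_family.
  rewrite (@ge0_integral_same_law (fun z => `|f z|)%E)//.
    by case/integrableP: intf'.
  exact: measurableT_comp.
split => //.
have := @integral_pushforward _ _ _ _ _ _ (measurable_family mZ) P setT f mf.
rewrite preimage_setT => <- //.
have := @integral_pushforward _ _ _ _ _ _ (measurable_family mZ') P' setT f mf.
rewrite preimage_setT => <- //.
apply: eq_measure_integral; [exact: measurable_family..|].
by move=> ? ? A mA _; exact: (law_unique mZ mZ' hm iZ iZ' mA).
Qed.
End transfer.

End families.
Arguments famType : clear implicits.

Section independence.
Context {R : realType} (I : finType).

(** A box in the selected coordinates is a box in all of them, with the whole line in the others,
    whose factors are 1. *)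
Lemma mutual_indep_inj d (T : measurableType d) (P : probability T R)
    (K : finType) (h : K -> I) (Z : I -> T -> R) :
  injective h -> mutual_indep P Z -> mutual_indep P (fun k => Z (h k)).
Proof.
move=> hI iZ B mB.
pose C i := if [pick k | h k == i] is Some k then B k else setT.
have Ch k : C (h k) = B k.
  by rewrite /C; case: pickP => [k' /eqP/hI->|/(_ k)]//; rewrite eqxx.
have mC i : measurable (C i) by rewrite /C; case: pickP.
have -> : \bigcap_(k in [set: K]) (Z (h k) @^-1` B k) =
          \bigcap_(i in [set: I]) (Z i @^-1` C i).
  apply/seteqP; split => t /= H i _; last by rewrite -Ch; exact: H.
  by rewrite /C; case: pickP => //= k /eqP <-; exact: H.
rewrite iZ//.
rewrite (bigID (mem (codom h)))/= [X in (_ * X)%E]big1 ?mule1; last first.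
  move=> i ih; rewrite /C; case: pickP => [k /eqP hk|_].
    by rewrite -hk codom_f in ih.
  by rewrite preimage_setT probability_setT.
rewrite -big_filter (perm_big (codom h)); last first.
  apply: uniq_perm.
  - by rewrite filter_uniq ?index_enum_uniq.
  - by rewrite map_inj_uniq ?enum_uniq.
  - by move=> i; rewrite mem_filter mem_index_enum andbT.
by rewrite big_map big_enum/=; apply: eq_bigr => k _; rewrite Ch.
Qed.

(** A copy of the family on a product space: freezing the first component amounts to conditioning on
    the variables in [J]. *)
Definition merge_fam (J : pred I) T T' (Z : I -> T -> R) (U : I -> T' -> R)
  (i : I) (tt : T * T') := if J i then Z i tt.1 else U i tt.2.

Lemma measurable_merge_fam (J : pred I) d (T : measurableType d)
    d' (T' : measurableType d') (Z : I -> T -> R) (U : I -> T' -> R) :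
  (forall i, measurable_fun setT (Z i)) ->
  (forall i, measurable_fun setT (U i)) ->
  forall i, measurable_fun setT (merge_fam J Z U i).
Proof.
move=> mZ mU i; rewrite /merge_fam; case: (J i).
  by apply: measurableT_comp (mZ i) _; exact: measurable_fst.
by apply: measurableT_comp (mU i) _; exact: measurable_snd.
Qed.

Lemma mutual_indep_merge (J : pred I) d (T : measurableType d)
    d' (T' : measurableType d') (P : probability T R) (P' : probability T' R)
    (Z : I -> T -> R) (U : I -> T' -> R) :
  (forall i, measurable_fun setT (Z i)) ->
  (forall i, measurable_fun setT (U i)) ->
  mutual_indep P Z -> mutual_indep P' U ->
  (forall i A, measurable A ->
     (P \x P')%E (merge_fam J Z U i @^-1` A) =
     if J i then P (Z i @^-1` A) else P' (U i @^-1` A)) /\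
  mutual_indep (P \x P')%E (merge_fam J Z U).
Proof.
move=> mZ mU iZ iU.
have marg i A : measurable A -> (P \x P')%E (merge_fam J Z U i @^-1` A) =
     if J i then P (Z i @^-1` A) else P' (U i @^-1` A).
  move=> mA; case: ifPn => Ji.
    have -> : merge_fam J Z U i @^-1` A = (Z i @^-1` A) `*` setT.
      by apply/seteqP; split => -[t t'] /=; rewrite /merge_fam Ji//= => -[].
    rewrite product_measure1E//.
      by rewrite [X in (_ * X)%E](probability_setT P') mule1.
    by rewrite -[X in measurable X]setTI; exact: mZ.
  have -> : merge_fam J Z U i @^-1` A = setT `*` (U i @^-1` A).
    by apply/seteqP; split => -[t t'] /=; rewrite /merge_fam (negbTE Ji)//= => -[].
  rewrite product_measure1E//.
    by rewrite [X in (X * _)%E](probability_setT P) mul1e.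
  by rewrite -[X in measurable X]setTI; exact: mU.
split => // B mB.
rewrite (eq_bigr _ (fun i _ => marg i (B i) (mB i))).
pose B1 i := if J i then B i else setT.
pose B2 i := if J i then setT else B i.
have mB1 i : measurable (B1 i) by rewrite /B1; case: ifP.
have mB2 i : measurable (B2 i) by rewrite /B2; case: ifP.
have -> : \bigcap_(i in [set: I]) (merge_fam J Z U i @^-1` B i) =
  (\bigcap_(i in [set: I]) (Z i @^-1` B1 i)) `*`
  (\bigcap_(i in [set: I]) (U i @^-1` B2 i)).
  apply/seteqP; split => -[t t'] /=; rewrite /merge_fam.
    move=> H; split => i _ /=; have := H i Logic.I; rewrite /B1 /B2 /=;
    by case: (J i).
  move=> [H1 H2] i _ /=; have := H1 i Logic.I; have := H2 i Logic.I.
  by rewrite /B1 /B2 /=; case: (J i).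
rewrite [LHS]product_measure1E//; last 2 first.
- apply: fin_bigcap_measurable => // i _.
  by rewrite -[X in measurable X]setTI; exact: mZ.
- apply: fin_bigcap_measurable => // i _.
  by rewrite -[X in measurable X]setTI; exact: mU.
rewrite [X in (X * _)%E](iZ _ mB1) [X in (_ * X)%E](iU _ mB2) -big_split/=.
apply: eq_bigr => i _.
by rewrite /B1 /B2; case: (J i); rewrite preimage_setT probability_setT ?mule1 ?mul1e.
Qed.

(* Resampling an independent copy of the variables outside [J] on a second
   factor turns expectations into iterated integrals. *)
Section resample.
Context d (T : measurableType d) (P : probability T R).
Context d' (T' : measurableType d') (P' : probability T' R).
Variables (Z : I -> T -> R) (U : I -> T' -> R) (J : pred I).
Hypotheses (mZ : forall i, measurable_fun setT (Z i))
  (mU : forall i, measurable_fun setT (U i))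
  (iZ : mutual_indep P Z) (iU : mutual_indep P' U)
  (ZU : forall i, ~~ J i -> forall A, measurable A ->
    P (Z i @^-1` A) = P' (U i @^-1` A)).

Let marg i A : measurable A ->
  P (Z i @^-1` A) = (P \x P')%E (merge_fam J Z U i @^-1` A).
Proof.
move=> mA; have [-> //] := mutual_indep_merge J mZ mU iZ iU.
by case: ifPn => // Ji; rewrite ZU.
Qed.

Lemma ge0_integral_resample (f : famType R I -> \bar R) :
  measurable_fun setT f -> (forall z, (0 <= f z)%E) ->
  (\int[P]_t f (fun i => Z i t) =
   \int[P]_t \int[P']_t' f (fun i => if J i then Z i t else U i t'))%E.
Proof.
move=> mf f0; have [_ iW] := mutual_indep_merge J mZ mU iZ iU.
rewrite (ge0_integral_same_law mZ (measurable_merge_fam J mZ mU) marg iZ iW)//.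
rewrite fubini_tonelli1//.
apply: measurableT_comp mf _; apply: measurable_family.
exact: measurable_merge_fam.
Qed.

End resample.
End independence.

(** * Means and second moments *)

Section has_mean.
Context {R : realType} d (T : measurableType d) (P : probability T R).
Implicit Types (f g : T -> R) (a b m : R).

(** Bundling integrability with the value lets moments be added and scaled without separate
    integrability proofs. *)
Definition has_mean f m :=
  P.-integrable setT (EFin \o f) /\ (\int[P]_t (f t)%:E = m%:E)%E.

Lemma has_mean_unique f m m' : has_mean f m -> has_mean f m' -> m = m'.
Proof. by move=> [_ E] [_ E']; apply: EFin_inj; rewrite -E -E'. Qed.

Lemma has_mean_ext f g m : f =1 g -> has_mean f m -> has_mean g m.
Proof. by move=> /funext ->. Qed.

Lemma has_mean_cst a : has_mean (fun=> a) a.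
Proof.
split; first exact: finite_measure_integrable_cst.
by rewrite integral_cst// [X in (_ * X)%E]probability_setT mule1.
Qed.

Lemma has_meanD f g a b :
  has_mean f a -> has_mean g b -> has_mean (fun t => f t + g t) (a + b).
Proof.
move=> [fi fE] [gi gE]; split.
  have -> : EFin \o (fun t => f t + g t) = (EFin \o f) \+ (EFin \o g).
    by apply/funext => t /=; rewrite EFinD.
  exact: integrableD.
under eq_integral do rewrite EFinD.
by rewrite integralD// fE gE.
Qed.

Lemma has_meanZ f a m : has_mean f m -> has_mean (fun t => a * f t) (a * m).
Proof.
move=> [fi fE]; split.
  have -> : EFin \o (fun t => a * f t) = (fun t => a%:E * (EFin \o f) t)%E.
    by apply/funext => t /=; rewrite EFinM.
  exact: integrableZl.
under eq_integral do rewrite EFinM.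
by rewrite integralZl// fE.
Qed.

Lemma has_mean_sum (I : Type) (s : seq I) (f : I -> T -> R) (m : I -> R) :
  (forall i, has_mean (f i) (m i)) ->
  has_mean (fun t => \sum_(i <- s) f i t) (\sum_(i <- s) m i).
Proof.
move=> fm; elim: s => [|i s IH].
  by rewrite big_nil; apply: has_mean_ext (has_mean_cst 0) => t; rewrite big_nil.
rewrite big_cons; apply: has_mean_ext (has_meanD (fm i) IH) => t.
by rewrite big_cons.
Qed.

Lemma has_mean_bounded f a : measurable_fun setT f -> (forall t, `|f t| <= a) ->
  exists m, has_mean f m.
Proof.
move=> mf fa; have fi : P.-integrable setT (EFin \o f).
  apply: (@le_integrable _ _ _ _ _ _ _ (fun=> a%:E)) => //.
  - exact/measurable_EFinP.
  - by move=> t _ /=; rewrite lee_fin (le_trans (fa t))// ler_norm.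
  - exact: finite_measure_integrable_cst.
exists (fine (\int[P]_t (f t)%:E)); split=> //.
by rewrite fineK//; exact: integrable_fin_num.
Qed.

End has_mean.

Lemma has_mean_same_law (R : realType) (I : finType)
    d (T : measurableType d) (P : probability T R)
    d' (T' : measurableType d') (P' : probability T' R)
    (Z : I -> T -> R) (Z' : I -> T' -> R) :
  (forall i, measurable_fun setT (Z i)) ->
  (forall i, measurable_fun setT (Z' i)) ->
  (forall i A, measurable A -> P (Z i @^-1` A) = P' (Z' i @^-1` A)) ->
  mutual_indep P Z -> mutual_indep P' Z' ->
  forall (f : famType R I -> R) m, measurable_fun setT f ->
  has_mean P' (fun t => f (fun i => Z' i t)) m ->
  has_mean P (fun t => f (fun i => Z i t)) m.
Proof.
move=> mZ mZ' ZZ' iZ iZ' f m mf [fi fE].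
have /measurable_EFinP mf' := mf.
have [//|? E] := integral_same_law mZ mZ' ZZ' iZ iZ' (f := EFin \o f) _ fi.
by split => //; rewrite -fE.
Qed.

Section second_moment.
Context {R : realType} (I : finType) d (T : measurableType d).
Variables (P : probability T R) (Z : I -> T -> R) (v : I -> R).
Hypotheses (mZ : forall i, measurable_fun setT (Z i)) (iZ : mutual_indep P Z)
  (Z1 : forall i, has_mean P (Z i) 0)
  (Z2 : forall i, has_mean P (fun t => Z i t ^+ 2) (v i)).

(** [|x y| <= x^2 + y^2] gives integrability. Then [Z i] and [Z j] are placed on different factors
    of a product, where the inner integral of [Z j] vanishes. *)
Lemma has_mean_indepM i j : i != j -> has_mean P (fun t => Z i t * Z j t) 0.
Proof.
move=> ij.
have ii : P.-integrable setT (EFin \o (fun t => Z i t * Z j t)).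
  have [H _] := has_meanD (Z2 i) (Z2 j).
  apply: le_integrable H => //.
    by apply/measurable_EFinP; exact: measurable_funM.
  move=> t _ /=; rewrite lee_fin normrM (ger0_norm (addr_ge0 _ _)) ?sqr_ge0//.
  rewrite -(real_normK (num_real (Z i t))) -(real_normK (num_real (Z j t))).
  by have := sqr_ge0 (`|Z i t| - `|Z j t|); nra.
split => //.
pose J := pred1 i.
have [marg iW] := mutual_indep_merge J mZ mZ iZ iZ.
have mW := measurable_merge_fam J mZ mZ.
have marg' k A : measurable A ->
    (P \x P)%E (merge_fam J Z Z k @^-1` A) = P (Z k @^-1` A).
  by move=> mA; rewrite marg//; case: ifP.
pose f (z : famType R I) := (z i * z j)%:E.
have mf : measurable_fun setT f.
  by apply/measurable_EFinP; apply: measurable_funM; exact: measurable_coord.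
have [fi <-] := integral_same_law mW mZ marg' iW iZ mf ii.
rewrite -(integral12_prod_meas1 fi) /fubini_F/=.
under eq_integral => t _.
  have -> : (\int[P]_y f (fun k => merge_fam J Z Z k (t, y)) = 0)%E.
    under eq_integral => y _.
      rewrite /f /merge_fam /J /= eqxx (eq_sym j) (negbTE ij) EFinM. over.
    have [? E] := Z1 j.
    by rewrite integralZl// E mule0.
  over.
by rewrite integral0.
Qed.

(** Serves both for the risk of a fixed linear predictor and for integrating out the training
    noise. *)
Lemma has_mean_affine_sq (a : I -> R) c :
  has_mean P (fun t => (c + \sum_i a i * Z i t) ^+ 2)
             (c ^+ 2 + \sum_i a i ^+ 2 * v i).
Proof.
have H1 : has_mean P (fun t => \sum_i (c * a i *+ 2) * Z i t)
                     (\sum_i (c * a i *+ 2) * 0).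
  by apply: has_mean_sum => i; exact: has_meanZ.
have H2 : has_mean P (fun t => \sum_i \sum_j (a i * a j) * (Z i t * Z j t))
    (\sum_i \sum_j (a i * a j) * (if i == j then v i else 0)).
  apply: has_mean_sum => i; apply: has_mean_sum => j; apply: has_meanZ.
  by case: eqVneq => [->|ij]; [exact: Z2|exact: has_mean_indepM].
have := has_meanD (has_mean_cst P (c ^+ 2)) (has_meanD H1 H2).
rewrite [X in _ + (X + _)]big1 ?add0r; last by move=> i _; rewrite mulr0.
rewrite [X in _ + X](eq_bigr (fun i => a i ^+ 2 * v i)); last first.
  move=> i _; rewrite (bigD1 i)//= eqxx big1 ?addr0 ?expr2// => j.
  by rewrite eq_sym => /negbTE ->; rewrite mulr0.
apply: has_mean_ext => t.
rewrite sqrrD addrA; congr (_ + _ + _).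
  rewrite mulr_sumr -sumrMnl; apply: eq_bigr => i _.
  by rewrite mulrnAl mulrA.
rewrite expr2 mulr_suml; apply: eq_bigr => i _; rewrite mulr_sumr.
by apply: eq_bigr => j _; ring.
Qed.

End second_moment.

(** * Gaussian integrals *)

Section normal_integral.
Context {R : realType} (m s : R).
Local Notation mu := (@lebesgue_measure R).
Local Open Scope ereal_scope.

Import HBNNSimple.

Let pdf_ge0 x : 0 <= (normal_pdf m s x)%:E.
Proof. by rewrite lee_fin normal_pdf_ge0. Qed.

Let mpdf : measurable_fun [set: measurableTypeR R] (fun x => (normal_pdf m s x)%:E).
Proof. by apply/measurable_EFinP; exact: measurable_normal_pdf. Qed.

Let integral_normal_nnsfun (f : {nnsfun measurableTypeR R >-> R}) :
  \int[normal_prob m s]_x (f x)%:E =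
  \int[mu]_x ((f x)%:E * (normal_pdf m s x)%:E).
Proof.
under [LHS]eq_integral do rewrite fimfunE -fsumEFin//.
rewrite [LHS]ge0_integral_fsum//; last 2 first.
  - by move=> r; apply/measurable_EFinP; exact: measurable_funM.
  - by move=> n x _; rewrite EFinM nnfun_muleindic_ge0.
under [RHS]eq_integral.
  move=> x xD; rewrite fimfunE -fsumEFin// ge0_mule_fsuml; last first.
    by move=> r; rewrite EFinM nnfun_muleindic_ge0.
  over.
rewrite [RHS]ge0_integral_fsum//; last 2 first.
  - move=> r; apply: emeasurable_funM => //.
    by apply/measurable_EFinP; exact: measurable_funM.
  - by move=> n x _; rewrite EFinM mule_ge0// nnfun_muleindic_ge0.
apply: eq_fsbigr => r _.
rewrite integralZl_indic_nnsfun//= integral_indic// setIT.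
have [r0|r0] := leP 0%R r; last first.
  rewrite preimage_nnfun0// measure0 mule0.
  by rewrite integral0_eq// => x _; rewrite indic0 /= mulr0 mul0e.
rewrite /normal_prob -ge0_integralZl//; last exact: measurable_funTS.
rewrite [LHS]integral_mkcond epatch_indic; apply: eq_integral => x _ /=.
by rewrite EFinM -!muleA; congr (_ * _); rewrite muleC.
Qed.

(** The density formula passes from sets to simple functions by linearity and to all nonnegative
    functions by monotone convergence. *)
Lemma ge0_integral_normal_prob (f : measurableTypeR R -> \bar R) :
  measurable_fun setT f -> (forall x, 0 <= f x) ->
  \int[normal_prob m s]_x f x = \int[mu]_x (f x * (normal_pdf m s x)%:E).
Proof.
move=> mf f0.
pose f_ := nnsfun_approx measurableT mf.
transitivity (lim (\int[normal_prob m s]_x (f_ n x)%:E @[n --> \oo])).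
  rewrite -monotone_convergence//=.
  - apply: eq_integral => ? /[!inE] xD; apply/esym/cvg_lim => //=.
    exact: cvg_nnsfun_approx.
  - by move=> n; exact/measurable_EFinP/measurable_funTS.
  - by move=> n ? _; rewrite lee_fin.
  - by move=> ? _ ? ? mn; rewrite lee_fin; exact/lefP/nd_nnsfun_approx.
rewrite [RHS](_ : _ = lim
    (\int[mu]_x ((f_ n x)%:E * (normal_pdf m s x)%:E) @[n --> \oo])); last first.
  rewrite -monotone_convergence//=.
  - apply: eq_integral => x _; apply/esym/cvg_lim => //.
    apply: cvgeZr => //; exact: cvg_nnsfun_approx.
  - move=> n; apply: emeasurable_funM => //.
    exact/measurable_EFinP/measurable_funTS.
  - by move=> n ? _; rewrite mule_ge0// lee_fin.
  - move=> x _ ? ? ?; apply: lee_wpmul2r => //.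
    by rewrite lee_fin; exact/lefP/nd_nnsfun_approx.
by apply: congr_lim; apply/funext => n /=; exact: integral_normal_nnsfun.
Qed.

End normal_integral.

Section affine_substitution.
Context {R : realType}.
Local Notation mu := (@lebesgue_measure R).
Local Open Scope ereal_scope.

(** The image of Lebesgue measure under the affine map, scaled by [a], gives half-open intervals
    their length, hence is Lebesgue measure. *)
Lemma ge0_integral_affine (a b : R) (f : measurableTypeR R -> \bar R) : (0 < a)%R ->
  measurable_fun setT f -> (forall x, 0 <= f x) ->
  \int[mu]_x f x = a%:E * \int[mu]_x f (a * x + b)%R.
Proof.
move=> a0 mf f0.
have mh : measurable_fun [set: measurableTypeR R]
    (fun x => (a * x + b)%R : measurableTypeR R).
  by apply: measurable_funD => //; exact: measurable_funM.
have := @ge0_integral_pushforward _ _ _ _ _ _ mh mu setT f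
  measurableT mf (fun y _ => f0 y).
rewrite preimage_setT => <-.
have a0' : (0 <= a)%R := ltW a0.
rewrite -[a]/((NngNum a0')%:num)%R -ge0_integral_mscale//=.
apply: eq_measure_integral => A mA _.
apply: lebesgue_measure_unique => // _ [[u v] _ <-].
rewrite /= /mscale /= /pushforward/=.
have -> : (fun x => a * x + b)%R @^-1` `]u, v] =
    `]((u - b) / a)%R, ((v - b) / a)%R]%classic :> set R.
  apply/seteqP; split => x /=;
  by rewrite !in_itv/= ltr_pdivrMr// ler_pdivlMr// ltrBlDr lerBrDr (mulrC x).
rewrite !lebesgue_measure_itv/= !lte_fin ltr_pM2r ?invr_gt0// ltrD2r.
case: ifP => _; last by rewrite mule0.
by rewrite -!EFinB -EFinM; congr EFin; field; rewrite gt_eqF.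
Qed.

Lemma ge0_integral_opp (f : measurableTypeR R -> \bar R) :
  measurable_fun setT f -> (forall x, 0 <= f x) ->
  \int[mu]_x f x = \int[mu]_x f (- x)%R.
Proof.
move=> mf f0.
have mh : measurable_fun [set: measurableTypeR R]
    (-%R : _ -> measurableTypeR R) by [].
have := @ge0_integral_pushforward _ _ _ _ _ _ mh mu setT f
  measurableT mf (fun y _ => f0 y).
rewrite preimage_setT => <-.
apply: eq_measure_integral => A mA _.
by rewrite -[LHS]lebesgue_measureN.
Qed.

End affine_substitution.

Section gaussian_integrals.
Context {R : realType} (s : R) (s0 : 0 < s).
Local Notation N := (normal_prob 0 s).
Local Notation mu := (@lebesgue_measure R).

Lemma measurable_fun_expR_quad (a b : R) :
  measurable_fun setT (fun x : measurableTypeR R => (expR (- (a * x ^+ 2 + 2 * b * x) / 2))%:E).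
Proof.
apply/measurable_EFinP; apply: measurableT_comp => //.
apply: measurable_funM => //; apply: measurableT_comp => //.
apply: measurable_funD.
  by apply: measurable_funM => //; exact: measurable_funX.
exact: measurable_funM.
Qed.

(** Completing the square turns the integrand times the density into a multiple of the density of
    [N(m', s'^2)]. The linear term carries the cross terms in the induction of [giid_expR_qform];
    negative [a] is used for the second moment. *)
Lemma integral_normal_expR_quad (a b : R) : 0 < 1 + a * s ^+ 2 ->
  (\int[N]_x (expR (- (a * x ^+ 2 + 2 * b * x) / 2))%:E =
   ((Num.sqrt (1 + a * s ^+ 2))^-1 *
    expR (b ^+ 2 * s ^+ 2 / (2 * (1 + a * s ^+ 2))))%:E)%E.
Proof.
move=> c0.
set c := 1 + a * s ^+ 2 in c0 *.
have q0 : 0 < Num.sqrt c by rewrite sqrtr_gt0.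
have q2 : Num.sqrt c ^+ 2 = c by rewrite sqr_sqrtr// ltW.
set q := Num.sqrt c in q0 q2 *.
have qn : q != 0 by rewrite gt_eqF.
have sn : s != 0 by rewrite gt_eqF.
have cn : c != 0 by rewrite gt_eqF.
rewrite ge0_integral_normal_prob; last 2 first.
- exact: measurable_fun_expR_quad.
- by move=> x; rewrite lee_fin expR_ge0.
pose m' := - (b * s ^+ 2 / c); pose s' := s / q.
have s'n : s' != 0 by rewrite mulf_neq0// invr_neq0.
transitivity (\int[mu]_x ((q^-1 * expR (b ^+ 2 * s ^+ 2 / (2 * c)))%:E *
    (normal_pdf m' s' x)%:E)%E)%E; last first.
  rewrite ge0_integralZl//; last 3 first.
  - by apply/measurable_EFinP; exact: measurable_normal_pdf.
  - by move=> x _; rewrite lee_fin normal_pdf_ge0.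
  - by rewrite lee_fin mulr_ge0 ?expR_ge0// invr_ge0 ltW.
  by rewrite integral_normal_pdf mule1.
apply: eq_integral => x _; rewrite -!EFinM; congr EFin.
rewrite !normal_pdfE// /normal_fun.
have -> : normal_peak s' = q * normal_peak s.
  rewrite /normal_peak -[q in RHS]invrK -invfM; congr (_^-1).
  rewrite -[q in RHS]ger0_norm ?ltW// -sqrtr_sqr -(sqrtrV (sqr_ge0 _)) -sqrtrM.
    by rewrite /s' expr_div_n; congr Num.sqrt; field.
  by rewrite invr_ge0 sqr_ge0.
transitivity (normal_peak s * (expR (b ^+ 2 * s ^+ 2 / (2 * c)) *
    expR (- (x - m') ^+ 2 / (s' ^+ 2 *+ 2)))); last by field.
rewrite mulrCA -!expRD; congr (_ * expR _).
rewrite /m' /s' expr_div_n q2 /c.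
by field; rewrite sn -/c cn.
Qed.

Lemma normal_probN (A : set R) : measurable A -> N [set - x | x in A] = N A.
Proof.
move=> mA.
have mN : measurable (-%R @^-1` A).
  by rewrite -[X in measurable X]setTI; exact: (oppr_measurable measurableT).
have -> : [set - x | x in A] = -%R @^-1` A.
  apply/seteqP; split => x /= => [[y Ay <-]|Ax]; first by rewrite opprK.
  by exists (- x) => //; rewrite opprK.
rewrite /normal_prob [RHS]integral_mkcond [LHS]integral_mkcond.
rewrite [RHS]ge0_integral_opp; last 2 first.
- rewrite epatch_indic; apply: emeasurable_funM.
    by apply/measurable_EFinP; exact: measurable_normal_pdf.
  by apply/measurable_EFinP; exact: measurable_indic.
- by move=> x; rewrite patchE; case: ifP => // _; rewrite lee_fin normal_pdf_ge0.
apply: eq_integral => x _; rewrite !epatch_indic/= !indicE.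
have -> : (x \in -%R @^-1` A) = (- x \in A).
  by apply/idP/idP; rewrite !inE.
congr ((_)%:E * _)%E; rewrite !normal_pdfE ?gt_eqF//.
by rewrite /normal_fun !subr0 sqrrN.
Qed.

End gaussian_integrals.

(** A second-order bound on the Laplace transform near 0, from which the second moment is
    extracted. *)
Lemma sqrtrV_le (R : realType) (y : R) : `|y| <= 1 / 2 ->
  (Num.sqrt (1 - y))^-1 <= 1 + y / 2 + y ^+ 2.
Proof.
rewrite ler_norml => /andP[y1 y2].
have y0 : 0 < 1 - y by lra.
have q0 : 0 < Num.sqrt (1 - y) by rewrite sqrtr_gt0.
have E : Num.sqrt (1 - y) ^+ 2 = 1 - y by rewrite sqr_sqrtr// ltW.
rewrite -[leLHS]mul1r ler_pdivrMr//.
have p0 : 0 <= 1 + y / 2 + y ^+ 2 by have := sqr_ge0 y; lra.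
rewrite -(@ler_pXn2r _ 2)// ?nnegrE//; last by rewrite mulr_ge0// ltW.
rewrite expr1n exprMn E.
have -> : (1 + y / 2 + y ^+ 2) ^+ 2 * (1 - y) =
  1 + y ^+ 2 * (5 / 4 * (1 - y) - y ^+ 3) by field.
rewrite lerDl mulr_ge0 ?sqr_ge0//.
have : y ^+ 3 <= 1 / 4.
  have -> : y ^+ 3 = y * y ^+ 2 by ring.
  have : y ^+ 2 <= 1 / 4 by nra.
  have := sqr_ge0 y; nra.
lra.
Qed.

(** A single variable is a family indexed by [unit], so results on families also transport integrals
    of one variable. *)
Lemma mutual_indep_unit (R : realType) d (T : measurableType d)
  (P : probability T R) (f : T -> R) : mutual_indep P (fun _ : unit => f).
Proof.
move=> B mB; rewrite (big_pred1 tt) => [|[]//].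
by congr (P _); apply/seteqP; split => t /= => [H|H []//]; exact: (H tt).
Qed.

Lemma has_mean_comp (R : realType) d (T : measurableType d)
    d' (T' : measurableType d') (P : probability T R) (P' : probability T' R)
    (X : T -> R) (X' : T' -> R) (f : R -> R) m :
  measurable_fun setT X -> measurable_fun setT X' ->
  (forall A, measurable A -> P (X @^-1` A) = P' (X' @^-1` A)) ->
  measurable_fun setT f -> has_mean P' (fun t => f (X' t)) m ->
  has_mean P (fun t => f (X t)) m.
Proof.
move=> mX mX' XX' mf.
apply: (@has_mean_same_law R unit _ _ P _ _ P' (fun=> X) (fun=> X')
  (fun=> mX) (fun=> mX') (fun=> XX') (mutual_indep_unit _ _)
  (mutual_indep_unit _ _) (fun z => f (z tt))).
by apply: measurableT_comp mf _; exact: measurable_coord.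
Qed.

Section normal_moments.
Context {R : realType} (s : R) (s0 : 0 < s).
Local Notation N := (normal_prob 0 s).

Let M := (\int[N]_x (x ^+ 2)%:E)%E.

Let msq : measurable_fun [set: measurableTypeR R] (fun x => (x ^+ 2)%:E).
Proof. by apply/measurable_EFinP; exact: measurable_funX. Qed.

(** The second moment is squeezed by integrating [1 + y <= exp y] at [y = u x^2 / 2] and at
    [y = - u x^2 / 2], which avoids differentiating under the integral. The upper bound also yields
    the finiteness that the subtraction in the lower bound relies on. *)
Let Mbound_pos (u : R) : 0 < u -> u * s ^+ 2 <= 1 / 2 ->
  (M <= (s ^+ 2 + 2 * u * s ^+ 4)%:E)%E.
Proof.
move=> u0 us.
have s2 : 0 < s ^+ 2 by rewrite exprn_gt0.
have H : (1 + (u / 2)%:E * M <= (1 + (u * s ^+ 2) / 2 + (u * s ^+ 2) ^+ 2)%:E)%E.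
  apply: (@le_trans _ _ (\int[N]_x (expR (- (- u * x ^+ 2 + 2 * 0 * x) / 2))%:E)%E).
    rewrite /M -ge0_integralZl//=; last 2 first.
    - by move=> x _; rewrite lee_fin sqr_ge0.
    - by rewrite lee_fin divr_ge0 ?ltW.
    have <- : (\int[N]_x 1 = 1)%E.
      by rewrite integral_cst// mul1e; exact: probability_setT.
    rewrite -ge0_integralD//; last 2 first.
    - move=> x _; rewrite -EFinM lee_fin mulr_ge0 ?sqr_ge0//.
      by rewrite divr_ge0// ltW.
    - by apply/measurable_EFinP; apply: measurable_funM => //; exact: measurable_funX.
    apply: ge0_le_integral => //.
    - move=> x _; rewrite -EFinM -EFinD lee_fin addr_ge0// mulr_ge0 ?sqr_ge0//.
      by rewrite divr_ge0// ltW.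
    - apply/measurable_EFinP; apply: measurable_funD => //.
      by apply: measurable_funM => //; exact: measurable_funX.
    - exact: measurable_fun_expR_quad.
    - move=> x _; rewrite -EFinM -EFinD lee_fin.
      have -> : - (- u * x ^+ 2 + 2 * 0 * x) / 2 = u / 2 * x ^+ 2 by field.
      exact: expR_ge1Dx.
  rewrite integral_normal_expR_quad//; last by nra.
  rewrite lee_fin expr0n/= !mul0r expR0 mulr1 mulNr.
  apply: sqrtrV_le; rewrite ger0_norm// mulr_ge0// ltW//.
have : M \is a fin_num.
  have M0 : (0 <= M)%E by apply: integral_ge0 => x _; rewrite lee_fin sqr_ge0.
  rewrite ge0_fin_numE// ltNge leye_eq; apply/negP => /eqP My.
  by move: H; rewrite My gt0_muley ?lte_fin ?divr_gt0// addey.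
move=> Mf; move: H; rewrite -(fineK Mf) -EFinM -EFinD !lee_fin => H.
rewrite -(ler_pM2l (divr_gt0 u0 (ltr0n _ 2)))//.
rewrite [leRHS](_ : _ = u * s ^+ 2 / 2 + (u * s ^+ 2) ^+ 2); first lra.
by field.
Qed.

Let Mfin : M \is a fin_num.
Proof.
have M0 : (0 <= M)%E by apply: integral_ge0 => x _; rewrite lee_fin sqr_ge0.
have s2 : 0 < s ^+ 2 by rewrite exprn_gt0.
rewrite ge0_fin_numE//; apply: le_lt_trans (@Mbound_pos (1 / 2 / s ^+ 2) _ _) (ltry _).
  by rewrite divr_gt0.
by rewrite divfK// gt_eqF.
Qed.

Let Mint : (normal_prob 0 s).-integrable setT (fun x : R => (x ^+ 2)%:E).
Proof.
apply/integrableP; split => //.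
under eq_integral => x _ do rewrite gee0_abs ?lee_fin ?sqr_ge0//.
by rewrite -/M ltey_eq Mfin.
Qed.

Let Mbound_neg (u : R) : 0 < u -> u * s ^+ 2 <= 1 / 2 ->
  s ^+ 2 - 2 * u * s ^+ 4 <= fine M.
Proof.
move=> u0 us.
have s2 : 0 < s ^+ 2 by rewrite exprn_gt0.
have H : (1 - (u / 2)%:E * M <= (1 - (u * s ^+ 2) / 2 + (u * s ^+ 2) ^+ 2)%:E)%E.
  apply: (@le_trans _ _ (\int[N]_x (expR (- (u * x ^+ 2 + 2 * 0 * x) / 2))%:E)%E).
    rewrite /M -integralZl//=.
    have <- : (\int[N]_x 1 = 1)%E.
      by rewrite integral_cst// mul1e; exact: probability_setT.
    rewrite -integralB//; last 2 first.
    - exact: finite_measure_integrable_cst.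
    - exact: integrableZl.
    apply: le_integral => //.
    - apply: integrableB => //; first exact: finite_measure_integrable_cst.
      exact: integrableZl.
    - apply/integrableP; split; first exact: measurable_fun_expR_quad.
      under eq_integral => x _ do rewrite gee0_abs ?lee_fin ?expR_ge0//.
      by rewrite integral_normal_expR_quad ?ltry//; nra.
    - move=> x _; rewrite -EFinM -EFinB lee_fin.
      have -> : - (u * x ^+ 2 + 2 * 0 * x) / 2 = - (u / 2 * x ^+ 2) by field.
      exact: expR_ge1Dx.
  rewrite integral_normal_expR_quad//; last by nra.
  rewrite lee_fin expr0n/= !mul0r expR0 mulr1.
  have := @sqrtrV_le R (- (u * s ^+ 2)); rewrite opprK sqrrN mulNr; apply.
  by rewrite normrN ger0_norm// mulr_ge0// ltW.
move: H; rewrite -(fineK Mfin) -EFinM -EFinB !lee_fin => H.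
rewrite -(ler_pM2l (divr_gt0 u0 (ltr0n _ 2)))//.
rewrite [leLHS](_ : _ = u * s ^+ 2 / 2 - (u * s ^+ 2) ^+ 2); first lra.
by field.
Qed.

Lemma normal_second_moment : has_mean N (fun x => x ^+ 2) (s ^+ 2).
Proof.
split; first exact: Mint.
rewrite -/M -(fineK Mfin); congr EFin.
have s2 : 0 < s ^+ 2 by rewrite exprn_gt0.
have s4 : 0 < s ^+ 4 by rewrite exprn_gt0.
apply/eqP; rewrite -subr_eq0 -normr_le0; apply/ler_addgt0Pl => e e0.
rewrite addr0.
pose u := Num.min (1 / 2 / s ^+ 2) (e / (2 * s ^+ 4)).
have u0 : 0 < u by rewrite lt_min !divr_gt0// mulr_gt0.
have us : u * s ^+ 2 <= 1 / 2 by rewrite -ler_pdivlMr// ge_min lexx.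
have ue : 2 * u * s ^+ 4 <= e.
  by rewrite mulrAC mulrC -ler_pdivlMr ?mulr_gt0// ge_min lexx orbT.
have := Mbound_pos u0 us; have := Mbound_neg u0 us.
rewrite -(fineK Mfin) lee_fin => h1 h2.
by rewrite ler_norml; apply/andP; split; lra.
Qed.

(** Integrability comes from [|x| <= 1 + x^2]; symmetry of the law makes the mean equal to its
    opposite. *)
Lemma normal_first_moment : has_mean N idfun 0.
Proof.
have xi : (normal_prob 0 s).-integrable setT (EFin \o idfun).
  have [H _] := has_meanD (has_mean_cst N 1) normal_second_moment.
  apply: le_integrable H => //; first by apply/measurable_EFinP; exact: measurable_id.
  move=> x _ /=; rewrite lee_fin (ger0_norm (addr_ge0 _ _)) ?sqr_ge0//.
  rewrite -(real_normK (num_real x)).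
  by have := sqr_ge0 (`|x| - 1); have := normr_ge0 x; nra.
have [m H] : exists m, has_mean N idfun m.
  exists (fine (\int[N]_x (EFin \o idfun) x)).
  by split=> //; rewrite fineK//; exact: integrable_fin_num.
have H' : has_mean N (fun x => idfun (- x)) (- m).
  by rewrite -mulN1r; apply: has_mean_ext (has_meanZ (-1) H) => x; rewrite mulN1r.
suff H2 : has_mean N idfun (- m).
  have m0 : m = 0 by have := has_mean_unique H H2; lra.
  by move: H; rewrite m0.
apply: (@has_mean_comp R _ _ _ _ N N idfun -%R idfun (- m) _ _ _ _ H') => //.
- exact: measurable_id.
- move=> A mA; rewrite -[RHS](normal_probN s0); last first.
    by rewrite -[X in measurable X]setTI; exact: (oppr_measurable measurableT).
  congr (N _); apply/seteqP; split => x /=.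
    by move=> Ax; exists (- x); rewrite /= ?opprK.
  by move=> [y Ay <-].
- exact: measurable_id.
Qed.

End normal_moments.

(** * Rotation by 45 degrees of two independent Gaussians *)

Section rotation.
Context {R : realType} (s : R) (s0 : 0 < s).
Local Notation N := (normal_prob 0 s).
Local Notation mu := (@lebesgue_measure R).
Local Notation r := (Num.sqrt (2 : R)).
Local Notation g := (normal_pdf 0 s).
Local Notation mR := (measurableTypeR R).
Local Open Scope ereal_scope.

Let r0 : (0 < r)%R. Proof. by rewrite sqrtr_gt0. Qed.
Let r2 : (r ^+ 2 = 2)%R. Proof. by rewrite sqr_sqrtr. Qed.
Let rn : (r != 0)%R. Proof. by rewrite gt_eqF. Qed.

Let g_rot x y : (g ((x - y) / r) * g ((x + y) / r) = g x * g y)%R.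
Proof.
rewrite !normal_pdfE ?gt_eqF// /normal_fun !subr0.
rewrite mulrACA [RHS]mulrACA -!expRD; congr (_ * expR _)%R.
rewrite !expr_div_n r2; field.
by rewrite gt_eqF.
Qed.

Lemma ge0_integral_normal_prob2 (h : mR * mR -> \bar R) :
  measurable_fun setT h -> (forall z, 0 <= h z) ->
  \int[N]_y \int[N]_x h (x, y) =
  \int[mu]_y \int[mu]_x (h (x, y) * (g x * g y)%:E).
Proof.
move=> mh h0.
have g0 x : 0 <= (g x)%:E by rewrite lee_fin normal_pdf_ge0.
have mg : measurable_fun [set: measurableTypeR R] (EFin \o g).
  by apply/measurable_EFinP; exact: measurable_normal_pdf.
have mhy y : measurable_fun [set: mR] (fun x => h (x, y)).
  by apply: measurableT_comp mh _; exact: pair2_measurable.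
rewrite ge0_integral_normal_prob; last 2 first.
- exact: (measurable_fun_fubini_tonelli_G (m1 := N) h mh h0).
- by move=> y; exact: integral_ge0.
apply: eq_integral => y _.
rewrite ge0_integral_normal_prob// -ge0_integralZr//; last 2 first.
- exact: emeasurable_funM.
- by move=> x _; rewrite mule_ge0.
by apply: eq_integral => x _; rewrite EFinM muleA.
Qed.

(** The rotation is factored into two substitutions in one variable: [x := r x - y] at fixed [y],
    then [y := (x + y) / r] at fixed [x]. Their Jacobians [r] and [1 / r] cancel, and [g_rot] gives
    the invariance of the density. *)
Lemma normal_prob_rotation (A B : set R) : measurable A -> measurable B ->
  (N \x N) [set z : mR * mR | A ((z.1 + z.2) / r)%R /\ B ((z.2 - z.1) / r)%R] =
  N A * N B.
Proof.
move=> mA mB.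
have mfst : measurable_fun [set: mR * mR] fst := measurable_fst.
have msnd : measurable_fun [set: mR * mR] snd := measurable_snd.
have mg : measurable_fun [set: mR] g := @measurable_normal_pdf R 0 s.
have mIA : measurable_fun [set: mR] (\1_A : mR -> R) := measurable_indic mA.
have mIB : measurable_fun [set: mR] (\1_B : mR -> R) := measurable_indic mB.
have g0 x : (0 <= g x)%R := normal_pdf_ge0 0 s x.
have I0 (C : set R) x : (0 <= (\1_C x : R))%R by [].
set E := [set z | _].
have mf1 : measurable_fun [set: mR * mR] (fun z => (z.1 + z.2) / r)%R.
  by apply: measurable_funM => //; exact: measurable_funD.
have mf2 : measurable_fun [set: mR * mR] (fun z => (z.2 - z.1) / r)%R.
  by apply: measurable_funM => //; exact: measurable_funB.
have mE : measurable E.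
  have -> : E = ((fun z : mR * mR => (z.1 + z.2) / r)%R @^-1` A) `&`
                ((fun z : mR * mR => (z.2 - z.1) / r)%R @^-1` B) by [].
  by apply: measurableI; rewrite -[X in measurable X]setTI; [exact: mf1|exact: mf2].
rewrite -[X in (N \x N) X]setIT -integral_indic//.
have mf : measurable_fun [set: mR * mR] (fun z => (\1_E z : R)%:E).
  by apply/measurable_EFinP; exact: measurable_indic.
rewrite fubini_tonelli2// /fubini_G.
have EE (x y : R) : (\1_E (x, y) = \1_A ((x + y) / r) * \1_B ((y - x) / r) :> R)%R.
  by rewrite !indicE -natrM mulnb; congr ((nat_of_bool _)%:R); apply/idP/andP; rewrite !inE.
have ind0 (z : mR * mR) : 0 <= (\1_E z : R)%:E by rewrite lee_fin.
rewrite [LHS](ge0_integral_normal_prob2 mf ind0).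
(* The integrand after the first substitution, without its Jacobian [r]. *)
pose h (x y : R) : R :=
  (\1_A x * \1_B (r * y - x) * (g (r * x - y) * g y))%R.
have h0 x y : (0 <= h x y)%R by rewrite !mulr_ge0.
have mh : measurable_fun [set: mR * mR] (fun z => (h z.1 z.2)%:E).
  apply/measurable_EFinP; apply: measurable_funM; apply: measurable_funM.
  - exact: measurableT_comp.
  - apply: measurableT_comp => //; apply: measurable_funB => //.
    exact: measurable_funM.
  - apply: measurableT_comp => //; apply: measurable_funB => //.
    exact: measurable_funM.
  - exact: measurableT_comp.
transitivity (\int[mu]_y \int[mu]_x (r%:E * (h x y)%:E)).
  apply: eq_integral => y _; rewrite ge0_integralZl//; last 2 first.
  - exact: (measurableT_comp mh (pair2_measurable y)).
  - by move=> x _; rewrite lee_fin; exact: h0.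
  rewrite (@ge0_integral_affine _ r (- y))//; last 2 first.
  - apply: emeasurable_funM.
      by apply: measurableT_comp mf _; exact: pair2_measurable.
    by apply/measurable_EFinP; exact: measurable_funM.
  - by move=> x; rewrite -EFinM lee_fin !mulr_ge0.
  congr (_ * _); apply: eq_integral => x _; rewrite EE -EFinM; congr EFin.
  have -> : ((r * x - y + y) / r = x)%R by rewrite subrK mulrC mulKf.
  have -> // : ((y - (r * x - y)) / r = r * y - x)%R.
  apply: (mulIf rn); rewrite divfK// mulrBl.
  have -> : (r * y * r = r ^+ 2 * y)%R by ring.
  by rewrite r2; ring.
have mrh : measurable_fun [set: mR * mR] (fun z => r%:E * (h z.1 z.2)%:E).
  exact: emeasurable_funM.
have rh0 z : 0 <= r%:E * (h z.1 z.2)%:E by rewrite -EFinM lee_fin mulr_ge0// ltW.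
rewrite -[LHS](@fubini_tonelli _ _ _ _ _ mu mu
  (fun z => r%:E * (h z.1 z.2)%:E) mrh rh0)/=.
transitivity (\int[mu]_x ((\1_A x * g x)%:E * \int[mu]_y (\1_B y * g y)%:E)).
  apply: eq_integral => x _; rewrite -ge0_integralZl//; last 3 first.
  - by apply/measurable_EFinP; exact: measurable_funM.
  - by move=> y _; rewrite lee_fin mulr_ge0.
  - by rewrite lee_fin mulr_ge0.
  rewrite (@ge0_integral_affine _ r^-1 (x / r)); last 3 first.
  - by rewrite invr_gt0.
  - exact: (measurableT_comp mrh (pair1_measurable x)).
  - by move=> y; exact: (rh0 (x, y)).
  rewrite -ge0_integralZl//; last 2 first.
  - have mrhx : measurable_fun [set: mR] (fun y => r%:E * (h x y)%:E).
      exact: (measurableT_comp mrh (pair1_measurable x)).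
    have ma : measurable_fun [set: mR] (fun y => (r^-1 * y + x / r)%R : mR).
      by apply: measurable_funD => //; exact: measurable_funM.
    exact: (measurableT_comp mrhx ma).
  - by move=> y _; exact: (rh0 (x, (r^-1 * y + x / r)%R)).
  apply: eq_integral => y _; rewrite -!EFinM; congr EFin.
  rewrite mulKf// /h.
  have -> : (r * (r^-1 * y + x / r) - x = y)%R by field.
  have -> : (r * x - (r^-1 * y + x / r) = (x - y) / r)%R.
    apply: (mulIf rn); rewrite divfK// mulrBl.
    have -> : (r * x * r = r ^+ 2 * x)%R by ring.
    by rewrite r2; field.
  have -> : (r^-1 * y + x / r = (x + y) / r)%R by field.
  by rewrite g_rot; ring.
rewrite ge0_integralZr//; last 3 first.
- by apply/measurable_EFinP; exact: measurable_funM.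
- by move=> x _; rewrite lee_fin mulr_ge0.
- by apply: integral_ge0 => y _; rewrite lee_fin mulr_ge0.
have NE (C : set R) : N C = \int[mu]_x (\1_C x * g x)%:E.
  rewrite /normal_prob integral_mkcond epatch_indic.
  by apply: eq_integral => x _; rewrite /= -EFinM mulrC.
by rewrite !NE.
Qed.

End rotation.

(** * Independent Gaussian families *)

Lemma ge0_integral_comp_law (R : realType) d (T : measurableType d)
    d' (T' : measurableType d') (P : probability T R) (P' : probability T' R)
    (X : T -> R) (X' : T' -> R) (f : R -> \bar R) :
  measurable_fun setT X -> measurable_fun setT X' ->
  (forall A, measurable A -> P (X @^-1` A) = P' (X' @^-1` A)) ->
  measurable_fun setT f -> (forall x, 0 <= f x)%E ->
  (\int[P]_t f (X t) = \int[P']_t f (X' t))%E.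
Proof.
move=> mX mX' XX' mf f0.
apply: (@ge0_integral_same_law R unit _ _ P _ _ P' (fun=> X) (fun=> X')
  (fun=> mX) (fun=> mX') (fun=> XX') (mutual_indep_unit _ _)
  (mutual_indep_unit _ _) (fun z => f (z tt))) => //.
by apply: measurableT_comp mf _; exact: measurable_coord.
Qed.

Section gaussian_families.
Context {R : realType} (s : R) (s0 : 0 < s).
Local Notation N := (normal_prob 0 s).

Definition giid d (T : measurableType d) (P : probability T R) (I : finType)
    (Z : I -> T -> R) :=
  [/\ forall i, measurable_fun setT (Z i),
      forall i A, measurable A -> P (Z i @^-1` A) = N A &
      mutual_indep P Z].

Section basics.
Context d (T : measurableType d) (P : probability T R) (I : finType).
Variables (Z : I -> T -> R) (gZ : giid P Z).

Lemma giid_measurable i : measurable_fun setT (Z i). Proof. by case: gZ. Qed.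

Lemma giid_inj (K : finType) (h : K -> I) :
  injective h -> giid P (fun k => Z (h k)).
Proof.
case: gZ => mZ nZ iZ hI; split; last exact: (mutual_indep_inj hI iZ).
  by move=> k; exact: mZ.
by move=> k A mA; exact: nZ.
Qed.

Lemma giid_mean i : has_mean P (Z i) 0.
Proof.
case: gZ => mZ nZ _.
have := normal_first_moment s0.
apply: (@has_mean_comp _ _ _ _ _ _ N (Z i) idfun idfun) => //.
- exact: measurable_id.
- exact: nZ.
- exact: measurable_id.
Qed.

Lemma giid_second_moment i : has_mean P (fun t => Z i t ^+ 2) (s ^+ 2).
Proof.
case: gZ => mZ nZ _.
have := normal_second_moment s0.
apply: (@has_mean_comp _ _ _ _ _ _ N (Z i) idfun (fun x => x ^+ 2)) => //.
- exact: measurable_id.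
- exact: nZ.
Qed.

Lemma ge0_integral_giid d' (T' : measurableType d') (P' : probability T' R)
    (Z' : I -> T' -> R) (f : famType R I -> \bar R) : giid P' Z' ->
  measurable_fun setT f -> (forall z, 0 <= f z)%E ->
  (\int[P]_t f (fun i => Z i t) = \int[P']_t f (fun i => Z' i t))%E.
Proof.
case: gZ => mZ nZ iZ [mZ' nZ' iZ'] mf f0.
by apply: ge0_integral_same_law => // i A mA; rewrite nZ ?nZ'.
Qed.

Lemma has_mean_giid d' (T' : measurableType d') (P' : probability T' R)
    (Z' : I -> T' -> R) (f : famType R I -> R) m : giid P' Z' ->
  measurable_fun setT f ->
  has_mean P' (fun t => f (fun i => Z' i t)) m ->
  has_mean P (fun t => f (fun i => Z i t)) m.
Proof.
case: gZ => mZ nZ iZ [mZ' nZ' iZ'] mf.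
by apply: has_mean_same_law => // i A mA; rewrite nZ ?nZ'.
Qed.

Lemma ge0_integral_giid_resample (J : pred I) (f : famType R I -> \bar R) :
  measurable_fun setT f -> (forall z, (0 <= f z)%E) ->
  (\int[P]_t f (fun i => Z i t) =
   \int[P]_t \int[P]_t' f (fun i => if J i then Z i t else Z i t'))%E.
Proof. by case: gZ => mZ nZ iZ; exact: ge0_integral_resample. Qed.

Lemma giid_sign (e : I -> bool) :
  giid P (fun i t => if e i then - Z i t else Z i t).
Proof.
case: gZ => mZ nZ iZ; split.
- by move=> i; case: (e i) => //; exact: measurableT_comp.
- move=> i A mA; case: (e i); last exact: nZ.
  rewrite -(normal_probN s0 mA) -(nZ i); last first.
    have -> : [set - x | x in A] = -%R @^-1` A.
      apply/seteqP; split => x /= => [[y Ay <-]|Ax]; first by rewrite opprK.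
      by exists (- x) => //; rewrite opprK.
    by rewrite -[X in measurable X]setTI; exact: (oppr_measurable measurableT).
  congr (P _); apply/seteqP; split => t /=.
    by move=> At; exists (- Z i t) => //; rewrite opprK.
  by move=> [x Ax <-]; rewrite opprK.
- move=> B mB.
  pose B' i := if e i then -%R @^-1` B i else B i.
  have mB' i : measurable (B' i).
    rewrite /B'; case: (e i) => //.
    by rewrite -[X in measurable X]setTI; exact: (oppr_measurable measurableT).
  have := iZ B' mB'; rewrite /B'.
  congr (P _ = _); last by apply: eq_bigr => i _; case: (e i).
  by apply: eq_bigcapr => i _; case: (e i).
Qed.

(** The pair [k], [l] has law [N x N], where the planar case applies. On the merged copy this pair
    and the remaining variables live on separate factors, so their probabilities multiply. *)
Lemma giid_rotation (k l : I) : k != l ->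
  giid P (fun i t => if i == k then (Z k t + Z l t) / Num.sqrt 2
                     else if i == l then (Z l t - Z k t) / Num.sqrt 2
                     else Z i t).
Proof.
move=> kl; case: gZ => mZ nZ iZ.
set W := fun i t => _.
have mW i : measurable_fun setT (W i).
  rewrite /W; case: (i == k); first by apply: measurable_funM => //; exact: measurable_funD.
  by case: (i == l) => //; apply: measurable_funM => //; exact: measurable_funB.
pose r : R := Num.sqrt 2.
have Hkl (A B : set R) : measurable A -> measurable B ->
  P [set t | A ((Z k t + Z l t) / r) /\ B ((Z l t - Z k t) / r)] = (N A * N B)%E.
  move=> mA mB; rewrite -normal_prob_rotation//.
  pose E : set (famType R bool) :=
    [set z | A ((z true + z false) / r) /\ B ((z false - z true) / r)].
  have mE : measurable E.
    have -> : E = ((fun z : famType R bool => (z true + z false) / r) @^-1` A) `&`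
      ((fun z : famType R bool => (z false - z true) / r) @^-1` B) by [].
    have mc := @measurable_coord R bool.
    have m1 : measurable_fun setT (fun z : famType R bool => (z true + z false) / r).
      by apply: measurable_funM => //; exact: measurable_funD.
    have m2 : measurable_fun setT (fun z : famType R bool => (z false - z true) / r).
      by apply: measurable_funM => //; exact: measurable_funB.
    by apply: measurableI; rewrite -[X in measurable X]setTI; [exact: m1|exact: m2].
  have hI : injective (fun b : bool => if b then k else l).
    by move=> [] [] //= kl'; move: kl; rewrite kl' eqxx.
  pose U b (z : measurableTypeR R * measurableTypeR R) := if b then z.1 else z.2.
  have mU b : measurable_fun setT (U b).
    by case: b; [exact: measurable_fst|exact: measurable_snd].
  have nU b A' : measurable A' -> (N \x N)%E (U b @^-1` A') = N A'.
    move=> mA'; case: b.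
      have -> : U true @^-1` A' = A' `*` setT.
        by apply/seteqP; split => -[x y] //= [].
      rewrite product_measure1E//.
      by rewrite [X in (_ * X)%E](probability_setT N) mule1.
    have -> : U false @^-1` A' = setT `*` A'.
      by apply/seteqP; split => -[x y] //= [].
    rewrite product_measure1E//.
    by rewrite [X in (X * _)%E](probability_setT N) mul1e.
  have iU : mutual_indep (N \x N)%E U.
    move=> C mC; rewrite big_bool/= !nU; [|exact: (mC false)|exact: (mC true)].
    have -> : \bigcap_(b in [set: bool]) (U b @^-1` C b) = C true `*` C false.
      apply/seteqP; split => -[x y] /=.
        by move=> H; split; [exact: (H true)|exact: (H false)].
      by move=> [? ?] [].
    rewrite [LHS]product_measure1E; [by []|exact: (mC true)|exact: (mC false)].
  have := @probability_same_law R bool _ T P _ _ (N \x N)%E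
    (fun b : bool => Z (if b then k else l)) U (fun b => mZ _) mU _
    (mutual_indep_inj hI iZ) iU E mE.
  by apply => b A' mA'; rewrite nZ//; apply/esym/nU.
have H (B : I -> set R) : (forall i, measurable (B i)) ->
  P (\bigcap_(i in [set: I]) (W i @^-1` B i)) = (\prod_i N (B i))%E.
  move=> mB.
  pose J i := (i == k) || (i == l).
  have [marg iM] := mutual_indep_merge J mZ mZ iZ iZ.
  pose w (z : famType R I) i := if i == k then (z k + z l) / r
    else if i == l then (z l - z k) / r else z i.
  have mw i : measurable_fun setT (w^~ i).
    have mc := @measurable_coord R I.
    rewrite /w; case: (i == k); first by apply: measurable_funM => //; exact: measurable_funD.
    by case: (i == l) => //; apply: measurable_funM => //; exact: measurable_funB.
  pose E : set (famType R I) := \bigcap_(i in [set: I]) (w^~ i @^-1` B i).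
  have mE : measurable E.
    apply: fin_bigcap_measurable => // i _.
    by rewrite -[X in measurable X]setTI; exact: mw.
  have -> : \bigcap_(i in [set: I]) (W i @^-1` B i) = [set t | E (fun i => Z i t)].
    by [].
  rewrite (@probability_same_law R I _ T P _ _ (P \x P)%E Z (merge_fam J Z Z)
    mZ (measurable_merge_fam J mZ mZ) _ iZ iM E mE); last first.
    by move=> i A mA; rewrite [RHS]marg//; case: ifP.
  pose C i := if J i then setT else B i.
  have mC i : measurable (C i) by rewrite /C; case: ifP.
  have -> : [set t | E (fun i => merge_fam J Z Z i t)] =
     [set t | B k ((Z k t + Z l t) / r) /\ B l ((Z l t - Z k t) / r)] `*`
     (\bigcap_(i in [set: I]) (Z i @^-1` C i)).
    have lk : (l == k) = false by rewrite eq_sym (negbTE kl).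
    apply/seteqP; split => -[t t'] /=.
      move=> Et; split; first split.
      - by have := Et k Logic.I; rewrite /w /merge_fam /J /= !eqxx orbT.
      - by have := Et l Logic.I; rewrite /w /merge_fam /J /= lk !eqxx.
      move=> i _ /=; have := Et i Logic.I; rewrite /w /merge_fam /C /J /=.
      by case: (i == k); case: (i == l).
    move=> [[E1 E2] E3] i _ /=; rewrite /w /merge_fam /= /J !eqxx /= lk orbT.
    have := E3 i Logic.I; rewrite /C /J /=.
    by case: (eqVneq i k) => [->|]//; case: (eqVneq i l) => [->|].
  rewrite [LHS]product_measure1E; last 2 first.
  - have m1 : measurable_fun setT (fun t => (Z k t + Z l t) / r).
      by apply: measurable_funM => //; exact: measurable_funD.
    have m2 : measurable_fun setT (fun t => (Z l t - Z k t) / r).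
      by apply: measurable_funM => //; exact: measurable_funB.
    by apply: measurableI; rewrite -[X in measurable X]setTI; [exact: m1|exact: m2].
  - apply: fin_bigcap_measurable => // i _.
    by rewrite -[X in measurable X]setTI; exact: mZ.
  rewrite [X in (X * _)%E](Hkl _ _ (mB k) (mB l)) [X in (_ * X)%E](iZ _ mC).
  have lk : l != k by rewrite eq_sym.
  have CT i : J i -> P (Z i @^-1` C i) = 1%E.
    by rewrite /C => ->; rewrite preimage_setT probability_setT.
  rewrite [RHS](bigD1 k)//= (bigD1 l lk)/= muleA; congr (_ * _)%E.
  rewrite (bigD1 k)//= (bigD1 l lk)/= !CT /J ?eqxx ?orbT// !mul1e.
  by apply: eq_bigr => i /andP[/negbTE ik /negbTE il]; rewrite /C /J ik il nZ.
(* Marginals are read off the joint formula by taking the whole line in every other coordinate. *)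
have nW i A : measurable A -> P (W i @^-1` A) = N A.
  move=> mA; pose B j := if j == i then A else setT.
  have mB j : measurable (B j) by rewrite /B; case: ifP.
  have -> : W i @^-1` A = \bigcap_(j in [set: I]) (W j @^-1` B j).
    apply/seteqP; split => t /=.
      by move=> At j _; rewrite /B /=; case: eqP => // ->.
    by move=> /(_ i Logic.I); rewrite /B /= eqxx.
  rewrite H// (bigD1 i)//= /B eqxx big1 ?mule1// => j /negbTE ->.
  exact: (probability_setT N).
by split => // B mB; rewrite H//; apply: eq_bigr => i _; rewrite nW.
Qed.

End basics.
End gaussian_families.

(** * Determinants, Schur complements and idempotents *)

Section matrix_facts.
Context {F : fieldType}.

Lemma det_schur n (M : 'M[F]_(1 + n)) : M 0 0 != 0 ->
  \det M = M 0 0 * \det (drsubmx M - (M 0 0)^-1 *: (dlsubmx M *m ursubmx M)).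
Proof.
set c := M 0 0 => c0.
have E : ulsubmx M = c%:M.
  apply/matrixP => i j; rewrite !ord1 !mxE eqxx mulr1n /c.
  by congr (M _ _); apply: val_inj.
rewrite -[in LHS](submxK M) E.
have -> : block_mx c%:M (ursubmx M) (dlsubmx M) (drsubmx M) =
  block_mx 1%:M 0 (c^-1 *: dlsubmx M) 1%:M *m
  block_mx c%:M (ursubmx M) 0
    (drsubmx M - c^-1 *: (dlsubmx M *m ursubmx M)).
  rewrite mulmx_block !mul1mx !mul0mx !addr0 -!scalemxAl.
  rewrite mul_mx_scalar scalerA mulVf// scale1r.
  by rewrite addrC subrK.
by rewrite det_mulmx det_lblock det_ublock !det1 !mul1r det_scalar1.
Qed.

(** Sylvester's identity: two triangular factorisations of one block matrix. *)
Lemma det_1D_mulmx m k (U : 'M[F]_(m, k)) (V : 'M[F]_(k, m)) :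
  \det (1%:M + U *m V) = \det (1%:M + V *m U).
Proof.
have E1 : block_mx 1%:M (- U) V 1%:M =
    block_mx (1%:M + U *m V) (- U) 0 1%:M *m block_mx 1%:M 0 V 1%:M.
  by rewrite mulmx_block !mul1mx !mulmx1 !mul0mx mulmx0 !add0r mulNmx addrK.
have E2 : block_mx 1%:M (- U) V 1%:M =
    block_mx 1%:M 0 V 1%:M *m block_mx 1%:M (- U) 0 (1%:M + V *m U).
  rewrite mulmx_block !mul1mx !mulmx1 !mul0mx !addr0 mulmxN.
  by rewrite addrC addrK.
have := congr1 determinant E1; rewrite {1}E2 !det_mulmx !det_lblock !det_ublock.
by rewrite !det1 !mul1r !mulr1.
Qed.

Section idempotent.
Variables (m : nat) (A : 'M[F]_m) (AA : A *m A = A).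

(** In the full-rank factorisation [A = C R], the relation [C R C R = C R] cancels to [R C = 1];
    trace and determinant then reduce to matrices of size [\rank A]. *)
Let base1 : row_base A *m col_base A = 1%:M.
Proof.
apply: (row_full_inj (col_base_full A)); apply: (row_free_inj (row_base_free A)).
by rewrite mulmx1 mulmxA mulmx_base -mulmxA mulmx_base.
Qed.

Lemma mxtrace_idem : \tr A = (\rank A)%:R.
Proof. by rewrite -{1}(mulmx_base A) mxtrace_mulC base1 mxtrace1. Qed.

Lemma det_1D_idem a : \det (1%:M + a *: A) = (1 + a) ^+ \rank A.
Proof.
rewrite -{1}(mulmx_base A) scalemxAl det_1D_mulmx -scalemxAr base1.
by rewrite scalemx1 -(raddfD (@scalar_mx F _)) det_scalar.
Qed.

End idempotent.
End matrix_facts.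

(** * Powers and exponentials integrated over the half-line *)

Section power_integral.
Context {R : realType}.
Local Notation mu := (@lebesgue_measure R).

(** The integrand is [(1 + c u)^(-p)], written with [expR] and [ln] because the exponent will be
    half a rank. *)
Lemma integral_power (c p : R) : 0 < c -> 1 < p ->
  (\int[mu]_(u in `[0%R, +oo[) (expR (- p * ln (1 + c * u)))%:E =
   (c * (p - 1))^-1%:E)%E.
Proof.
move=> c0 p1.
have p10 : 0 < p - 1 by rewrite subr_gt0.
pose F (u : R) : R := - (c * (p - 1))^-1 * expR (- (p - 1) * ln (1 + c * u)).
have pos (u : R) : 0 <= u -> 0 < 1 + c * u by move=> u0; nra.
have dF (u : R) : 0 <= u -> is_derive u 1 F (expR (- p * ln (1 + c * u))).
  move=> u0; have dln := is_derive1_ln (pos u u0).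
  have H : is_derive u 1 (fun u : R => 1 + c * u) c.
    by apply: is_derive_eq; rewrite scaler1 add0r; ring.
  have H2 : is_derive u 1 (fun u : R => ln (1 + c * u)) ((1 + c * u)^-1 * c).
    exact: is_derive1_comp.
  have H3 : is_derive u 1 (fun u : R => - (p - 1) * ln (1 + c * u))
      (- (p - 1) * ((1 + c * u)^-1 * c)).
    exact: is_deriveZ.
  have H4 : is_derive u 1 (fun u : R => expR (- (p - 1) * ln (1 + c * u)))
      (expR (- (p - 1) * ln (1 + c * u)) * (- (p - 1) * ((1 + c * u)^-1 * c))).
    exact: is_derive1_comp.
  have H5 : is_derive u 1 F (- (c * (p - 1))^-1 *
      (expR (- (p - 1) * ln (1 + c * u)) * (- (p - 1) * ((1 + c * u)^-1 * c)))).
    exact: is_deriveZ.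
  apply: (is_derive_eq H5).
  have -> : - p * ln (1 + c * u) =
      - (p - 1) * ln (1 + c * u) + - ln (1 + c * u) by ring.
  rewrite expRD expRN lnK ?posrE ?pos//.
  field; rewrite !gt_eqF ?pos//; rewrite -subr_gt0//.
have cF (u : R) : 0 <= u -> {for u, continuous F}.
  move=> /dF H; apply: differentiable_continuous; apply/derivable1_diffP.
  exact: ex_derive.
have cf (u : R) : 0 <= u -> {for u, continuous (fun u : R => expR (- p * ln (1 + c * u)))}.
  move=> u0; apply: continuous_comp; last exact: continuous_expR.
  apply: continuousM; first exact: cst_continuous.
  apply: continuous_comp; last exact: continuous_ln (pos u u0).
  apply: continuousD; first exact: cst_continuous.
  by apply: continuousM; [exact: cst_continuous|exact: cvg_id].
rewrite (@ge0_continuous_FTC2y _ _ F 0 0).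
- by rewrite sub0e /F mulr0 addr0 ln1 mulr0 expR0 mulr1 -EFinN opprK.
- by move=> u _; exact: expR_ge0.
- apply/continuous_within_itvcyP; split.
    by move=> u; rewrite in_itv/= andbT => /ltW /cf.
  by apply: cvg_at_right_filter; exact: cf.
- rewrite -[X in _ --> X](mulr0 (- (c * (p - 1))^-1)).
  apply: cvgM; first exact: cvg_cst.
  under eq_fun do rewrite mulNr.
  apply: (@cvg_comp _ _ _ (fun u => (p - 1) * ln (1 + c * u)) (fun x => expR (- x))
    _ (+oo)%R); last exact: cvgr_expR.
  apply/cvgryPge => A; near=> u.
  have u0 : 0 <= u by near: u; apply: nbhs_pinfty_ge; rewrite num_real.
  rewrite mulrC -ler_pdivrMr// -[leLHS]expRK ler_ln ?posrE ?expR_gt0 ?pos//.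
  rewrite -lerBlDl (mulrC c) -ler_pdivrMr//.
- by move=> u /ltW /dF H; exact: ex_derive.
- by apply: cvg_at_right_filter; exact: cF.
- move=> u; rewrite in_itv/= andbT => /ltW /dF H.
  by rewrite derive1E; exact: derive_val.
Unshelve. all: by end_near. Qed.

(** The integral dominates those with exponent [1 + e], whose value [1 / (c e)] is unbounded as [e]
    tends to 0. *)
Lemma integral_powery (c p : R) : 0 < c -> p <= 1 ->
  (\int[mu]_(u in `[0%R, +oo[) (expR (- p * ln (1 + c * u)))%:E = +oo)%E.
Proof.
move=> c0 p1; apply/eqyP => A A0.
pose e := (c * A)^-1.
have e0 : 0 < e by rewrite invr_gt0 mulr_gt0.
have mpow (q : R) : measurable_fun (`[0, +oo[%classic : set (measurableTypeR R))
    (fun u : measurableTypeR R => (expR (- q * ln (1 + c * u)))%:E).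
  apply/measurable_EFinP; apply: measurable_funTS; apply: measurableT_comp => //.
  apply: measurable_funM => //; apply: measurableT_comp => //.
  by apply: measurable_funD => //; exact: measurable_funM.
apply: (@le_trans _ _ (\int[mu]_(u in `[0%R, +oo[)
   (expR (- (1 + e) * ln (1 + c * u)))%:E)%E).
  rewrite integral_power//; last by rewrite ltrDl.
  rewrite addrAC subrr add0r lee_fin (_ : (c * e)^-1 = A)//.
  by rewrite /e; field; rewrite !gt_eqF.
apply: ge0_le_integral => //.
move=> u; rewrite /= in_itv/= andbT => u0; rewrite lee_fin ler_expR.
  rewrite ler_wpM2r ?ln_ge0//; last by rewrite lerN2; lra.
  by rewrite lerDl mulr_ge0// ltW.
Qed.

Lemma integral_expR_half (q : R) : 0 < q ->
  (\int[mu]_(u in `[0%R, +oo[) (expR (- (u * q) / 2))%:E = (2 / q)%:E)%E.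
Proof.
move=> q0.
pose F (u : R) : R := - (2 / q) * expR (- (q / 2) * u).
have dF (u : R) : is_derive u 1 F (expR (- (u * q) / 2)).
  have H3 : is_derive u 1 (fun u : R => - (q / 2) * u) (- (q / 2) * 1).
    exact: is_deriveZ.
  have H4 : is_derive u 1 (fun u : R => expR (- (q / 2) * u))
      (expR (- (q / 2) * u) * (- (q / 2) * 1)).
    exact: is_derive1_comp.
  have H5 : is_derive u 1 F (- (2 / q) * (expR (- (q / 2) * u) * (- (q / 2) * 1))).
    exact: is_deriveZ.
  apply: (is_derive_eq H5).
  have -> : - (u * q) / 2 = - (q / 2) * u by field.
  by field; rewrite gt_eqF.
have cF (u : R) : {for u, continuous F}.
  have H := dF u; apply: differentiable_continuous; apply/derivable1_diffP.
  exact: ex_derive.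
have cf (u : R) : {for u, continuous (fun u : R => expR (- (u * q) / 2))}.
  apply: continuous_comp; last exact: continuous_expR.
  apply: continuousM; last exact: cst_continuous.
  apply: (@continuousN _ R^o).
  by apply: continuousM; [exact: cvg_id|exact: cst_continuous].
rewrite (@ge0_continuous_FTC2y _ _ F 0 0).
- by rewrite sub0e /F mulr0 expR0 mulr1 -EFinN opprK.
- by move=> u _; exact: expR_ge0.
- by apply: continuous_subspaceT => u; exact: cf.
- rewrite -[X in _ --> X](mulr0 (- (2 / q))).
  apply: cvgM; first exact: cvg_cst.
  under eq_fun do rewrite mulNr.
  apply: (@cvg_comp _ _ _ (fun u => q / 2 * u) (fun x => expR (- x))
    _ (+oo)%R); last exact: cvgr_expR.
  apply/cvgryPge => A; near=> u.
  rewrite mulrC -ler_pdivrMr ?divr_gt0//.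
- by move=> u _; have H := dF u; exact: ex_derive.
- by apply: cvg_at_right_filter; exact: cF.
- move=> u _; have H := dF u.
  by rewrite derive1E; exact: derive_val.
Unshelve. all: by end_near. Qed.

End power_integral.

(** * Quadratic forms in Gaussian vectors *)

Section quadratic_forms.
Context {R : realType}.

Definition qform n (S : 'M[R]_n) (z : 'I_n -> R) : R :=
  \sum_i \sum_j S i j * (z i * z j).

Lemma measurable_qform n (S : 'M[R]_n) d (T : measurableType d)
    (Z : 'I_n -> T -> R) : (forall i, measurable_fun setT (Z i)) ->
  measurable_fun setT (fun t => qform S (fun i => Z i t)).
Proof.
move=> mZ; apply: measurable_sum => i; apply: measurable_sum => j.
by apply: measurable_funM => //; exact: measurable_funM.
Qed.

Lemma qform_recl n (S : 'M[R]_n.+1) z : S^T = S ->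
  qform S z = S 0 0 * z 0 ^+ 2 +
    2 * (\sum_j S 0 (lift 0 j) * z (lift 0 j)) * z 0 +
    qform (\matrix_(i, j) S (lift 0 i) (lift 0 j)) (z \o lift 0).
Proof.
move=> SS; rewrite /qform big_ord_recl/= big_ord_recl.
under [X in _ + X]eq_bigr => i _ do rewrite big_ord_recl.
rewrite big_split/= -!addrA -expr2; congr (_ + _); rewrite addrA; congr (_ + _).
  rewrite -mulrA mulr_suml mulr_natl mulr2n; congr (_ + _); apply: eq_bigr => i _.
    by rewrite mulrAC -mulrA mulrC; ring.
  by rewrite -{1}SS mxE; ring.
by apply: eq_bigr => i _; apply: eq_bigr => j _; rewrite mxE.
Qed.

Lemma qform_proj n (S : 'M[R]_n) z : S^T = S -> S *m S = S ->
  qform S z = \sum_i (\sum_j S i j * z j) ^+ 2.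
Proof.
move=> ST SS.
have -> : qform S z = ((\row_i z i) *m S *m (\col_i z i)) 0 0.
  rewrite -mulmxA mxE; apply: eq_bigr => i _; rewrite !mxE mulr_sumr.
  by apply: eq_bigr => j _; rewrite !mxE; ring.
rewrite -{1}SS mulmxA -mulmxA mxE; apply: eq_bigr => i _.
rewrite expr2; congr (_ * _); last by rewrite mxE; apply: eq_bigr => j _; rewrite mxE.
by rewrite mxE; apply: eq_bigr => j _; rewrite -{1}ST !mxE mulrC.
Qed.

Lemma qform_scale n a (S : 'M[R]_n) z : qform (a *: S) z = a * qform S z.
Proof.
rewrite /qform mulr_sumr; apply: eq_bigr => i _; rewrite mulr_sumr.
by apply: eq_bigr => j _; rewrite mxE -mulrA.
Qed.

Context (s : R) (s0 : 0 < s).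

(** Integrating out the first coordinate leaves the factor [1 / sqrt c] and the quadratic form [S'']
    in the others. Here [c] is the pivot of [1 + s^2 S] and [1 + s^2 S''] its Schur complement, so
    the determinants multiply along the induction. *)
Lemma giid_expR_qform n (S : 'M[R]_n) d (T : measurableType d)
    (P : probability T R) (Z : 'I_n -> T -> R) :
  S^T = S -> (forall z, 0 <= qform S z) -> giid s P Z ->
  0 < \det (1%:M + s ^+ 2 *: S) /\
  (\int[P]_t (expR (- qform S (fun i => Z i t) / 2))%:E =
   ((Num.sqrt (\det (1%:M + s ^+ 2 *: S)))^-1)%:E)%E.
Proof.
elim: n => [|n IH] in S Z *.
  move=> _ _ _; rewrite det_mx00 ltr01 sqrtr1 invr1; split=> //.
  under eq_integral do rewrite /qform big_ord0 oppr0 mul0r expR0.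
  by rewrite integral_cst// mul1e; exact: probability_setT.
move=> SS S0 gZ.
have s2 : 0 < s ^+ 2 by rewrite exprn_gt0.
have S00 : 0 <= S 0 0.
  have := S0 (fun i => (i == 0)%:R); rewrite qform_recl// eqxx /= expr1n !mulr1.
  rewrite big1 ?mulr0 ?addr0; last by move=> i _; rewrite mulr0.
  rewrite [qform _ _]big1 ?addr0// => i _.
  by rewrite big1// => j _ /=; rewrite mul0r mulr0.
pose c := 1 + S 0 0 * s ^+ 2.
have c0 : 0 < c by rewrite /c; nra.
have cn : c != 0 by rewrite gt_eqF.
pose b (y : 'I_n -> R) := \sum_j S 0 (lift 0 j) * y j.
pose S' : 'M[R]_n := \matrix_(i, j) S (lift 0 i) (lift 0 j).
pose S'' : 'M[R]_n := \matrix_(i, j) (S (lift 0 i) (lift 0 j) -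
  s ^+ 2 / c * (S 0 (lift 0 i) * S 0 (lift 0 j))).
have S''S'' : S''^T = S''.
  by apply/matrixP => i j; rewrite !mxE -{1}SS mxE [S 0 (lift 0 j) * _]mulrC.
have qS'' y : qform S'' y = qform S' y - s ^+ 2 / c * b y ^+ 2.
  have -> : b y ^+ 2 = \sum_i \sum_j
      (S 0 (lift 0 i) * y i) * (S 0 (lift 0 j) * y j).
    rewrite expr2 {1}[b y]/b mulr_suml; apply: eq_bigr => i _.
    by rewrite /b mulr_sumr.
  rewrite /qform mulr_sumr -sumrB; apply: eq_bigr => i _.
  rewrite mulr_sumr -sumrB; apply: eq_bigr => j _.
  by rewrite !mxE; ring.
(* [S''] arises by partial minimisation: [qform S'' y] equals [qform S z + x^2 / s^2] at the
   minimising first coordinate [x], and is therefore nonnegative. *)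
have S''0 y : 0 <= qform S'' y.
  pose x := - (s ^+ 2 / c * b y).
  pose z (i : 'I_n.+1) := if unlift 0 i is Some j then y j else x.
  have z0 : z 0 = x by rewrite /z unlift_none.
  have zl j : z (lift 0 j) = y j by rewrite /z liftK.
  have := S0 z; rewrite qform_recl// z0.
  have -> : z \o lift 0 = y by apply/funext => j /=.
  under eq_bigr do rewrite zl.
  rewrite -/(b y) -/S' qS'' /x => H; apply: le_trans H _.
  rewrite -subr_ge0 (_ : _ - _ = s ^+ 2 / c ^+ 2 * b y ^+ 2).
    by rewrite mulr_ge0 ?sqr_ge0// divr_ge0 ?sqr_ge0.
  by rewrite /c; field; rewrite -/c.
pose Z' j := Z (lift 0 j).
have gZ' : giid s P Z' by apply: (giid_inj gZ); exact: lift_inj.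
have [d0 IHE] := IH S'' Z' S''S'' S''0 gZ'.
have dE : \det (1%:M + s ^+ 2 *: S) = c * \det (1%:M + s ^+ 2 *: S'').
  have M00 : (1%:M + s ^+ 2 *: S) 0 0 = c.
    by rewrite !mxE eqxx /c mulrC.
  rewrite (@det_schur _ n (1%:M + s ^+ 2 *: S)) M00//.
  congr (_ * \det _); apply/matrixP => i j.
  have E k : ((0 : 'I_n.+1) == lift 0 k) = false by [].
  rewrite !mxE big_ord1 !mxE !lshift0 !rshift1 (inj_eq lift_inj).
  have -> : S (lift 0 i) 0 = S 0 (lift 0 i) by rewrite -[in RHS]SS mxE.
  have -> : (lift 0 i == 0) = false by [].
  have -> : (0 == lift 0 j) = false by [].
  by rewrite !mulr0n; field.
split; first by rewrite dE mulr_gt0.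
pose f (z : famType R 'I_n.+1) := (expR (- qform S z / 2))%:E.
have mf : measurable_fun setT f.
  apply/measurable_EFinP; apply: measurableT_comp => //.
  apply: measurable_funM => //; apply: measurableT_comp => //.
  by apply: measurable_qform; exact: measurable_coord.
have f0 z : (0 <= f z)%E by rewrite lee_fin expR_ge0.
rewrite -[LHS]/(\int[P]_t f (fun i => Z i t))%E.
(* All coordinates but the first are frozen, so that the inner integral is one-dimensional. *)
rewrite (ge0_integral_giid_resample gZ (fun i => i != ord0) mf f0).
have inner t : (\int[P]_t' f (fun i => if i != ord0 then Z i t else Z i t') =
    ((Num.sqrt c)^-1)%:E * (expR (- qform S'' (fun j => Z' j t) / 2))%:E)%E.
  pose y j := Z' j t.
  pose h (x : R) := (expR (- (S 0 0 * x ^+ 2 + 2 * b y * x) / 2) *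
                     expR (- qform S' y / 2))%:E.
  transitivity (\int[P]_t' h (Z ord0 t'))%E.
    apply: eq_integral => t' _; rewrite /f /h -expRD qform_recl//=.
    congr ((expR _)%:E); rewrite -mulrDl -opprD; congr (- (_ + _) / 2).
  transitivity (\int[normal_prob 0 s]_x h x)%E.
    case: gZ => mZ nZ _.
    apply: (@ge0_integral_comp_law _ _ _ _ _ P (normal_prob 0 s) (Z 0) idfun h) => //.
    - exact: measurable_id.
    - exact: nZ.
    - apply/measurable_EFinP; apply: measurable_funM => //.
      by apply/measurable_EFinP; exact: measurable_fun_expR_quad.
    - by move=> x; rewrite lee_fin mulr_ge0 ?expR_ge0.
  under eq_integral do rewrite /h EFinM.
  rewrite ge0_integralZr//; last exact: measurable_fun_expR_quad.
  rewrite integral_normal_expR_quad// -/c -!EFinM; congr EFin.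
  rewrite -[LHS]mulrA -expRD; congr (_ * expR _).
  by rewrite qS''; field.
under eq_integral do rewrite inner.
rewrite ge0_integralZl//; last first.
  apply/measurable_EFinP; apply: measurableT_comp => //.
  apply: measurable_funM => //; apply: measurableT_comp => //.
  by apply: measurable_qform; exact: giid_measurable gZ'.
by rewrite IHE -EFinM dE sqrtrM ?(ltW c0)// invfM.
Qed.
End quadratic_forms.

Lemma measurable_resample (R : realType) (I : finType) d (T : measurableType d)
    d' (T' : measurableType d') (P' : probability T' R)
    (Z : I -> T -> R) (U : I -> T' -> R) (J : pred I)
    (f : famType R I -> \bar R) :
  (forall i, measurable_fun setT (Z i)) ->
  (forall i, measurable_fun setT (U i)) ->
  measurable_fun setT f -> (forall z, (0 <= f z)%E) ->
  measurable_fun setT (fun t =>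
    \int[P']_t' f (fun i => if J i then Z i t else U i t'))%E.
Proof.
move=> mZ mU mf f0.
have mg : measurable_fun setT (fun x : T * T' => f (fun i => merge_fam J Z U i x)).
  apply: measurableT_comp mf _; apply: measurable_family.
  exact: measurable_merge_fam.
exact: (measurable_fun_fubini_tonelli_F (m2 := P') _ mg (fun x => f0 _)).
Qed.

(** Powers of [x^2] are measurable, and the extra factor [x] produces the convention [0^-1 = 0]. *)
Lemma measurable_inv_real (R : realType) : measurable_fun [set: R] (@GRing.inv R).
Proof.
have -> : (@GRing.inv R) = (fun x : R => x * (x ^+ 2) `^ (-1)).
  apply/funext => x; have [->|x0] := eqVneq x 0; first by rewrite invr0 mul0r.
  by rewrite powRN powRr1 ?sqr_ge0// expr2 invfM mulrA divff// mul1r.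
apply: measurable_funM => //.
have mX : measurable_fun [set: R] (fun x : R => x ^+ 2) by exact: measurable_funX.
have mp : measurable_fun [set: R] (fun x : R => x `^ (-1)) by exact: measurable_powR.
by apply: (@measurableT_comp _ _ _ R R R (fun y : R => y `^ (-1)) setT
  (fun x : R => x ^+ 2)).
Qed.

Section chi_square.
Context {R : realType} (s : R) (s0 : 0 < s).
Context d (T : measurableType d) (P : probability T R).
Variables (n : nat) (A : 'M[R]_n) (Z : 'I_n -> T -> R).
Hypotheses (gZ : giid s P Z) (AT : A^T = A) (AA : A *m A = A).
Local Notation q := (fun t => qform A (fun i => Z i t)).
Local Notation k := (\rank A).
Local Notation mu := (@lebesgue_measure R).

Lemma qform_proj_ge0 z : 0 <= qform A z.
Proof. by rewrite qform_proj//; apply: sumr_ge0 => i _; exact: sqr_ge0. Qed.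

Let mq : measurable_fun setT q.
Proof. by apply: measurable_qform; exact: giid_measurable gZ. Qed.

Lemma chi_square_laplace (u : R) : 0 <= u ->
  (\int[P]_t (expR (- (u * q t) / 2))%:E =
   (expR (- (k%:R / 2) * ln (1 + s ^+ 2 * u)))%:E)%E.
Proof.
move=> u0; have x0 : 0 < 1 + s ^+ 2 * u.
  by rewrite ltr_wpDr// mulr_ge0// sqr_ge0.
have uT : (u *: A)^T = u *: A by rewrite linearZ/= AT.
have [|_] := giid_expR_qform s0 uT _ gZ.
  by move=> z; rewrite qform_scale mulr_ge0// qform_proj_ge0.
under eq_integral do rewrite qform_scale.
move=> ->; congr EFin; rewrite scalerA det_1D_idem// mulNr expRN; congr (_^-1).
have -> : (1 + s ^+ 2 * u) ^+ k = expR (k%:R / 2 * ln (1 + s ^+ 2 * u)) ^+ 2.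
  rewrite -expRM_natl -{1}(lnK (x := 1 + s ^+ 2 * u)) ?posrE// -expRM_natl.
  by congr expR; field.
by rewrite sqrtr_sqr ger0_norm// expR_ge0.
Qed.

(** The indicator of [q = 0] is at most [exp (- u q / 2)], whose mean tends to 0 as [u] grows. *)
Lemma chi_square_neq0 : (0 < k)%N -> P [set t | (q t = 0)%R] = 0%E.
Proof.
move=> k0.
have mE : measurable [set t | (q t = 0)%R].
  have := mq measurableT (measurable_set1 0); rewrite setTI; apply.
have s2 : 0 < s ^+ 2 by rewrite exprn_gt0.
have bound (u : R) : 0 <= u ->
    (P [set t | (q t = 0)%R] <= (expR (- (1 / 2) * ln (1 + s ^+ 2 * u)))%:E)%E.
  move=> u0; have x1 : 1 <= 1 + s ^+ 2 * u by rewrite lerDl mulr_ge0// ltW.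
  apply: (@le_trans _ _ (\int[P]_t (expR (- (u * q t) / 2))%:E)%E); last first.
    rewrite chi_square_laplace// lee_fin ler_expR ler_wpM2r ?ln_ge0//.
    by rewrite lerN2 ler_wpM2r// ler1n.
  rewrite -[X in P X]setIT -integral_indic//; apply: ge0_le_integral => //.
  - by apply/measurable_EFinP; exact: measurable_indic.
  - apply/measurable_EFinP; apply: measurableT_comp => //.
    apply: measurable_funM => //; apply: measurableT_comp => //.
    exact: measurable_funM.
  - move=> t _; rewrite lee_fin indicE; case: (boolP (t \in _)) => [|_].
      by rewrite inE /= => ->; rewrite mulr0 oppr0 mul0r expR0.
    exact: expR_ge0.
apply/eqP; rewrite eq_le measure_ge0 andbT; apply/lee_addgt0Pr => e e0.
rewrite add0e.
(* This makes [s^2 u = 1 / e^2], and [(1 + 1 / e^2)^(-1/2) <= e]. *)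
pose u := (e ^- 2) / s ^+ 2.
have e2 : 0 < e ^+ 2 by rewrite exprn_gt0.
have u0 : 0 <= u by rewrite divr_ge0 ?sqr_ge0// invr_ge0 ltW.
apply: le_trans (bound u u0) _; rewrite lee_fin.
have -> : s ^+ 2 * u = e ^- 2 by rewrite /u mulrC divfK// gt_eqF.
rewrite -[leRHS]lnK ?posrE// ler_expR mulNr lerNl.
rewrite -(@ler_pM2l _ 2)// mulrA mulrN.
have -> : 2 * (1 / 2) = 1 :> R by field.
rewrite mul1r -mulrN -lnV ?posrE// mulr_natl -lnXn ?invr_gt0// ler_ln ?posrE//.
- by rewrite exprVn lerDr.
- by rewrite exprn_gt0// invr_gt0.
- by rewrite addr_gt0// invr_gt0.
Qed.

Lemma integral_inv_qform : (0 < k)%N ->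
  (\int[P]_t ((q t)^-1)%:E =
   (2^-1)%:E * \int[mu]_(u in `[0%R, +oo[)
                 (expR (- (k%:R / 2) * ln (1 + s ^+ 2 * u)))%:E)%E.
Proof.
move=> k0.
pose D := `[0%R, +oo[%classic : set (measurableTypeR R).
pose f (x : T * measurableTypeR R) :=
  (2^-1 * expR (- (x.2 * q x.1) / 2) * \1_D x.2)%:E.
have mDD : measurable D by exact: measurable_itv.
have mD : measurable_fun [set: measurableTypeR R] (\1_D : _ -> R).
  exact: (measurable_indic mDD).
have mf : measurable_fun setT f.
  apply/measurable_EFinP; apply: measurable_funM; last first.
    by apply: measurableT_comp => //; exact: measurable_snd.
  apply: measurable_funM => //; apply: measurableT_comp => //.
  apply: measurable_funM => //; apply: measurableT_comp => //.
  apply: measurable_funM; first exact: measurable_snd.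
  by apply: (measurableT_comp mq); exact: measurable_fst.
have f0 x : (0 <= f x)%E by rewrite lee_fin !mulr_ge0 ?expR_ge0// invr_ge0.
have me (t : T) : measurable_fun [set: measurableTypeR R]
    (fun u => (expR (- (u * q t) / 2))%:E).
  apply/measurable_EFinP; apply: measurableT_comp => //.
  apply: measurable_funM => //; apply: measurableT_comp => //.
  exact: measurable_funM.
have inner t : (\int[mu]_u f (t, u) =
    (2^-1)%:E * \int[mu]_(u in `[0%R, +oo[) (expR (- (u * q t) / 2))%:E)%E.
  rewrite -ge0_integralZl//; last exact: measurable_funTS.
  rewrite [RHS]integral_mkcond epatch_indic; apply: eq_integral => u _.
  by rewrite /f /= -!EFinM.
transitivity (\int[P]_t \int[mu]_u f (t, u))%E.
  apply: ge0_ae_eq_integral => //.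
  - apply/measurable_EFinP.
    by apply: (@measurableT_comp _ _ _ T R R (@GRing.inv R) setT q) => //;
      exact: measurable_inv_real.
  - exact: (measurable_fun_fubini_tonelli_F (m2 := mu) _ mf f0).
  - by move=> t _; rewrite lee_fin invr_ge0 qform_proj_ge0.
  - by move=> t _; apply: integral_ge0.
  (* Where [q] vanishes the two sides differ: [0^-1 = 0] against an infinite integral. *)
  exists [set t | (q t = 0)%R]; split.
  - have := mq measurableT (measurable_set1 0); rewrite setTI; apply.
  - exact: chi_square_neq0.
  - move=> t /= /not_implyP[_ H]; apply: contrapT => qt; apply: H.
    rewrite inner integral_expR_half -?EFinM.
      by congr EFin; rewrite mulrA mulVf// mul1r.
    by rewrite lt_def qform_proj_ge0 andbT; apply/eqP.
have := @fubini_tonelli _ _ _ _ R P mu f mf f0; rewrite /fubini_F /fubini_G => ->.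
rewrite -ge0_integralZl//; last first.
  apply/measurable_EFinP; apply: measurable_funTS; apply: measurableT_comp => //.
  apply: measurable_funM => //; apply: measurableT_comp => //.
  by apply: measurable_funD => //; exact: measurable_funM.
rewrite [RHS]integral_mkcond epatch_indic; apply: eq_integral => u _ /=.
rewrite indicE; case: (boolP (u \in _)) => [uD|uD]; last first.
  rewrite mule0 integral0_eq// => t _; rewrite /f /= indicE.
  by rewrite (negbTE uD) mulr0.
have u0 : 0 <= u by move: uD; rewrite inE /= in_itv/= andbT.
rewrite mule1 -chi_square_laplace// -ge0_integralZl//; last first.
  apply/measurable_EFinP; apply: measurableT_comp => //.
  apply: measurable_funM => //; apply: measurableT_comp => //.
  exact: measurable_funM.
by apply: eq_integral => t _; rewrite /f /= indicE uD mulr1 EFinM.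
Qed.

Lemma integral_inv_qform_fin : (2 < k)%N ->
  (\int[P]_t ((q t)^-1)%:E = ((s ^+ 2 * (k%:R - 2))^-1)%:E)%E.
Proof.
move=> k2; have k2' : 2 < k%:R :> R by rewrite ltr_nat.
rewrite integral_inv_qform ?(ltn_trans _ k2)//.
rewrite integral_power ?exprn_gt0//; last by lra.
rewrite -EFinM; congr EFin; field.
by rewrite !gt_eqF//; lra.
Qed.

Lemma integral_inv_qformy : (0 < k <= 2)%N ->
  (\int[P]_t ((q t)^-1)%:E = +oo)%E.
Proof.
move=> /andP[k0 k2]; have k2' : k%:R <= 2 :> R by rewrite ler_nat.
rewrite integral_inv_qform// integral_powery ?exprn_gt0//; last by lra.
by rewrite gt0_muley// lte_fin invr_gt0.
Qed.

End chi_square.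

(** * Gram matrices and the inverse Wishart mean *)

Section gram.
Context {R : realType}.

Definition gram m p (A : 'M[R]_(m, p)) : 'M[R]_p := A^T *m A.

(* equals [invmx W] when [W] is invertible and [0] otherwise *)
Definition ginv p (W : 'M[R]_p) : 'M[R]_p := (\det W)^-1 *: \adj W.

Lemma ginvE p (W : 'M[R]_p) : \det W != 0 -> ginv W = invmx W.
Proof. by move=> W0; rewrite /ginv /invmx unitmxE unitfE W0. Qed.

Lemma ginv_singular p (W : 'M[R]_p) : \det W = 0 -> ginv W = 0.
Proof. by move=> W0; rewrite /ginv W0 invr0 scale0r. Qed.

Lemma qformE n (S : 'M[R]_n) z :
  qform S z = ((\col_i z i)^T *m S *m (\col_i z i)) 0 0.
Proof.
rewrite -mulmxA mxE; apply: eq_bigr => i _; rewrite !mxE mulr_sumr.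
by apply: eq_bigr => j _; rewrite !mxE; ring.
Qed.

Lemma gram_sym m p (A : 'M[R]_(m, p)) : (gram A)^T = gram A.
Proof. by rewrite /gram trmx_mul trmxK. Qed.

Section projection.
Variables (m p : nat) (B : 'M[R]_(m, p)) (B0 : \det (gram B) != 0).

(** The orthogonal projection onto the complement of the column space of [B]. *)
Definition coproj : 'M[R]_m := 1%:M - B *m invmx (gram B) *m B^T.

Let Bu : gram B \in unitmx. Proof. by rewrite unitmxE unitfE. Qed.

Let invT : (invmx (gram B))^T = invmx (gram B).
Proof. by rewrite trmx_inv gram_sym. Qed.

Lemma coproj_sym : coproj^T = coproj.
Proof.
by rewrite /coproj linearB/= trmx1 !trmx_mul trmxK invT mulmxA.
Qed.

Let hatK : (B *m invmx (gram B) *m B^T) *m (B *m invmx (gram B) *m B^T) =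
  B *m invmx (gram B) *m B^T.
Proof.
rewrite -[LHS]mulmxA; congr (_ *m _).
by rewrite !mulmxA -[B^T *m B]/(gram B) mulmxV// mul1mx.
Qed.

Lemma coproj_idem : coproj *m coproj = coproj.
Proof.
by rewrite /coproj mulmxBl mul1mx mulmxBr mulmx1 hatK subrr subr0.
Qed.

(** The rank of an idempotent is its trace, computed by cyclicity. *)
Lemma rank_coproj : \rank coproj = (m - p)%N.
Proof.
have H : (\rank coproj)%:R + p%:R = m%:R :> R.
  rewrite -mxtrace_idem ?coproj_idem// /coproj linearB/= mxtrace1.
  by rewrite mxtrace_mulC mulmxA -[B^T *m B]/(gram B) mulmxV// mxtrace1 subrK.
apply: (canRL (addnK p)); apply/eqP.
by rewrite -(eqr_nat R) natrD H.
Qed.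

End projection.

Section schur.
Variables (m p : nat) (A : 'M[R]_(m, 1 + p)).
Hypothesis B0 : \det (gram (rsubmx A)) != 0.
Let B := rsubmx A.
Let z := lsubmx A.
Let q := qform (coproj B) (fun i => A i 0).

Let gramE : gram A = block_mx (z^T *m z) (z^T *m B) (B^T *m z) (gram B).
Proof. by rewrite /gram -{1 2}(hsubmxK A) tr_row_mx mul_col_row. Qed.

Let qE : z^T *m coproj B *m z = q%:M.
Proof.
apply/matrixP => i j; rewrite !ord1 [RHS]mxE eqxx mulr1n /q qformE.
have -> : \col_i A i 0 = z; last by [].
by apply/matrixP => k l; rewrite !mxE !ord1; congr (A _ _); apply: val_inj.
Qed.

Lemma det_gram_recl : \det (gram A) = q * \det (gram B).
Proof.
have u : gram B \in unitmx by rewrite unitmxE unitfE.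
have -> : gram A = block_mx 1%:M (z^T *m B *m invmx (gram B)) 0 1%:M *m
    block_mx q%:M 0 (B^T *m z) (gram B).
  rewrite gramE mulmx_block !mul1mx !mul0mx !add0r mulmxKV//.
  rewrite -qE /coproj mulmxBr mulmx1 mulmxBl !mulmxA subrK.
  by [].
by rewrite det_mulmx det_ublock det_lblock !det1 !mul1r det_scalar1.
Qed.

(** The Gram matrix sends [(1, - b)], with [b] the regression coefficients of the first column on
    the others, to [(q, 0)]. If [q = 0], both sides are 0 by convention. *)
Lemma ginv_gram00 : ginv (gram A) 0 0 = q^-1.
Proof.
have u : gram B \in unitmx by rewrite unitmxE unitfE.
have [q0|q0] := eqVneq q 0.
  by rewrite q0 invr0 ginv_singular ?mxE// det_gram_recl q0 mul0r.
have W0 : \det (gram A) != 0 by rewrite det_gram_recl mulf_neq0.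
rewrite ginvE//.
have E : gram A *m col_mx 1%:M (- (invmx (gram B) *m B^T *m z)) =
    col_mx q%:M (0 : 'M[R]_(p, 1)).
  rewrite gramE mul_block_col !mulmx1 !mulmxN; congr col_mx.
    by rewrite -qE /coproj mulmxBr mulmx1 mulmxBl !mulmxA.
  by rewrite !mulmxA mulmxV// mul1mx subrr.
have := congr1 (fun M => (invmx (gram A) *m M) 0 0) E.
rewrite mulKmx ?unitmxE ?unitfE// => E2.
apply: (mulIf q0); rewrite mulVf//.
have e0 : 0 = lshift p (0 : 'I_1) :> 'I_(1 + p) by apply: val_inj.
move: E2; rewrite [in LHS]e0 col_mxEu mxE eqxx mulr1n => ->.
rewrite mxE big_split_ord/= big_ord1 [X in _ + X]big1 ?addr0.
  by rewrite col_mxEu mxE eqxx mulr1n -e0.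
by move=> i _; rewrite col_mxEd mxE mulr0.
Qed.

End schur.

End gram.

(** * Entrywise measurability of random matrices *)

Section measurable_matrix.
Context {R : realType} d (T : measurableType d).

Definition mmx m n (F : T -> 'M[R]_(m, n)) :=
  forall i j, measurable_fun setT (fun t => F t i j).

Lemma mmx_tr m n (F : T -> 'M[R]_(m, n)) : mmx F -> mmx (fun t => (F t)^T).
Proof. by move=> mF i j; under eq_fun do rewrite mxE; exact: mF. Qed.

Lemma mmx_cst m n (A : 'M[R]_(m, n)) : mmx (fun=> A).
Proof. by move=> i j; exact: measurable_cst. Qed.

Lemma mmx_mul m n p (F : T -> 'M[R]_(m, n)) (G : T -> 'M[R]_(n, p)) :
  mmx F -> mmx G -> mmx (fun t => F t *m G t).
Proof.
move=> mF mG i j; under eq_fun do rewrite mxE.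
by apply: measurable_sum => k; exact: measurable_funM.
Qed.

Lemma mmx_det n (F : T -> 'M[R]_n) : mmx F ->
  measurable_fun setT (fun t => \det (F t)).
Proof.
move=> mF; rewrite /determinant; apply: measurable_sum => s.
by apply: measurable_funM => //; apply: measurable_prod => i _.
Qed.

Lemma mmx_ginv n (F : T -> 'M[R]_n) : mmx F -> mmx (fun t => ginv (F t)).
Proof.
move=> mF i j; under eq_fun do rewrite !mxE.
apply: measurable_funM.
  apply: (@measurableT_comp _ _ _ T R R (@GRing.inv R) setT
    (fun t => \det (F t))); first exact: measurable_inv_real.
  exact: mmx_det.
rewrite /cofactor; apply: measurable_funM => //; apply: mmx_det => k l.
by under eq_fun do rewrite !mxE; exact: mF.
Qed.

Lemma mmx_gram m n (F : T -> 'M[R]_(m, n)) : mmx F -> mmx (fun t => gram (F t)).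
Proof. by move=> mF; apply: mmx_mul => //; exact: mmx_tr. Qed.

End measurable_matrix.

Section wishart.
Context {R : realType} (s : R) (s0 : 0 < s).
Context d (T : measurableType d) (P : probability T R).

Definition mxof m p (z : 'I_m * 'I_p -> R) : 'M[R]_(m, p) := \matrix_(i, j) z (i, j).

Lemma mmx_mxof m p d' (T' : measurableType d') (Z : 'I_m * 'I_p -> T' -> R) :
  (forall i, measurable_fun setT (Z i)) -> mmx (fun t => mxof (fun i => Z i t)).
Proof. by move=> mZ i j; under eq_fun do rewrite mxE; exact: mZ. Qed.

Lemma mmx_fam m p : mmx (fun z : famType R ('I_m * 'I_p)%type => mxof z).
Proof.
move=> i j.
have -> : (fun z : famType R ('I_m * 'I_p)%type => mxof z i j) =
          (fun z : famType R ('I_m * 'I_p)%type => z (i, j)).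
  by apply/funext => z; rewrite mxE.
exact: measurable_coord.
Qed.

Let rsh_inj m p : injective (fun i : 'I_m * 'I_p => (i.1, rshift 1 i.2)).
Proof. by move=> [a b] [a' b'] /= [-> H]; congr pair; exact: val_inj. Qed.

(** Conditioning on all columns but the first fixes a projection, of rank [m - p] off a null set,
    and the inner integral is then the constant [c]. Applied with [h] the indicator of 0 for full
    rank and with [h] the absolute inverse for the inverse Wishart mean. *)
Lemma gram_resample m p (Z : 'I_m * 'I_(1 + p) -> T -> R)
    (f : 'M[R]_(m, 1 + p) -> \bar R) (h : R -> \bar R) (c : \bar R) :
  giid s P Z -> (0 <= c)%E ->
  measurable_fun setT (fun z : famType R ('I_m * 'I_(1 + p))%type => f (mxof z)) ->
  (forall A, (0 <= f A)%E) ->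
  (forall A, \det (gram (rsubmx A)) != 0 ->
     f A = h (qform (coproj (rsubmx A)) (fun i => A i 0))) ->
  (forall S : 'M[R]_m, S^T = S -> S *m S = S -> \rank S = (m - p)%N ->
     \int[P]_t h (qform S (fun i => Z (i, 0%R) t)) = c)%E ->
  P [set t | \det (gram (mxof (fun i : 'I_m * 'I_p => Z (i.1, rshift 1 i.2) t))) = 0%R]
    = 0%E ->
  (\int[P]_t f (mxof (fun i => Z i t)) = c)%E.
Proof.
move=> gZ c0 mf f0 fh hc B0.
pose J (i : 'I_m * 'I_(1 + p)) := i.2 != 0.
have mZ := giid_measurable gZ.
rewrite (ge0_integral_giid_resample gZ J mf (fun z => f0 _)).
transitivity (\int[P]_t c)%E; last first.
  by rewrite integral_cst// [X in (_ * X)%E]probability_setT mule1.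
apply: ge0_ae_eq_integral => //.
- exact: (@measurable_resample R _ _ _ _ _ P Z Z J (fun z => f (mxof z)) mZ mZ mf
    (fun z => f0 _)).
- by move=> t _; apply: integral_ge0.
exists [set t | \det (gram (mxof (fun i : 'I_m * 'I_p => Z (i.1, rshift 1 i.2) t))) = 0].
split => //.
  have mB : measurable_fun setT (fun t =>
      \det (gram (mxof (fun i : 'I_m * 'I_p => Z (i.1, rshift 1 i.2) t)))).
    by apply: mmx_det; apply: mmx_gram; apply: mmx_mxof.
  by have := mB measurableT _ (measurable_set1 0); rewrite setTI; apply.
move=> t /= /not_implyP[_ H]; apply: contrapT => /eqP Bt; apply: H.
set B := mxof _ in Bt.
rewrite -(hc (coproj B) (coproj_sym _) (coproj_idem Bt) (rank_coproj Bt)).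
apply: eq_integral => t' _.
set A := mxof _.
have AB : rsubmx A = B by apply/matrixP => i j; rewrite !mxE /J/=.
rewrite fh AB//; congr (h (qform _ _)); apply/funext => i.
by rewrite mxE.
Qed.

(** Each added column multiplies the Gram determinant by a quadratic form in a projection of
    positive rank, which is almost surely nonzero. *)
Lemma gram_full_rank m p (Z : 'I_m * 'I_p -> T -> R) : (p <= m)%N -> giid s P Z ->
  P [set t | \det (gram (mxof (fun i => Z i t))) = 0] = 0%E.
Proof.
elim: p => [|p IH] in Z * => pm gZ.
  rewrite (_ : [set t | _] = set0) ?measure0//; apply/seteqP; split => t //=.
  by rewrite det_mx00 => /eqP; rewrite oner_eq0.
pose E := [set A : 'M[R]_(m, 1 + p) | \det (gram A) = 0].
have mE : measurable [set z : famType R ('I_m * 'I_(1 + p))%type | E (mxof z)].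
  have mB : measurable_fun setT (fun z : famType R ('I_m * 'I_(1 + p))%type =>
      \det (gram (mxof z))).
    by apply: mmx_det; apply: mmx_gram; exact: mmx_fam.
  by have := mB measurableT _ (measurable_set1 0); rewrite setTI; apply.
have mEt : measurable [set t | E (mxof (fun i => Z i t))].
  have mB : measurable_fun setT (fun t => \det (gram (mxof (fun i => Z i t)))).
    by apply: mmx_det; apply: mmx_gram; apply: mmx_mxof; exact: giid_measurable gZ.
  by have := mB measurableT _ (measurable_set1 0); rewrite setTI; apply.
have g0 : giid s P (fun i : 'I_m => Z (i, 0)).
  by apply: (giid_inj gZ (h := fun i => (i, 0))) => i j [].
rewrite -[LHS]/(P [set t | E (mxof (fun i => Z i t))]) -[X in P X]setIT.
rewrite -integral_indic//.
apply: (@gram_resample m p Z (fun A => (\1_E A)%:E)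
  (fun x => ((x == 0)%:R)%:E) 0%E gZ) => //.
- apply/measurable_EFinP.
  have -> : (fun z : famType R ('I_m * 'I_(1 + p))%type => \1_E (mxof z) : R) =
      \1_[set z : famType R ('I_m * 'I_(1 + p))%type | E (mxof z)].
    by apply/funext => z; rewrite !indicE; congr (nat_of_bool _)%:R;
      apply/idP/idP; rewrite !inE.
  exact: measurable_indic.
- move=> A A0; rewrite indicE; congr (_%:R%:E); congr nat_of_bool.
  apply/idP/idP; rewrite inE /E /= (det_gram_recl A0).
    by move=> /eqP; rewrite mulf_eq0 (negbTE A0) orbF.
  by move=> /eqP ->; rewrite mul0r.
- move=> S ST SS Sr.
  have Sq : P [set t | qform S (fun i => Z (i, 0) t) = 0] = 0%E.
    by apply: (chi_square_neq0 s0 g0 ST SS); rewrite Sr subn_gt0.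
  have mq : measurable_fun setT (fun t => qform S (fun i => Z (i, 0) t)).
    by apply: measurable_qform => i; exact: giid_measurable g0 i.
  have mQ : measurable [set t | qform S (fun i => Z (i, 0) t) = 0].
    by have := mq measurableT _ (measurable_set1 0); rewrite setTI; apply.
  rewrite -Sq -[X in P X]setIT -integral_indic//; apply: eq_integral => t _.
  rewrite indicE; congr (_%:R%:E); congr nat_of_bool.
  by apply/eqP/idP; rewrite !inE.
- by apply: (IH (fun i => Z (i.1, rshift 1 i.2)) (ltnW pm));
    exact: (giid_inj gZ (@rsh_inj m p)).
Qed.

(** The absolute value keeps the integrand nonnegative on degenerate matrices too, as
    [gram_resample] requires; it disappears once [ginv] is identified with [solver_cov]. *)
Lemma inverse_wishart00 m p (Z : 'I_m * 'I_p.+1 -> T -> R) : (p < m)%N ->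
  giid s P Z ->
  (\int[P]_t (`|ginv (gram (mxof (fun i => Z i t))) 0%R 0%R|%R)%:E =
   if (m - p <= 2)%N then +oo else ((s ^+ 2 * ((m - p)%:R - 2))^-1)%:E)%E.
Proof.
move=> pm gZ.
have g0 : giid s P (fun i : 'I_m => Z (i, 0)).
  by apply: (giid_inj gZ (h := fun i => (i, 0))) => i j [].
apply: (@gram_resample m p Z (fun A => (`|ginv (gram A) 0%R 0%R|%R)%:E)
  (fun x => (`|x^-1|%R)%:E) _ gZ) => //.
- case: ifPn => //; rewrite -ltnNge => mp; rewrite lee_fin invr_ge0.
  by rewrite mulr_ge0 ?sqr_ge0// subr_ge0 ler_nat ltnW.
- apply/measurable_EFinP; apply: measurableT_comp => //.
  by apply: mmx_ginv; apply: mmx_gram; exact: mmx_fam.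
- by move=> A A0; rewrite (ginv_gram00 A0).
- move=> S ST SS Sr.
  under eq_integral => t _.
    rewrite ger0_norm; last by rewrite invr_ge0 (qform_proj_ge0 ST SS).
    over.
  case: ifPn; rewrite -?ltnNge => mp.
    by apply: (integral_inv_qformy s0 g0 ST SS); rewrite Sr subn_gt0 pm.
  by rewrite (integral_inv_qform_fin s0 g0 ST SS) Sr.
- by apply: (gram_full_rank (Z := fun i => Z (i.1, rshift 1 i.2)) (ltnW pm));
    exact: (giid_inj gZ (@rsh_inj m p)).
Qed.

End wishart.

(** * The least squares solution operator *)

Section solver.
Context {R : realType}.

(** The Moore-Penrose inverse of a full-rank [X]: [(X^T X)^-1 X^T] when tall, [X^T (X X^T)^-1] when
    wide. Being 0 on degenerate matrices, it is a measurable function of the entries. *)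
Definition solver n d (X : 'M[R]_(n, d)) : 'M[R]_(d, n) :=
  if (d <= n)%N then ginv (gram X) *m X^T else X^T *m ginv (gram X^T).

Definition nondeg n d (X : 'M[R]_(n, d)) : bool :=
  if (d <= n)%N then \det (gram X) != 0 else \det (gram X^T) != 0.

Definition penrose n d (X : 'M[R]_(n, d)) (M : 'M[R]_(d, n)) :=
  [/\ X *m M *m X = X, M *m X *m M = M, (X *m M)^T = X *m M & (M *m X)^T = M *m X].

Lemma solver_deg n d (X : 'M[R]_(n, d)) : ~~ nondeg X -> solver X = 0.
Proof.
rewrite /nondeg /solver; case: ifP => _ /negPn/eqP H.
  by rewrite ginv_singular// mul0mx.
by rewrite ginv_singular// mulmx0.
Qed.

Lemma solver_left n d (X : 'M[R]_(n, d)) : nondeg X -> (d <= n)%N ->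
  solver X *m X = 1%:M.
Proof.
rewrite /nondeg /solver => H dn; rewrite dn in H *.
by rewrite ginvE// -mulmxA -[X^T *m X]/(gram X) mulVmx// unitmxE unitfE.
Qed.

Lemma solver_right n d (X : 'M[R]_(n, d)) : nondeg X -> (n < d)%N ->
  X *m solver X = 1%:M.
Proof.
rewrite /nondeg /solver ltnNge => + /negbTE dn; rewrite dn => H.
rewrite ginvE// mulmxA.
have -> : X *m X^T = gram X^T by rewrite /gram trmxK.
by rewrite mulmxV// unitmxE unitfE.
Qed.

Lemma solver_penrose n d (X : 'M[R]_(n, d)) : nondeg X -> penrose X (solver X).
Proof.
move=> H; case: (leqP d n) => dn.
  have MX := solver_left H dn; split.
  - by rewrite -mulmxA MX mulmx1.
  - by rewrite MX mul1mx.
  - move: H; rewrite /nondeg /solver dn => H; rewrite ginvE// !trmx_mul trmxK.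
    by rewrite trmx_inv gram_sym mulmxA.
  - by rewrite MX trmx1.
have XM := solver_right H dn; split.
- by rewrite XM mul1mx.
- by rewrite -mulmxA XM mulmx1.
- by rewrite XM trmx1.
move: H dn; rewrite /nondeg /solver ltnNge => + /negbTE dn; rewrite dn => H.
by rewrite ginvE// !trmx_mul trmxK trmx_inv gram_sym mulmxA.
Qed.

(** Acts on parameters, unlike the usual hat matrix on outputs: for nondegenerate [X] it is the
    orthogonal projection onto the row space. *)
Definition hat n d (X : 'M[R]_(n, d)) : 'M[R]_d := solver X *m X.

Lemma hat_sym n d (X : 'M[R]_(n, d)) : (hat X)^T = hat X.
Proof.
have [/solver_penrose[]//|/solver_deg H] := boolP (nondeg X).
by rewrite /hat H mul0mx trmx0.
Qed.

Lemma hat_idem n d (X : 'M[R]_(n, d)) : hat X *m hat X = hat X.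
Proof.
have [/solver_penrose[_ H _ _]|/solver_deg H] := boolP (nondeg X).
  by rewrite /hat mulmxA H.
by rewrite /hat H !mul0mx.
Qed.

Lemma invmx_conj d (O W : 'M[R]_d) : O *m O^T = 1%:M -> W \in unitmx ->
  invmx (O^T *m W *m O) = O^T *m invmx W *m O.
Proof.
move=> OO Wu; have OO' := mulmx1C OO.
have K : (O^T *m W *m O) *m (O^T *m invmx W *m O) = 1%:M.
  rewrite !mulmxA -(mulmxA (O^T *m W)) OO mulmx1 -(mulmxA O^T) mulmxV//.
  by rewrite mulmx1.
have [u _] := mulmx1_unit K.
by rewrite -[RHS](mulKmx u) K mulmx1.
Qed.

(** [X] and [X O] degenerate together, so equivariance holds without a rank condition; it turns
    invariance of the design into symmetries of moments. *)
Lemma solver_orth n d (X : 'M[R]_(n, d)) (O : 'M[R]_d) : O *m O^T = 1%:M ->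
  solver (X *m O) = O^T *m solver X.
Proof.
move=> OO; have OO' := mulmx1C OO.
rewrite /solver; case: ifP => _; last first.
  have -> : gram (X *m O)^T = gram X^T.
    by rewrite /gram !trmxK trmx_mul mulmxA -(mulmxA X) OO mulmx1.
  by rewrite trmx_mul mulmxA.
have E : gram (X *m O) = O^T *m gram X *m O by rewrite /gram trmx_mul !mulmxA.
have dO : \det O^T * \det O = 1 by rewrite -det_mulmx OO' det1.
have dE : \det (gram (X *m O)) = \det (gram X).
  by rewrite E !det_mulmx mulrAC dO mul1r.
have [W0|W0] := eqVneq (\det (gram X)) 0.
  by rewrite !ginv_singular ?dE// !mul0mx mulmx0.
have Wu : gram X \in unitmx by rewrite unitmxE unitfE.
rewrite !ginvE ?dE// E.
by rewrite invmx_conj// trmx_mul -!mulmxA (mulmxA O) OO mul1mx.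
Qed.

Lemma hat_orth n d (X : 'M[R]_(n, d)) (O : 'M[R]_d) : O *m O^T = 1%:M ->
  hat (X *m O) = O^T *m hat X *m O.
Proof. by move=> OO; rewrite /hat solver_orth// !mulmxA. Qed.

Lemma mmx_solver n d dT (T : measurableType dT) (F : T -> 'M[R]_(n, d)) :
  mmx F -> mmx (fun t => solver (F t)).
Proof.
move=> mF; rewrite /solver; case: (d <= n)%N.
  by apply: mmx_mul; [apply: mmx_ginv; exact: mmx_gram|exact: mmx_tr].
apply: mmx_mul; first exact: mmx_tr.
by apply: mmx_ginv; apply: mmx_gram; exact: mmx_tr.
Qed.

Lemma mmx_hat n d dT (T : measurableType dT) (F : T -> 'M[R]_(n, d)) :
  mmx F -> mmx (fun t => hat (F t)).
Proof. by move=> mF; apply: mmx_mul => //; exact: mmx_solver. Qed.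

Lemma pinv_unique d (A B C : 'M[R]_d) : is_pinv A B -> is_pinv A C -> B = C.
Proof.
move=> [ABA BAB ABs BAs] [ACA CAC ACs CAs].
have E1 : A *m B *m (A *m C) = A *m C by rewrite mulmxA ABA.
have E2 : A *m B *m (A *m C) = A *m B.
  by rewrite -{1}ABs -{1}ACs -trmx_mul mulmxA ACA ABs.
have F1 : B *m A *m (C *m A) = B *m A by rewrite -mulmxA [A *m (C *m A)]mulmxA ACA.
have F2 : B *m A *m (C *m A) = C *m A.
  by rewrite -{1}BAs -{1}CAs -trmx_mul -mulmxA [A *m (B *m A)]mulmxA ABA CAs.
by rewrite -BAB -mulmxA -E2 E1 mulmxA -F1 F2 CAC.
Qed.

(** For the Moore-Penrose inverse [M] of [X], the product [M M^T] satisfies the Penrose equations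
    for [X^T X], and [M M^T X^T = M]. Uniqueness of the pseudoinverse identifies the value chosen by
    [epsilon]. *)
Lemma lse_solver n d (Xs : 'I_n -> 'cV[R]_d) (Ys : 'I_n -> R) :
  nondeg (design Xs) -> lse Xs Ys = solver (design Xs) *m \col_i Ys i.
Proof.
rewrite /lse; move: (design Xs) => X H.
have [XMX MXM XMs MXs] := solver_penrose H.
move: (solver X) XMX MXM XMs MXs => M XMX MXM XMs MXs.
have AB : X^T *m X *m (M *m M^T) = M *m X.
  transitivity ((M *m X *m M *m X)^T); last by rewrite MXM MXs.
  by rewrite -mulmxA [X *m (M *m M^T)]mulmxA -XMs !trmx_mul !mulmxA.
have BA : M *m M^T *m (X^T *m X) = M *m X.
  by rewrite mulmxA -(mulmxA M) -trmx_mul XMs mulmxA MXM.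
have XT : M *m X *m X^T = X^T by rewrite -MXs -trmx_mul mulmxA XMX.
have pB : is_pinv (X^T *m X) (M *m M^T).
  by split; rewrite ?AB ?BA// mulmxA ?XT ?MXM.
have -> : mp_pinv (X^T *m X) = M *m M^T.
  apply: (@pinv_unique _ (X^T *m X)) => //.
  by apply: (ClassicalEpsilon.epsilon_spec (inhabits 0) (fun B => is_pinv _ B));
    exists (M *m M^T).
by rewrite -(mulmxA M) -trmx_mul XMs mulmxA MXM.
Qed.

End solver.

(** * Orthogonal symmetries of a Gaussian design *)

Section invariance.
Context {R : realType} (s : R) (s0 : 0 < s).
Context dT (T : measurableType dT) (P : probability T R) (n d : nat).
Variables (Z : 'I_n * 'I_d -> T -> R) (gZ : giid s P Z).
Local Notation X := (fun t => mxof (fun i => Z i t)).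

(** A witness family replaces equality of laws, so that [X O] is itself a Gaussian design on the
    same space. *)
Definition law_invariant (O : 'M[R]_d) :=
  exists2 Z' : 'I_n * 'I_d -> T -> R, giid s P Z' &
    forall t, mxof (fun i => Z' i t) = X t *m O.

Lemma ge0_integral_law_invariant O (F : 'M[R]_(n, d) -> \bar R) :
  law_invariant O ->
  measurable_fun setT (fun z : famType R ('I_n * 'I_d)%type => F (mxof z)) ->
  (forall A, 0 <= F A)%E ->
  (\int[P]_t F (X t) = \int[P]_t F (X t *m O))%E.
Proof.
move=> [Z' gZ' ZZ'] mF F0.
rewrite (ge0_integral_giid gZ gZ' mF (fun z => F0 _)).
by apply: eq_integral => t _; rewrite ZZ'.
Qed.

Lemma has_mean_law_invariant O (F : 'M[R]_(n, d) -> R) m :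
  law_invariant O ->
  measurable_fun setT (fun z : famType R ('I_n * 'I_d)%type => F (mxof z)) ->
  has_mean P (fun t => F (X t *m O)) m -> has_mean P (fun t => F (X t)) m.
Proof.
move=> [Z' gZ' ZZ'] mF H.
apply: (has_mean_giid gZ gZ' mF); apply: has_mean_ext H => t.
by rewrite -ZZ'.
Qed.

Definition sign_mx (e : 'I_d -> bool) : 'M[R]_d := diag_mx (\row_j (-1) ^+ e j).

Lemma sign_mx_orth e : sign_mx e *m (sign_mx e)^T = 1%:M.
Proof.
rewrite /sign_mx tr_diag_mx mulmx_diag; apply/matrixP => i j.
by rewrite !mxE -expr2 sqrr_sign.
Qed.

Lemma law_invariant_sign e : law_invariant (sign_mx e).
Proof.
exists (fun i t => if e i.2 then - Z i t else Z i t).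
  exact: (giid_sign s0 gZ (fun i => e i.2)).
move=> t; apply/matrixP => i j; rewrite /sign_mx mul_mx_diag !mxE /=.
by case: (e j); rewrite ?expr0 ?expr1 ?mulrN1 ?mulr1.
Qed.

Lemma perm_mx_orth (g : {perm 'I_d}) :
  (perm_mx g^-1%g : 'M[R]_d) *m (perm_mx g^-1%g)^T = 1%:M.
Proof. by rewrite tr_perm_mx invgK -perm_mxM mulVg perm_mx1. Qed.

Lemma law_invariant_perm (g : {perm 'I_d}) : law_invariant (perm_mx g^-1%g).
Proof.
exists (fun i => Z (i.1, g i.2)).
  apply: (giid_inj gZ (h := fun i : 'I_n * 'I_d => (i.1, g i.2))).
  by move=> [a b] [a' b'] /= [-> /perm_inj ->].
by move=> t; apply/matrixP => i j; rewrite -col_permE !mxE.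
Qed.

Section rotation.
Variables (a b : 'I_d) (ab : a != b).
Local Notation r := (Num.sqrt 2 : R).

Definition rot_mx : 'M[R]_d := \matrix_(k, j)
  (if j == a then ((k == a)%:R + (k == b)%:R) / r
   else if j == b then ((k == b)%:R - (k == a)%:R) / r else (k == j)%:R).

Lemma mul_rot_mx m (Y : 'M[R]_(m, d)) i j :
  (Y *m rot_mx) i j = if j == a then (Y i a + Y i b) / r
    else if j == b then (Y i b - Y i a) / r else Y i j.
Proof.
have S c : \sum_k Y i k * (k == c)%:R = Y i c.
  rewrite (bigD1 c)//= eqxx mulr1 big1 ?addr0// => k /negbTE ->.
  by rewrite mulr0.
rewrite mxE; case: ifP => ja.
  under eq_bigr do rewrite mxE ja mulrA mulrDr.
  by rewrite -mulr_suml big_split/= !S.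
case: ifP => jb.
  under eq_bigr do rewrite mxE ja jb mulrA mulrBr.
  by rewrite -mulr_suml sumrB !S.
by under eq_bigr do rewrite mxE ja jb; rewrite S.
Qed.

Lemma rot_mx_orth : rot_mx *m rot_mx^T = 1%:M.
Proof.
apply: mulmx1C; apply/matrixP => i j; rewrite mul_rot_mx !mxE.
have r2 : r * r = 2 by rewrite -expr2 sqr_sqrtr.
have rn : r != 0 by rewrite gt_eqF// sqrtr_gt0.
have ba : (b == a) = false by rewrite eq_sym (negbTE ab).
have E2 (x : R) : x / r / r = x / 2 by rewrite -mulrA -invfM r2.
rewrite !eqxx (negbTE ab) ba.
have [->|ja] := eqVneq j a.
  have [ia|ia] := eqVneq i a.
    by rewrite /= !mulr1n !mulr0n addr0 add0r -mulrDl E2; field.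
  have [ib|ib] := eqVneq i b.
    by rewrite /= !mulr1n !mulr0n subr0 sub0r -mulrDl E2 addNr mul0r.
  by rewrite /= !mulr0n addr0 mul0r.
have [->|jb] := eqVneq j b.
  have [ia|ia] := eqVneq i a.
    by rewrite ia (negbTE ab) /= !mulr1n !mulr0n addr0 add0r -mulrBl E2 subrr mul0r.
  have [ib|ib] := eqVneq i b.
    by rewrite /= !mulr1n !mulr0n subr0 sub0r -mulrBl E2 opprK; field.
  by rewrite /= !mulr0n subr0 mul0r.
have [ia|ia] := eqVneq i a.
  by rewrite ia (eq_sym a) (negbTE ja) /= !mulr0n addr0 mul0r.
have [ib|ib] := eqVneq i b.
  by rewrite ib (eq_sym b) (negbTE jb) /= !mulr0n subr0 mul0r.
by rewrite eq_sym.
Qed.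

(** [rot_mx] rotates a pair of entries in every row, [giid_rotation] a single pair of variables;
    [W k] is the design with its first [k] rows rotated. *)
Lemma law_invariant_rot : law_invariant rot_mx.
Proof.
pose W (k : nat) (i : 'I_n * 'I_d) t := if (i.1 < k)%N then
  (X t *m rot_mx) i.1 i.2 else Z i t.
suff H k : giid s P (W k).
  exists (W n) => // t; apply/matrixP => i j.
  by rewrite mxE /W /= ltn_ord.
elim: k => [|k IH].
  by have -> : W 0 = Z by apply/funext => -[i j]; apply/funext => t.
have [nk|kn] := leqP n k.
  have -> : W k.+1 = W k; last by [].
  apply/funext => -[i j]; apply/funext => t; rewrite /W /=.
  by rewrite !(leq_trans (ltn_ord i))// ltnW.
pose o := Ordinal kn.
have := giid_rotation s0 IH (k := (o, a)) (l := (o, b)).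
rewrite xpair_eqE eqxx /= ab => /(_ isT).
congr (giid s P _); apply/funext => -[i j]; apply/funext => t.
rewrite !xpair_eqE /W /= ltnn ltnS mul_rot_mx !mxE.
have [->|io] := eqVneq i o; first by rewrite /= ltnn leqnn.
have -> : (i <= k)%N = (i < k)%N.
  by rewrite leq_eqVlt -[k]/(val o) val_eqE (negbTE io).
by [].
Qed.

End rotation.
End invariance.

(** * Moments of the solution operator *)

Lemma sum_delta (R : pzSemiRingType) (I : finType) (f : I -> R) j :
  \sum_i f i * (i == j)%:R = f j.
Proof.
rewrite (bigD1 j)//= eqxx mulr1 big1 ?addr0// => i /negbTE ->.
by rewrite mulr0.
Qed.

(** For [i != j], flipping the sign at [i] is an involution that negates every summand. *)
Lemma sum_signs (R : realType) d (i j : 'I_d) :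
  \sum_(e : {ffun 'I_d -> bool}) ((-1) ^+ e i * (-1) ^+ e j : R) =
  (i == j)%:R * #|{ffun 'I_d -> bool}|%:R.
Proof.
have [->|ij] := eqVneq i j.
  under eq_bigr do rewrite -expr2 sqrr_sign.
  by rewrite sumr_const mul1r.
rewrite mul0r; set S := \sum_e _.
pose phi (e : {ffun 'I_d -> bool}) : {ffun 'I_d -> bool} :=
  [ffun x => if x == i then ~~ e x else e x].
have phiK : involutive phi.
  by move=> e; apply/ffunP => x; rewrite !ffunE; case: (x == i); rewrite ?negbK.
have : S = - S.
  rewrite {1}/S (reindex_inj (inv_inj phiK))/= /S -sumrN; apply: eq_bigr => e _.
  rewrite !ffunE eqxx (eq_sym j) (negbTE ij) signrN mulNr//.
lra.
Qed.

Section moments.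
Context {R : realType} (s : R) (s0 : 0 < s).
Context dT (T : measurableType dT) (P : probability T R).

Section trace.
Variables (n d : nat) (Z : 'I_n * 'I_d -> T -> R) (gZ : giid s P Z).
Local Notation X := (fun t => mxof (fun i => Z i t)).

(** Times [vxi], the covariance of the noise part of the estimate given the design. *)
Definition solver_cov n d (Y : 'M[R]_(n, d)) : 'M[R]_d := solver Y *m (solver Y)^T.

Lemma solver_cov_orth (Y : 'M[R]_(n, d)) (O : 'M[R]_d) : O *m O^T = 1%:M ->
  solver_cov (Y *m O) = O^T *m solver_cov Y *m O.
Proof. by move=> OO; rewrite /solver_cov solver_orth// trmx_mul trmxK !mulmxA. Qed.

Lemma solver_cov_ge0 (Y : 'M[R]_(n, d)) i : 0 <= solver_cov Y i i.
Proof. by rewrite mxE sumr_ge0// => j _; rewrite mxE -expr2 sqr_ge0. Qed.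

Lemma mmx_solver_cov : mmx (fun z : famType R ('I_n * 'I_d)%type => solver_cov (mxof z)).
Proof.
apply: mmx_mul; first by apply: mmx_solver; exact: mmx_fam.
by apply: mmx_tr; apply: mmx_solver; exact: mmx_fam.
Qed.

Lemma mmx_solver_covX : mmx (fun t => solver_cov (X t)).
Proof.
have mX : mmx X by apply: mmx_mxof; exact: giid_measurable gZ.
by apply: mmx_mul; [exact: mmx_solver|apply: mmx_tr; exact: mmx_solver].
Qed.

Variables (A : 'M[R]_d) (AT : A^T = A) (AA : A *m A = A).

Lemma trace_proj_cov (Y : 'M[R]_(n, d)) :
  \tr (A *m solver_cov Y) = \sum_i \sum_j ((A *m solver Y) i j) ^+ 2.
Proof.
have -> : \tr (A *m solver_cov Y) = \tr ((A *m solver Y) *m (A *m solver Y)^T).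
  by rewrite trmx_mul AT [in RHS]mulmxA [in RHS]mxtrace_mulC /solver_cov !mulmxA AA.
apply: eq_bigr => i _; rewrite mxE; apply: eq_bigr => j _.
by rewrite [_^T _ _]mxE expr2.
Qed.

Lemma proj_diag_ge0 i : 0 <= A i i.
Proof.
rewrite -AA mxE; apply: sumr_ge0 => j _.
have -> : A j i = A i j by rewrite -{1}AT mxE.
by rewrite -expr2 sqr_ge0.
Qed.

Lemma integral_trace_cov :
  (\int[P]_t (\tr (A *m solver_cov (X t)))%:E =
   \int[P]_t (\sum_i A i i * solver_cov (X t) i i)%:E)%E.
Proof.
pose E := {ffun 'I_d -> bool}.
pose F (Y : 'M[R]_(n, d)) := (\tr (A *m solver_cov Y))%:E.
have F0 Y : (0 <= F Y)%E.
  rewrite lee_fin trace_proj_cov; apply: sumr_ge0 => i _.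
  by apply: sumr_ge0 => j _; exact: sqr_ge0.
have mF : measurable_fun setT (fun z : famType R ('I_n * 'I_d)%type => F (mxof z)).
  apply/measurable_EFinP; apply: measurable_sum => i.
  by apply: mmx_mul; [exact: mmx_cst|exact: mmx_solver_cov].
have mX : mmx X by apply: mmx_mxof; exact: giid_measurable gZ.
have mFO (e : E) : measurable_fun setT (fun t => F (X t *m sign_mx e)).
  apply/measurable_EFinP; apply: measurable_sum => i.
  have mXO : mmx (fun t => X t *m sign_mx e) by apply: mmx_mul => //; exact: mmx_cst.
  apply: mmx_mul; first exact: mmx_cst.
  by apply: mmx_mul; [exact: mmx_solver|apply: mmx_tr; exact: mmx_solver].
have N0 : (#|E|%:R : R) != 0.
  by rewrite pnatr_eq0 -lt0n; apply/card_gt0P; exists [ffun=> false].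
have mG : measurable_fun setT (fun t => (\sum_i A i i * solver_cov (X t) i i)%:E).
  apply/measurable_EFinP; apply: measurable_sum => i; apply: measurable_funM => //.
  exact: mmx_solver_covX.
have G0 t : (0 <= (\sum_i A i i * solver_cov (X t) i i)%:E)%E.
  rewrite lee_fin; apply: sumr_ge0 => i _.
  by rewrite mulr_ge0 ?proj_diag_ge0 ?solver_cov_ge0.
have K : ((#|E|%:R)%:E * \int[P]_t F (X t) =
  (#|E|%:R)%:E * \int[P]_t (\sum_i A i i * solver_cov (X t) i i)%:E)%E.
  transitivity (\sum_(e : E) \int[P]_t F (X t *m sign_mx e))%E.
    under eq_bigr => e _ do rewrite -(ge0_integral_law_invariant gZ
      (law_invariant_sign s0 gZ e) mF F0).
    by rewrite sumr_const mule_natl.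
  rewrite -ge0_integral_sum// -ge0_integralZl//.
  apply: eq_integral => t _; rewrite sumEFin -EFinM; congr EFin.
  have FE (e : E) : \tr (A *m solver_cov (X t *m sign_mx e)) =
      \sum_i \sum_j (A i j * solver_cov (X t) j i) * ((-1) ^+ e i * (-1) ^+ e j).
    apply: eq_bigr => i _; rewrite mxE; apply: eq_bigr => j _.
    rewrite solver_cov_orth ?sign_mx_orth// /sign_mx tr_diag_mx mul_mx_diag.
    by rewrite mxE mul_diag_mx !mxE; ring.
  under eq_bigr do rewrite FE.
  rewrite exchange_big mulr_sumr; apply: eq_bigr => i _ /=.
  rewrite exchange_big/=.
  under eq_bigr => j _ do rewrite -mulr_sumr sum_signs mulrCA mulrC eq_sym.
  by rewrite (sum_delta (fun j => A i j * solver_cov (X t) j i * _)) mulrC.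
have := congr1 (fun x => (#|E|%:R^-1)%:E * x)%E K.
by rewrite !muleA -!EFinM mulVf// !mul1e.
Qed.

Lemma integral_cov_diag i j :
  (\int[P]_t (solver_cov (X t) i i)%:E = \int[P]_t (solver_cov (X t) j j)%:E)%E.
Proof.
pose g := tperm i j.
rewrite (ge0_integral_law_invariant (F := fun Y => (solver_cov Y i i)%:E) gZ
  (law_invariant_perm gZ g)).
- apply: eq_integral => t _; rewrite solver_cov_orth ?perm_mx_orth//.
  by rewrite tr_perm_mx invgK -row_permE -col_permE !mxE /g tpermL.
- by apply/measurable_EFinP; exact: mmx_solver_cov.
- by move=> Y; rewrite lee_fin solver_cov_ge0.
Qed.

End trace.

(** The mean of a diagonal entry of the inverse Gram matrix of an [m] by [p] design: the other
    [p.-1] columns leave a projection of rank [m - p.-1]. *)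
Definition wish m p : \bar R := if (m - p.-1 <= 2)%N then +oo%E
  else ((s ^+ 2 * ((m - p.-1)%:R - 2))^-1)%:E.

Lemma solver_cov_tall n d (Y : 'M[R]_(n, d)) : (d <= n)%N ->
  solver_cov Y = ginv (gram Y).
Proof.
move=> dn; rewrite /solver_cov /solver dn.
have [W0|W0] := eqVneq (\det (gram Y)) 0; first by rewrite ginv_singular// !mul0mx.
rewrite ginvE// trmx_mul trmxK trmx_inv gram_sym -mulmxA (mulmxA Y^T).
by rewrite -[Y^T *m Y]/(gram Y) mulmxV ?mulmx1// unitmxE unitfE.
Qed.

Lemma integral_cov_tall n d (Z : 'I_n * 'I_d -> T -> R) i :
  giid s P Z -> (d <= n)%N ->
  (\int[P]_t (solver_cov (mxof (fun k => Z k t)) i i)%:E = wish n d)%E.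
Proof.
case: d => [|p] in Z i *; first by case: i.
move=> gZ dn; rewrite (integral_cov_diag gZ i 0) /wish /= -(inverse_wishart00 s0 dn gZ).
apply: eq_integral => t _; rewrite -solver_cov_tall// ger0_norm//.
exact: solver_cov_ge0.
Qed.

(** [solver_cov] has the same trace for a design and its transpose, and the transpose is tall. The
    factors [d] and [n] count equal diagonal means; the product form avoids dividing extended
    reals. *)
Lemma integral_cov_wide n d (Z : 'I_n * 'I_d -> T -> R) i :
  giid s P Z -> (n < d)%N ->
  (d%:R%:E * \int[P]_t (solver_cov (mxof (fun k => Z k t)) i i)%:E =
   n%:R%:E * wish d n)%E.
Proof.
move=> gZ nd.
pose Zt (k : 'I_d * 'I_n) := Z (k.2, k.1).
have gZt : giid s P Zt.
  by apply: (giid_inj gZ (h := fun k : 'I_d * 'I_n => (k.2, k.1))) => -[a b] [a' b'] [-> ->].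
have XT t : mxof (fun k => Zt k t) = (mxof (fun k => Z k t))^T.
  by apply/matrixP => a b; rewrite !mxE.
have E t : \sum_k solver_cov (mxof (fun k => Z k t)) k k =
    \sum_k solver_cov (mxof (fun k => Zt k t)) k k.
  rewrite -!/(\tr _) [in RHS]solver_cov_tall ?(ltnW nd)// XT.
  move: (mxof _) => Y; rewrite /solver_cov /solver leqNgt nd /= mxtrace_mulC.
  have [W0|W0] := eqVneq (\det (gram Y^T)) 0.
    by rewrite ginv_singular// !mulmx0.
  rewrite ginvE// trmx_mul trmxK trmx_inv gram_sym -mulmxA (mulmxA Y).
  have -> : Y *m Y^T = gram Y^T by rewrite /gram trmxK.
  by rewrite mulmxV ?mulmx1// unitmxE unitfE.
transitivity (\sum_k \int[P]_t (solver_cov (mxof (fun k => Z k t)) k k)%:E)%E.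
  rewrite (eq_bigr _ (fun k _ => integral_cov_diag gZ k i)) sumr_const card_ord.
  by rewrite mule_natl.
rewrite -ge0_integral_sum//; last 2 first.
- by move=> k; apply/measurable_EFinP; exact: mmx_solver_covX.
- by move=> k t _; rewrite lee_fin solver_cov_ge0.
under eq_integral do rewrite sumEFin E -sumEFin.
rewrite ge0_integral_sum//; last 2 first.
- by move=> k; apply/measurable_EFinP; exact: mmx_solver_covX.
- by move=> k t _; rewrite lee_fin solver_cov_ge0.
rewrite (eq_bigr _ (fun k _ => integral_cov_tall k gZt (ltnW nd))) sumr_const card_ord.
by rewrite mule_natl.
Qed.

End moments.

(** * Second moments of the projection onto the row space *)

Section hat_moments.
Context {R : realType} (s : R) (s0 : 0 < s).
Context dT (T : measurableType dT) (P : probability T R) (n d : nat).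
Variables (Z : 'I_n * 'I_d -> T -> R) (gZ : giid s P Z) (nd : (n < d)%N).
Local Notation X := (fun t => mxof (fun i => Z i t)).
Local Notation p i j t := (hat (X t) i j).

Let hs (Y : 'M[R]_(n, d)) i j : hat Y i j = hat Y j i.
Proof. by rewrite -{1}hat_sym mxE. Qed.

Lemma hat_row_sq (Y : 'M[R]_(n, d)) i : \sum_j hat Y i j * hat Y i j = hat Y i i.
Proof.
rewrite -[in RHS]hat_idem mxE; apply: eq_bigr => j _.
by rewrite (hs Y j i).
Qed.

Let hat_sq_le (Y : 'M[R]_(n, d)) i j : hat Y i j ^+ 2 <= hat Y i i.
Proof.
rewrite -hat_row_sq (bigD1 j)//= expr2 lerDl.
by apply: sumr_ge0 => k _; rewrite -expr2 sqr_ge0.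
Qed.

Lemma hat_bound (Y : 'M[R]_(n, d)) i j : `|hat Y i j| <= 1.
Proof.
have h1 : hat Y i i <= 1 by have := hat_sq_le Y i i; have := sqr_ge0 (hat Y i i - 1); nra.
rewrite -(@ler_pXn2r _ 2)// ?nnegrE// expr1n real_normK ?num_real//.
exact: le_trans (hat_sq_le Y i j) h1.
Qed.

(** The extra factor makes the trace identity hold for every matrix, since [hat] is 0 on degenerate
    ones. *)
Lemma trace_hat (Y : 'M[R]_(n, d)) i : \tr (hat Y) * hat Y i i = n%:R * hat Y i i.
Proof.
have [H|/solver_deg H] := boolP (nondeg Y); last by rewrite /hat H mul0mx mxE !mulr0.
by rewrite {1}/hat mxtrace_mulC solver_right// mxtrace1.
Qed.

Let mX : mmx X. Proof. by apply: mmx_mxof; exact: giid_measurable gZ. Qed.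
Let mp i j : measurable_fun setT (fun t => p i j t).
Proof. exact: (mmx_hat mX). Qed.
Let mpf i j : measurable_fun setT
  (fun z : famType R ('I_n * 'I_d)%type => hat (mxof z) i j).
Proof. by apply: mmx_hat; exact: mmx_fam. Qed.

Let tau i j k l := fine (\int[P]_t (p i j t * p k l t)%:E)%E.

Let tauP i j k l : has_mean P (fun t => p i j t * p k l t) (tau i j k l).
Proof.
have [|m H] := @has_mean_bounded _ _ _ P (fun t => p i j t * p k l t) 1
  (measurable_funM (mp i j) (mp k l)).
  by move=> t; rewrite normrM mulr_ile1 ?hat_bound.
by rewrite /tau; case: (H) => _ ->.
Qed.

Let tau_inv O i j k l : O *m O^T = 1%:M -> law_invariant s P Z O ->
  forall m, has_mean P (fun t => (O^T *m hat (X t) *m O) i j * (O^T *m hat (X t) *m O) k l) m ->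
  tau i j k l = m.
Proof.
move=> OO li m H; apply: has_mean_unique (tauP i j k l) _.
apply: (has_mean_law_invariant (F := fun Y => hat Y i j * hat Y k l) gZ li).
  exact: measurable_funM.
by apply: has_mean_ext H => t; rewrite hat_orth.
Qed.

(** Flipping coordinate [x] contributes a sign for each index equal to [x]. *)
Let tau_odd x i j k l : odd ((i == x) + (j == x) + (k == x) + (l == x)) ->
  tau i j k l = 0.
Proof.
move=> od; suff : tau i j k l = - tau i j k l by lra.
pose e y := y == x.
apply: (tau_inv (sign_mx_orth e) (law_invariant_sign s0 gZ e)).
apply: has_mean_ext (_ : has_mean P (fun t => -1 * (p i j t * p k l t)) _); last first.
  by have := has_meanZ (-1) (tauP i j k l); rewrite mulN1r.
have E (H : 'M[R]_d) a b :
    ((sign_mx e)^T *m H *m sign_mx e) a b = (-1) ^+ e a * H a b * (-1) ^+ e b.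
  by rewrite /sign_mx tr_diag_mx mul_mx_diag mxE mul_diag_mx !mxE.
move=> t; rewrite !E.
transitivity ((-1) ^+ ((i == x) + (j == x) + (k == x) + (l == x)) *
  (p i j t * p k l t)).
  by rewrite -signr_odd od.
by rewrite !exprD /e; ring.
Qed.

Let tau_perm (g : {perm 'I_d}) i j k l : tau i j k l = tau (g i) (g j) (g k) (g l).
Proof.
apply: (tau_inv (perm_mx_orth g) (law_invariant_perm gZ g)).
apply: has_mean_ext (tauP (g i) (g j) (g k) (g l)) => t.
by rewrite tr_perm_mx invgK -row_permE -!col_permE !mxE.
Qed.

Let perm_pair (a b a' b' : 'I_d) : a != b -> a' != b' ->
  exists g : {perm 'I_d}, g a = a' /\ g b = b'.
Proof.
move=> ab ab'; pose g1 := tperm a a'.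
have g1a : g1 a = a' by rewrite /g1 tpermL.
exists (g1 * tperm (g1 b) b')%g; rewrite !permM g1a tpermL; split => //.
by rewrite tpermD// 1?eq_sym// -g1a (inj_eq perm_inj).
Qed.

(** The rotation in the plane of [a] and [b] turns the entry [(a, b)] into [(p b b - p a a) / 2],
    whose second moment is expanded. *)
Let tau_rot a b : a != b ->
  tau a b a b = (tau a a a a + tau b b b b - 2 * tau a a b b) / 4.
Proof.
move=> ab; apply: (tau_inv (rot_mx_orth ab) (law_invariant_rot s0 gZ ab)).
have H := has_meanZ (4^-1) (has_meanD (has_meanD (tauP a a a a) (tauP b b b b))
  (has_meanZ (- 2) (tauP a a b b))).
rewrite (_ : _ / 4 = 4^-1 *
  (tau a a a a + tau b b b b + - 2 * tau a a b b)); last by field.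
apply: has_mean_ext H => t.
have ba : (b == a) = false by rewrite eq_sym (negbTE ab).
have E j : (((rot_mx a b : 'M[R]_d))^T *m hat (X t)) a j = (p j a t + p j b t) / Num.sqrt 2.
  rewrite -[X in (_ *m X) _ _]hat_sym -trmx_mul mxE mul_rot_mx eqxx.
  by rewrite !(hs _ j).
have r2 : Num.sqrt 2 * Num.sqrt 2 = 2 :> R by rewrite -expr2 sqr_sqrtr.
have F : (((rot_mx a b : 'M[R]_d))^T *m hat (X t) *m (rot_mx a b : 'M[R]_d)) a b = (p b b t - p a a t) / 2.
  rewrite mul_rot_mx ba eqxx !E -mulrBl -mulrA -invfM r2 (hs _ b a).
  by congr (_ / _); ring.
by rewrite F; field.
Qed.

Let tauC i j k l : tau i j k l = tau i j l k.
Proof. by rewrite /tau; congr fine; apply: eq_integral => t _; rewrite (hs _ k). Qed.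

Hypothesis d2 : (1 < d)%N.

(** The second moment of an off-diagonal entry of [hat]. *)
Definition hat_offdiag : R :=
  n%:R * (d%:R - n%:R) / (d%:R * (d%:R - 1) * (d%:R + 2)).

Let a0 : 'I_d := Ordinal (ltnW d2).
Let b0 : 'I_d := Ordinal d2.
Let ab0 : a0 != b0. Proof. by []. Qed.

Let tau_v x y : x != y -> tau x y x y = tau a0 b0 a0 b0.
Proof.
by move=> xy; have [g [gx gy]] := perm_pair xy ab0; rewrite (tau_perm g) gx gy.
Qed.

Let tau_u x y : x != y -> tau x x y y = tau a0 a0 b0 b0.
Proof.
by move=> xy; have [g [gx gy]] := perm_pair xy ab0; rewrite (tau_perm g) gx gy.
Qed.

Let tau_s x : tau x x x x = tau a0 a0 a0 a0.
Proof. by rewrite (tau_perm (tperm x a0)) tpermL. Qed.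

Let rotE : tau a0 a0 a0 a0 = tau a0 a0 b0 b0 + 2 * tau a0 b0 a0 b0.
Proof. by have := tau_rot ab0; rewrite (tau_s b0); lra. Qed.

(** An isotropic tensor of order four. Sign flips kill every index of odd multiplicity, permutations
    leave one constant for each pattern [aaaa], [aabb], [abab], and the rotation gives
    [aaaa = aabb + 2 abab]. *)
Lemma tauE i j k l : tau i j k l = tau a0 a0 b0 b0 * ((i == j)%:R * (k == l)%:R) +
  tau a0 b0 a0 b0 * ((i == k)%:R * (j == l)%:R + (i == l)%:R * (j == k)%:R).
Proof.
have [ij|ij] := eqVneq i j; have [kl|kl] := eqVneq k l.
- subst j l; have [->|ik] := eqVneq i k; first by rewrite tau_s rotE; rewrite ?eqxx /=; ring.
  by rewrite tau_u//; rewrite ?eqxx /=; ring.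
- subst j; rewrite (@tau_odd k); last first.
    by rewrite eqxx (eq_sym l) (negbTE kl) addn0 addn1 /= addnn odd_double.
  have [ik|ik] := eqVneq i k; last by rewrite /=; ring.
  by rewrite ik (negbTE kl); rewrite ?eqxx /=; ring.
- subst l; rewrite (@tau_odd i); last first.
    by rewrite eqxx (eq_sym j) (negbTE ij) addn0 -addnA oddD addnn odd_double.
  have [ik|ik] := eqVneq i k; last by rewrite /=; ring.
  by rewrite -ik (eq_sym j) (negbTE ij); rewrite ?eqxx /=; ring.
have [ik|ik] := eqVneq i k.
  have [jl|jl] := eqVneq j l.
    by subst k l; rewrite tau_v// (eq_sym j) (negbTE ij); rewrite ?eqxx /=; ring.
  subst k; rewrite (@tau_odd j); last first.
    by rewrite eqxx (negbTE ij) (eq_sym l) (negbTE jl).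
  by rewrite (negbTE kl); rewrite ?eqxx /=; ring.
have [il|il] := eqVneq i l.
  have [jk|jk] := eqVneq j k.
    by subst k l; rewrite tauC tau_v//; rewrite ?eqxx /=; ring.
  subst l; rewrite (@tau_odd j); last first.
    by rewrite eqxx (negbTE ij) (eq_sym k) (negbTE jk).
  by rewrite /=; ring.
rewrite (@tau_odd i); last first.
  by rewrite eqxx (eq_sym j) (negbTE ij) (eq_sym k) (negbTE ik) (eq_sym l) (negbTE il).
by rewrite /=; ring.
Qed.

Let mean1 i : has_mean P (fun t => p i i t) (n%:R / d%:R).
Proof.
have d0 : d%:R != 0 :> R by rewrite pnatr_eq0 -lt0n (ltn_trans _ d2).
have [m0 H0] := @has_mean_bounded _ _ _ P (fun t => p i i t) 1 (mp i i)
  (fun t => hat_bound _ _ _).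
have H j : has_mean P (fun t => p j j t) m0.
  pose g := tperm j i.
  apply: (has_mean_law_invariant (F := fun Y => hat Y j j) gZ (law_invariant_perm gZ g)) => //.
  apply: has_mean_ext H0 => t; rewrite hat_orth ?perm_mx_orth//.
  by rewrite tr_perm_mx invgK -row_permE -col_permE !mxE tpermL.
have [S1 S2] := has_mean_sum (index_enum 'I_d) H.
suff -> : n%:R / d%:R = m0 by [].
apply: (mulIf d0); rewrite divfK//.
apply: EFin_inj.
have -> : m0 * d%:R = \sum_(j < d) m0 by rewrite sumr_const card_ord mulr_natr.
rewrite -S2.
pose Zt (k : 'I_d * 'I_n) := Z (k.2, k.1).
have gZt : giid s P Zt.
  by apply: (giid_inj gZ (h := fun k : 'I_d * 'I_n => (k.2, k.1))) => -[a b] [a' b'] [-> ->].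
have XT t : mxof (fun k => Zt k t) = (X t)^T by apply/matrixP => a b; rewrite !mxE.
have N0 := gram_full_rank s0 (ltnW nd) gZt.
transitivity (\int[P]_t (n%:R)%:E)%E.
  by rewrite integral_cst// [X in (_ * X)%E]probability_setT mule1.
apply: ae_eq_integral => //.
  by case/integrableP: S1.
exists [set t | \det (gram (mxof (fun k => Zt k t))) = 0]; split => //.
  have mB : measurable_fun setT (fun t => \det (gram (mxof (fun k => Zt k t)))).
    by apply: mmx_det; apply: mmx_gram; apply: mmx_mxof; exact: giid_measurable gZt.
  by have := mB measurableT _ (measurable_set1 0); rewrite setTI; apply.
move=> t /= /not_implyP[_ K]; apply: contrapT => /eqP; rewrite XT => W0; apply: K.
have nz : nondeg (X t) by rewrite /nondeg leqNgt nd.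
by rewrite -/(\tr _) /hat mxtrace_mulC solver_right// mxtrace1.
Qed.

Let sum_split (f : 'I_d -> R) c : (forall j, j != a0 -> f j = c) ->
  \sum_j f j = f a0 + (d%:R - 1) * c.
Proof.
move=> fc; rewrite (bigD1 a0)//= (eq_bigr (fun=> c))// sumr_const; congr (_ + _).
rewrite -[LHS]mulr_natl; congr (_ * _); rewrite cardC1 card_ord -subn1 natrB//.
exact: ltnW.
Qed.

(** Write [u] for [aabb] and [v] for [abab]. Idempotence gives [u + (d + 1) v = n / d], the trace
    gives [d u + 2 v = n^2 / d], and eliminating [u] leaves [(d - 1) (d + 2) v = n (d - n) / d]. *)
Let tau_offdiag : tau a0 b0 a0 b0 = hat_offdiag.
Proof.
have d1' : 1 < d%:R :> R by rewrite ltr1n.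
have E1 : tau a0 a0 a0 a0 + (d%:R - 1) * tau a0 b0 a0 b0 = n%:R / d%:R.
  rewrite -(sum_split (f := fun j => tau a0 j a0 j)).
    apply: has_mean_unique (mean1 a0).
    apply: has_mean_ext (has_mean_sum (index_enum 'I_d) (fun j => tauP a0 j a0 j)) => t.
    exact: hat_row_sq.
  by move=> j ja; rewrite tau_v// eq_sym.
have E2 : tau a0 a0 a0 a0 + (d%:R - 1) * tau a0 a0 b0 b0 = n%:R * (n%:R / d%:R).
  rewrite -(sum_split (f := fun j => tau a0 a0 j j)).
    apply: has_mean_unique (has_meanZ n%:R (mean1 a0)).
    apply: has_mean_ext (has_mean_sum (index_enum 'I_d) (fun j => tauP a0 a0 j j)) => t.
    by rewrite -trace_hat -mulr_sumr mulrC.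
  by move=> j ja; rewrite tau_u// eq_sym.
rewrite rotE in E1 E2.
have E3 : tau a0 b0 a0 b0 * ((d%:R - 1) * (d%:R + 2)) = n%:R * (d%:R - n%:R) / d%:R.
  have -> : n%:R * (d%:R - n%:R) / d%:R = d%:R * (n%:R / d%:R) - n%:R * (n%:R / d%:R) :> R.
    by field; lra.
  by rewrite -E2 -E1; ring.
rewrite /hat_offdiag; apply: (mulIf (x := (d%:R - 1) * (d%:R + 2))).
  by rewrite mulf_neq0// gt_eqF//; lra.
by rewrite E3; field; rewrite !gt_eqF//; lra.
Qed.

(** Of the three index pairings in [tauE] only one survives: the other two contract [A] with
    [theta]. *)
Lemma has_mean_proj_hat (A : 'M[R]_d) (theta : 'cV[R]_d) :
  A^T = A -> A *m A = A -> A *m theta = 0 ->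
  has_mean P (fun t => \sum_i ((A *m (hat (X t) *m theta)) i 0) ^+ 2)
    (hat_offdiag * (\sum_i theta i 0 ^+ 2) * \tr A).
Proof.
move=> AT AA At.
have At' j : \sum_k A j k * theta k 0 = 0.
  by have := congr1 (fun M : 'cV[R]_d => M j 0) At; rewrite !mxE.
have At2 j : \sum_k A k j * theta k 0 = 0.
  by rewrite -[RHS](At' j); apply: eq_bigr => k _; rewrite -{1}AT mxE.
have H : has_mean P (fun t => \sum_j \sum_k \sum_i \sum_l
    (A j k * theta i 0 * theta l 0) * (p j i t * p k l t))
  (\sum_j \sum_k \sum_i \sum_l (A j k * theta i 0 * theta l 0) * tau j i k l).
  by do 4 (apply: has_mean_sum => ?); apply: has_meanZ; exact: tauP.
have -> : hat_offdiag * (\sum_i theta i 0 ^+ 2) * \tr A =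
  \sum_j \sum_k \sum_i \sum_l (A j k * theta i 0 * theta l 0) * tau j i k l.
  set u := tau a0 a0 b0 b0; set v := tau a0 b0 a0 b0.
  have S j k : \sum_i \sum_l (A j k * theta i 0 * theta l 0) * tau j i k l =
      (u + v) * (A j k * theta k 0) * theta j 0 +
      (v * \sum_i theta i 0 ^+ 2) * A j k * (k == j)%:R.
    have -> : \sum_i \sum_l (A j k * theta i 0 * theta l 0) * tau j i k l =
      \sum_i (u * A j k * theta k 0 * theta i 0 * (i == j)%:R +
        (v * A j k * theta i 0 ^+ 2 * (k == j)%:R +
         v * A j k * theta j 0 * theta i 0 * (i == k)%:R)).
      apply: eq_bigr => i _.
      transitivity (\sum_l (u * A j k * theta i 0 * (i == j)%:R * theta l 0 * (l == k)%:R +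
         (v * A j k * theta i 0 * (k == j)%:R * theta l 0 * (l == i)%:R +
          v * A j k * theta i 0 * (i == k)%:R * theta l 0 * (l == j)%:R))).
        apply: eq_bigr => l _; rewrite tauE -/u -/v.
        by rewrite (eq_sym j i) (eq_sym k l) (eq_sym j k) (eq_sym i l) (eq_sym j l); ring.
      by rewrite !big_split/= !sum_delta; ring.
    rewrite !big_split/= !sum_delta -mulr_suml -mulr_sumr; ring.
  transitivity (\sum_j (v * \sum_i theta i 0 ^+ 2) * A j j).
    by rewrite -mulr_sumr -/(\tr A) /v tau_offdiag.
  apply: eq_bigr => j _; rewrite (eq_bigr _ (fun k _ => S j k)) big_split/=.
  by rewrite sum_delta -mulr_suml -mulr_sumr At' mulr0 mul0r add0r.
apply: has_mean_ext H => t.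
set b := hat (X t) *m theta.
have -> : \sum_i (A *m b) i 0 ^+ 2 = (b^T *m A *m b) 0 0.
  rewrite -{2}AA -{2}AT mulmxA -trmx_mul -mulmxA mxE; apply: eq_bigr => i _.
  by rewrite [_^T _ _]mxE expr2.
rewrite -mulmxA mxE; apply: eq_bigr => j _; rewrite [_^T _ _]mxE [(A *m b) _ _]mxE mulr_sumr.
apply: eq_bigr => k _; rewrite !mxE.
transitivity ((\sum_i p j i t * theta i 0) * (A j k * \sum_l p k l t * theta l 0)) => //.
rewrite mulr_suml; apply: eq_bigr => i _; rewrite mulr_sumr mulr_sumr.
by apply: eq_bigr => l _; ring.
Qed.

End hat_moments.

(** * Haar averaging *)

Section nonmeasurable.
Context {R : realType} d (T : measurableType d).
Variable mu : {measure set T -> \bar R}.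
Local Open Scope ereal_scope.

Import HBNNSimple.

(** The integral of a nonnegative function is a supremum over the simple functions below it, hence
    monotone without measurability. The competitor [h'] may depend on the sample in any way. *)
Lemma ge0_le_integral_nonmeasurable (f g : T -> \bar R) :
  (forall x, 0 <= f x) -> (forall x, f x <= g x) ->
  \int[mu]_x f x <= \int[mu]_x g x.
Proof.
move=> f0 fg; have g0 x : 0 <= g x by exact: le_trans (fg x).
rewrite !ge0_integralTE//; apply: ereal_sup_le => _ [h hf <-].
by exists h => // x; exact: le_trans (hf x) (fg x).
Qed.

(* [f] need not be measurable: it is squeezed between [g] off [N] and
   [g] set to [+oo] on [N]. *)
Lemma ge0_integral_off_null (N : set T) (f g : T -> \bar R) :
  measurable N -> mu N = 0 -> measurable_fun setT g ->
  (forall x, 0 <= f x) -> (forall x, 0 <= g x) ->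
  (forall x, ~ N x -> f x = g x) ->
  \int[mu]_x f x = \int[mu]_x g x.
Proof.
move=> mN N0 mg f0 g0 fg.
have mI (M : set T) : measurable M -> measurable_fun setT (EFin \o (\1_M : T -> R)).
  by move=> mM; apply/measurable_EFinP; exact: measurable_indic.
have I0 (M : set T) x : 0 <= (\1_M x : R)%:E by rewrite lee_fin.
pose g1 x := g x * (\1_(~` N) x)%:E.
pose g2 x := g x + +oo * (\1_N x)%:E.
have mg1 : measurable_fun setT g1.
  by apply: emeasurable_funM => //; apply: mI; exact: measurableC.
have mg2 : measurable_fun setT g2.
  apply: emeasurable_funD => //; apply: emeasurable_funM; last exact: mI.
  exact: measurable_cst.
have off x : ~ N x -> g1 x = g x /\ g2 x = g x.
  move=> Nx; rewrite /g1 /g2 !indicE mem_set ?memNset//.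
  by rewrite mule1 mule0 adde0.
have ae h : (forall x, ~ N x -> h x = g x) -> ae_eq mu setT h g.
  move=> hg; exists N; split => // x /= /not_implyP[_ H].
  by apply: contrapT => /hg.
have g10 x : 0 <= g1 x by rewrite mule_ge0.
have g20 x : 0 <= g2 x by rewrite adde_ge0// mule_ge0.
apply/eqP; rewrite eq_le; apply/andP; split.
  have <- : \int[mu]_x g2 x = \int[mu]_x g x.
    apply: ge0_ae_eq_integral => //; apply: ae => x Nx; exact: (off x Nx).2.
  apply: ge0_le_integral_nonmeasurable => // x.
  have [Nx|Nx] := pselect (N x); last by rewrite (off x Nx).2 fg.
  by rewrite /g2 indicE mem_set//= mule1 addey ?leey// -ltNye (lt_le_trans _ (g0 x)).
have <- : \int[mu]_x g1 x = \int[mu]_x g x.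
  apply: ge0_ae_eq_integral => //; apply: ae => x Nx; exact: (off x Nx).1.
apply: ge0_le_integral_nonmeasurable => // x.
have [Nx|Nx] := pselect (N x); last by rewrite (off x Nx).1 fg.
by rewrite /g1 indicE memNset//= mule0.
Qed.

End nonmeasurable.

(** * The Haar average as an orthogonal projection *)

Section haar.
Context {R : realType} (d : nat) (G : compact_group) (phi : G -> 'M[R]_d).
Variables (lam : (G -> R) -> R) (ph : orth_rep phi) (hl : haar_integral lam).
Local Notation B := (avg_mx lam phi).

Let cphi i j : continuous (fun g => phi g i j).
Proof. by case: ph => _ _ _; apply. Qed.

(** [lam] is linear on continuous functions only, so continuity is carried through the induction. *)
Let csum (I : Type) (r : seq I) (c : I -> R) (f : I -> G -> R) :
  (forall k, continuous (f k)) ->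
  continuous (fun g => \sum_(k <- r) c k * f k g) /\
  lam (fun g => \sum_(k <- r) c k * f k g) = \sum_(k <- r) c k * lam (f k).
Proof.
move=> cf; case: hl => lD lZ _ l1 _.
have c0 : continuous (fun _ : G => 0 : R) by move=> x; exact: cvg_cst.
have cZ k : continuous (fun g => c k * f k g).
  by move=> x; apply: cvgM; [exact: cvg_cst|exact: cf].
elim: r => [|k r [cr lr]].
  rewrite (_ : (fun g => _) = fun _ : G => 0) ?big_nil; last first.
    by apply/funext => g; rewrite big_nil.
  by split => //; have := lZ 0 _ c0; rewrite !mul0r.
rewrite (_ : (fun g => _) = fun g => c k * f k g + \sum_(k <- r) c k * f k g); last first.
  by apply/funext => g; rewrite big_cons.
rewrite big_cons; split; last by rewrite lD// lZ// lr.
by move=> x; apply: cvgD; [exact: cZ|exact: cr].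
Qed.

Let lam_cst (c : R) : lam (fun=> c) = c.
Proof.
case: hl => lD lZ _ l1 _.
have c1 : continuous (fun _ : G => 1 : R) by move=> x; exact: cvg_cst.
by have := lZ c _ c1; rewrite l1 !mulr1.
Qed.

Lemma phi_avg g : phi g *m B = B.
Proof.
apply/matrixP => i j; rewrite !mxE.
under eq_bigr do rewrite mxE.
have [_ <-] := csum (index_enum _) (fun k => phi g i k) (fun k => @cphi k j).
case: hl => _ _ _ _ linv; rewrite -[RHS](linv g)//; congr lam.
by apply/funext => h; case: ph => -> _ _ _; rewrite mxE.
Qed.

Lemma phiT_avg g : (phi g)^T *m B = B.
Proof.
case: ph => _ _ pp _; rewrite -{1}(phi_avg g) mulmxA.
by rewrite (mulmx1C (pp g)) mul1mx.
Qed.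

Lemma avg_idem : B *m B = B.
Proof.
apply/matrixP => i j; rewrite mxE.
under eq_bigr do rewrite [B _ _]mxE mulrC.
have [_ <-] := csum (index_enum _) (fun k => B k j) (fun k => @cphi i k).
rewrite -[RHS]lam_cst; congr lam; apply/funext => g.
by rewrite -[in RHS](phi_avg g) mxE; apply: eq_bigr => k _; rewrite mulrC.
Qed.

(** Integrating [B^T phi(g) = B^T] over [g] gives [B^T B = B^T], and the left side is symmetric. *)
Lemma avg_sym : B^T = B.
Proof.
have H : B^T *m B = B^T.
  apply/matrixP => i j; rewrite mxE.
  under eq_bigr do rewrite [X in _ * X]mxE.
  have [_ <-] := csum (index_enum _) (fun k => B^T i k) (fun k => @cphi k j).
  rewrite -[RHS]lam_cst; congr lam; apply/funext => g.
  by rewrite -[in RHS](phiT_avg g) trmx_mul trmxK mxE.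
by rewrite -[RHS]trmxK -H trmx_mul trmxK.
Qed.

Lemma avg_invariant theta : G_invariant phi (linpred theta) -> B *m theta = theta.
Proof.
move=> inv.
have inv' g : theta^T *m phi g = theta^T.
  apply/matrixP => i j; rewrite !ord1.
  have := inv g (delta_mx j 0); rewrite /linpred mulmxA.
  by rewrite -!colE !mxE.
have H : theta^T *m B = theta^T.
  apply/matrixP => i j; rewrite mxE.
  under eq_bigr do rewrite [X in _ * X]mxE.
  have [_ <-] := csum (index_enum _) (fun k => theta^T i k) (fun k => @cphi k j).
  rewrite -[RHS]lam_cst; congr lam; apply/funext => g.
  by rewrite -[in RHS](inv' g) mxE.
by rewrite -[LHS]trmxK trmx_mul avg_sym H trmxK.
Qed.

Lemma invariant_avg w : B *m w = w -> G_invariant phi (linpred w).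
Proof.
move=> Bw g x; rewrite /linpred mulmxA; congr ((_ *m x) 0 0).
by rewrite -[LHS]trmxK trmx_mul trmxK -{1}Bw mulmxA phiT_avg Bw.
Qed.

Lemma dimA_rank : dimA lam phi = \rank (1%:M - B).
Proof.
rewrite /dimA mxrank_ker subKn ?rank_leq_row// avg_sym -mxrank_opp opprB.
by [].
Qed.

Lemma compl_idem : (1%:M - B) *m (1%:M - B) = 1%:M - B.
Proof. by rewrite mulmxBl mul1mx mulmxBr mulmx1 avg_idem subrr subr0. Qed.

Lemma compl_sym : (1%:M - B)^T = 1%:M - B.
Proof. by rewrite linearB/= trmx1 avg_sym. Qed.

Lemma mxtrace_compl : \tr (1%:M - B) = (dimA lam phi)%:R.
Proof. by rewrite dimA_rank mxtrace_idem// compl_idem. Qed.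

Lemma compl_invariant (theta : 'cV[R]_d) : B *m theta = theta -> (1%:M - B) *m theta = 0.
Proof. by move=> Bt; rewrite mulmxBl mul1mx Bt subrr. Qed.

Definition sqn k (v : 'cV[R]_k) : R := \sum_i v i 0 ^+ 2.

(** Pythagoras: [w - theta] is the orthogonal sum of [B w - theta] and [(1 - B) w]. *)
Lemma sqn_compl w theta : B *m theta = theta ->
  sqn (w - theta) - sqn (B *m w - theta) = sqn ((1%:M - B) *m w).
Proof.
move=> Bt.
have sE k (v : 'cV[R]_k) : sqn v = (v^T *m v) 0 0.
  by rewrite mxE; apply: eq_bigr => i _; rewrite mxE expr2.
rewrite !sE.
have -> : B *m w - theta = B *m (w - theta) by rewrite mulmxBr Bt.
have -> : (1%:M - B) *m w = (1%:M - B) *m (w - theta).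
  by rewrite [RHS]mulmxBr (compl_invariant Bt) subr0.
move: (w - theta) => v.
rewrite !trmx_mul compl_sym avg_sym !mulmxA -(mulmxA _ B B) avg_idem.
rewrite -(mulmxA _ (1%:M - B) (1%:M - B)) compl_idem mulmxBr mulmxBl mulmx1.
by rewrite [RHS]mxE [X in _ = _ + X]mxE.
Qed.

End haar.

(** * The generalisation gap *)

Lemma noise_moments (R : realType) dT (T : measurableType dT) (P : probability T R)
    (f : T -> R) (v : R) :
  P.-integrable setT (EFin \o f) -> ('E_P[f] = 0)%E -> ('V_P[f] = v%:E)%E ->
  has_mean P f 0 /\ has_mean P (fun t => f t ^+ 2) v.
Proof.
move=> fi E0 V0; split.
  by split=> //; have := E0; rewrite unlock.
have mf : measurable_fun setT f by move/measurable_int: fi => /measurable_EFinP.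
have E : (\int[P]_t (f t ^+ 2)%:E = v%:E)%E.
  rewrite -V0 /variance [in RHS]unlock E0 [in RHS]unlock.
  by apply: eq_integral => t _; rewrite /= !fctE /= subr0 expr2.
split=> //; apply/integrableP; split.
  by apply/measurable_EFinP; exact: measurable_funX.
under eq_integral => t _ do rewrite gee0_abs ?lee_fin ?sqr_ge0//.
by rewrite E ltry.
Qed.

Section gap.
Context (R : realType) (d n : nat) (G : compact_group) (phi : G -> 'M[R]_d).
Variables (lam : (G -> R) -> R) (s vxi : R) (theta : 'cV[R]_d).
Context (dT : measure_display) (T : measurableType dT) (P : probability T R).
Variables (X : option 'I_n -> T -> 'cV[R]_d) (xi : option 'I_n -> T -> R).
Hypotheses (ph : orth_rep phi) (hl : haar_integral lam) (s0 : 0 < s)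
  (mX : forall i j, measurable_fun setT (fun t => X i t j 0))
  (nX : forall i j A, measurable A ->
     P ((fun t => X i t j 0) @^-1` A) = normal_prob 0 s A)
  (mxi : forall i, measurable_fun setT (xi i))
  (dxi : forall i A, measurable A -> P (xi i @^-1` A) = P (xi None @^-1` A))
  (ixi : P.-integrable setT (EFin \o xi None))
  (exi : ('E_P[xi None] = 0)%E) (vx : ('V_P[xi None] = vxi%:E)%E)
  (ind : mutual_indep P (sample_family X xi))
  (inv : G_invariant phi (linpred theta)).

Local Notation Y := (fun i t => linpred theta (X i t) + xi i t).
Local Notation w := (fun t => lse (fun k => X (Some k) t) (fun k => Y (Some k) t)).
Local Notation wbar := (fun t => Phi lam phi (w t)).
Local Notation risk := (fun f : 'cV[R]_d -> R =>
  ('E_P[fun t => ((f (X None t) - Y None t) ^+ 2)%R])%E).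
Local Notation gap := (fun h' : T -> 'cV[R]_d -> R =>
  (\int[P]_t (risk (linpred (w t)) - risk (h' t)))%E).
Local Notation B := (avg_mx lam phi).
Local Notation A := (1%:M - B).

Let Bt : B *m theta = theta. Proof. exact: (avg_invariant ph hl inv). Qed.
Let AT : A^T = A. Proof. exact: (compl_sym ph hl). Qed.
Let AA : A *m A = A. Proof. exact: (compl_idem ph hl). Qed.
Let At : A *m theta = 0. Proof. exact: compl_invariant Bt. Qed.

Let xi1 i : has_mean P (xi i) 0.
Proof.
have [H _] := noise_moments ixi exi vx.
apply: (@has_mean_comp _ _ _ _ _ P P (xi i) (xi None) idfun) => //.
- exact: dxi.
- exact: measurable_id.
Qed.

Let xi2 i : has_mean P (fun t => xi i t ^+ 2) vxi.
Proof.
have [_ H] := noise_moments ixi exi vx.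
apply: (@has_mean_comp _ _ _ _ _ P P (xi i) (xi None) (fun x => x ^+ 2)) => //.
- exact: dxi.
Qed.

Let vxi0 : 0 <= vxi.
Proof. by rewrite -lee_fin -vx variance_ge0. Qed.

Let gX i : giid s P (fun j t => X i t j 0).
Proof.
split; [exact: mX|exact: nX|].
have hI : injective (fun j : 'I_d => inl (i, j) : (option 'I_n * 'I_d) + option 'I_n).
  by move=> j k [].
exact: (mutual_indep_inj hI ind).
Qed.

(** The prediction error is a linear combination of the independent centred variables of the test
    pair. The parameter is a constant here, so the risk of [w t] depends on the sample only through
    [w t]. *)
Lemma riskE (u : 'cV[R]_d) :
  risk (linpred u) = (s ^+ 2 * sqn (u - theta) + vxi)%:E.
Proof.
pose h (k : 'I_d + unit) : (option 'I_n * 'I_d) + option 'I_n :=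
  if k is inl j then inl (None, j) else inr None.
have hI : injective h by move=> [j|[]] [k|[]] //= [->].
have iU := mutual_indep_inj hI ind.
set U := fun k => sample_family X xi (h k) in iU.
pose v (k : 'I_d + unit) := if k is inl j then s ^+ 2 else vxi.
have mU k : measurable_fun setT (U k) by case: k => [j|[]]; [exact: mX|exact: mxi].
have U1 k : has_mean P (U k) 0.
  by case: k => [j|[]]; [exact: (giid_mean s0 (gX None))|exact: xi1].
have U2 k : has_mean P (fun t => U k t ^+ 2) (v k).
  by case: k => [j|[]]; [exact: (giid_second_moment s0 (gX None))|exact: xi2].
have [_ E] := has_mean_affine_sq mU iU U1 U2
  (fun k => if k is inl j then (u - theta) j 0 else -1) 0.
rewrite unlock; transitivity (\int[P]_t ((0 + \sum_(k : 'I_d + unit)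
   (if k is inl j then (u - theta) j 0 else -1) * U k t) ^+ 2)%:E)%E.
  apply: eq_integral => t _; congr ((_ ^+ 2)%:E).
  rewrite big_sumType/= add0r (big_pred1 tt) => [|[]//].
  rewrite mulN1r opprD addrA; congr (_ - _).
  rewrite /linpred !mxE -sumrB; apply: eq_bigr => j _.
  by rewrite !mxE mulrBl.
rewrite E; congr EFin; rewrite big_sumType/= (big_pred1 tt) => [|[]//].
rewrite expr0n add0r sqrrN expr1n mul1r; congr (_ + _).
by rewrite /sqn mulr_sumr; apply: eq_bigr => j _; rewrite mulrC.
Qed.

Lemma risk_diff (u : 'cV[R]_d) :
  (risk (linpred u) - risk (linpred (Phi lam phi u)) =
   (s ^+ 2 * sqn (A *m u))%:E)%E.
Proof.
cbv beta; rewrite !riskE -EFinB; congr EFin; rewrite -(sqn_compl ph hl u Bt) /Phi; ring.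
Qed.

Let sqn_ge0 k (v : 'cV[R]_k) : 0 <= sqn v.
Proof. by apply: sumr_ge0 => i _; exact: sqr_ge0. Qed.

Lemma le_gap (h' : T -> 'cV[R]_d -> R) :
  (forall t, (risk (h' t) <= risk (linpred (wbar t)))%E) ->
  (gap (fun t => linpred (wbar t)) <= gap h')%E.
Proof.
move=> hr; apply: ge0_le_integral_nonmeasurable => t.
  by rewrite risk_diff lee_fin mulr_ge0 ?sqr_ge0.
by apply: leeD2l; rewrite leeN2; exact: hr.
Qed.

Let Zx (k : 'I_n * 'I_d) (t : T) : R := X (Some k.1) t k.2 0.
Local Notation Xm := (fun t => mxof (fun k => Zx k t)).

Let gZ : giid s P Zx.
Proof.
split.
- by move=> k; exact: mX.
- by move=> k C mC; exact: nX.
have hI : injective (fun k : 'I_n * 'I_d =>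
    inl (Some k.1, k.2) : (option 'I_n * 'I_d) + option 'I_n).
  by move=> [a b] [a' b'] /= [-> ->].
exact: (mutual_indep_inj hI ind).
Qed.

Let degE : measurable [set t | ~~ nondeg (Xm t)] /\
  P [set t | ~~ nondeg (Xm t)] = 0%E.
Proof.
pose Zt (k : 'I_d * 'I_n) := Zx (k.2, k.1).
have gZt : giid s P Zt.
  by apply: (giid_inj gZ (h := fun k : 'I_d * 'I_n => (k.2, k.1))) => -[a b] [a' b'] [-> ->].
have XT t : mxof (fun k => Zt k t) = (Xm t)^T by apply/matrixP => a b; rewrite !mxE.
have mD m p (Z' : 'I_m * 'I_p -> T -> R) : giid s P Z' ->
    measurable [set t | \det (gram (mxof (fun k => Z' k t))) = 0].
  move=> gZ'; have mB : measurable_fun setT (fun t => \det (gram (mxof (fun k => Z' k t)))).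
    by apply: mmx_det; apply: mmx_gram; apply: mmx_mxof; exact: giid_measurable gZ'.
  by have := mB measurableT _ (measurable_set1 0); rewrite setTI; apply.
have [dn|nd] := leqP d n.
  have -> : [set t | ~~ nondeg (Xm t)] = [set t | \det (gram (Xm t)) = 0].
    by apply/seteqP; split => t /=; rewrite /nondeg dn negbK => /eqP.
  by split; [exact: mD|exact: (gram_full_rank s0 dn gZ)].
have -> : [set t | ~~ nondeg (Xm t)] = [set t | \det (gram (mxof (fun k => Zt k t))) = 0].
  by apply/seteqP; split => t /=; rewrite XT /nondeg leqNgt nd negbK => /eqP.
by split; [exact: mD|exact: (gram_full_rank s0 (ltnW nd) gZt)].
Qed.

Let w_nondeg t : nondeg (Xm t) ->
  w t = hat (Xm t) *m theta + solver (Xm t) *m \col_i xi (Some i) t.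
Proof.
have E : design (fun k => X (Some k) t) = Xm t by apply/matrixP => i j; rewrite !mxE.
move=> H; rewrite lse_solver E// /hat -mulmxA -mulmxDr; congr (_ *m _).
apply/matrixP => i j; rewrite !ord1 !mxE; congr (_ + _).
by rewrite /linpred mxE; apply: eq_bigr => k _; rewrite !mxE mulrC.
Qed.

Let I : finType := ('I_n * 'I_d + 'I_n)%type.
Let idx (k : I) : (option 'I_n * 'I_d) + option 'I_n :=
  match k with inl k => inl (Some k.1, k.2) | inr i => inr (Some i) end.
Let V (k : I) := sample_family X xi (idx k).

Let gapf (z : I -> R) : R := s ^+ 2 * sqn (A *m (hat (mxof (z \o inl)) *m theta +
  solver (mxof (z \o inl)) *m \col_i z (inr i))).

(** Off the null set of degenerate designs the integrand is [gapf] of the training variables. With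
    the noise resampled, the inner integral is the second moment of an affine function of the noise
    with frozen coefficients. *)
Lemma gapE : gap (fun t => linpred (wbar t)) =
  (\int[P]_t (s ^+ 2 * (sqn (A *m (hat (Xm t) *m theta)) +
                        vxi * \tr (A *m solver_cov (Xm t))))%:E)%E.
Proof.
have mV k : measurable_fun setT (V k) by case: k => [k|i]; [exact: mX|exact: mxi].
have iV : mutual_indep P V.
  have hI : injective idx.
    by move=> [[a b]|i] [[a' b']|i'] //= [] => [-> ->|->].
  exact: (mutual_indep_inj hI ind).
have mg d' (T' : measurableType d') (z : I -> T' -> R) :
    (forall k, measurable_fun setT (z k)) ->
    measurable_fun setT (fun t => (gapf (fun k => z k t))%:E).
  move=> mz; apply/measurable_EFinP; apply: measurable_funM => //.
  apply: measurable_sum => i; apply: measurable_funX.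
  have mM : mmx (fun t => mxof ((fun k => z k t) \o inl : 'I_n * 'I_d -> R)).
    by apply: (mmx_mxof (Z := fun k => z (inl k))).
  apply: mmx_mul; first exact: mmx_cst.
  move=> a b; under eq_fun do rewrite mxE.
  apply: measurable_funD.
    by apply: mmx_mul; [exact: mmx_hat|exact: mmx_cst].
  apply: mmx_mul; first exact: mmx_solver.
  by move=> a' b'; under eq_fun do rewrite mxE; exact: mz.
have g0 z : (0 <= (gapf z)%:E)%E by rewrite lee_fin mulr_ge0 ?sqr_ge0.
have [mN N0] := degE.
transitivity (\int[P]_t (gapf (fun k => V k t))%:E)%E.
  apply: (ge0_integral_off_null mN N0); [exact: mg| |by []|].
  - by move=> t; rewrite risk_diff lee_fin mulr_ge0 ?sqr_ge0.
  - by move=> t /negP; rewrite negbK => /w_nondeg H; rewrite risk_diff H.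
pose J (k : I) := if k is inl _ then true else false.
have mgf : measurable_fun setT (fun z : famType R I => (gapf z)%:E).
  by apply: mg => k; exact: measurable_coord.
have H := @ge0_integral_resample R I _ T P _ T P V V J mV mV iV iV
  (fun i _ C _ => erefl) (fun z => (gapf z)%:E) mgf g0.
rewrite [LHS]H.
apply: eq_integral => t _.
pose D := A *m solver (Xm t).
pose c := A *m (hat (Xm t) *m theta).
have hI : injective (fun i : 'I_n => inr (Some i) : (option 'I_n * 'I_d) + option 'I_n).
  by move=> i j [].
have [_ E] := has_meanZ (s ^+ 2) (has_mean_sum (index_enum 'I_d) (fun i =>
  has_mean_affine_sq (fun k => mxi (Some k)) (mutual_indep_inj hI ind)
    (fun k => xi1 (Some k)) (fun k => xi2 (Some k)) (fun k => D i k) (c i 0))).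
transitivity (\int[P]_t' (s ^+ 2 * \sum_i (c i 0 + \sum_k D i k * xi (Some k) t') ^+ 2)%:E)%E.
  apply: eq_integral => t' _; congr ((_ * _)%:E); apply: eq_bigr => i _.
  rewrite mulmxDr mxE; congr ((_ + _) ^+ 2); rewrite mulmxA mxE.
  by apply: eq_bigr => k _; rewrite [X in _ * X = _]mxE.
rewrite E; congr ((_ * _)%:E); rewrite big_split/=; congr (_ + _).
rewrite (trace_proj_cov AT AA) mulr_sumr; apply: eq_bigr => i _.
by rewrite mulr_sumr; apply: eq_bigr => k _; rewrite mulrC.
Qed.

Let mXm : mmx Xm. Proof. by apply: mmx_mxof; exact: giid_measurable gZ. Qed.

Let sq_hat t := sqn (A *m (hat (Xm t) *m theta)).

Let msq : measurable_fun setT (fun t => (sq_hat t)%:E).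
Proof.
apply/measurable_EFinP; apply: measurable_sum => i; apply: measurable_funX.
apply: mmx_mul; first exact: mmx_cst.
by apply: mmx_mul; [exact: mmx_hat|exact: mmx_cst].
Qed.

(** An extended real [kappa] lets one formula cover both finite regimes and the threshold. *)
Lemma gap_cov (kappa : \bar R) :
  (forall i, \int[P]_t (solver_cov (Xm t) i i)%:E = kappa)%E ->
  gap (fun t => linpred (wbar t)) =
  ((s ^+ 2)%:E * (\int[P]_t (sq_hat t)%:E +
     vxi%:E * ((dimA lam phi)%:R%:E * kappa)))%E.
Proof.
move=> hk.
have mtr : measurable_fun setT (fun t => (\tr (A *m solver_cov (Xm t)))%:E).
  apply/measurable_EFinP; apply: measurable_sum => i.
  by apply: mmx_mul; [exact: mmx_cst|exact: mmx_solver_covX gZ].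
have tr0 t : (0 <= (\tr (A *m solver_cov (Xm t)))%:E)%E.
  rewrite lee_fin (trace_proj_cov AT AA); apply: sumr_ge0 => i _.
  by apply: sumr_ge0 => j _; exact: sqr_ge0.
have sq0 t : (0 <= (sq_hat t)%:E)%E by rewrite lee_fin; exact: sqn_ge0.
rewrite gapE.
transitivity (\int[P]_t ((s ^+ 2)%:E * ((sq_hat t)%:E +
    vxi%:E * (\tr (A *m solver_cov (Xm t)))%:E)))%E.
  by apply: eq_integral => t _; rewrite -!EFinM.
rewrite ge0_integralZl//; last 3 first.
- by apply: emeasurable_funD => //; exact: emeasurable_funM.
- by move=> t _; rewrite adde_ge0// mule_ge0// lee_fin.
- by rewrite lee_fin sqr_ge0.
congr (_ * _)%E; rewrite ge0_integralD//; last 2 first.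
- by move=> t _; rewrite mule_ge0// lee_fin.
- exact: emeasurable_funM.
congr (_ + _)%E; rewrite ge0_integralZl// ?lee_fin//; congr (_ * _)%E.
rewrite (integral_trace_cov s0 gZ AT AA) -(mxtrace_compl ph hl).
have A0 i : 0 <= A i i by exact: proj_diag_ge0.
transitivity (\sum_i (A i i)%:E * kappa)%E.
  under eq_integral do rewrite -sumEFin.
  rewrite ge0_integral_sum//; last 2 first.
  - move=> i; apply/measurable_EFinP; apply: measurable_funM => //.
    exact: (mmx_solver_covX gZ i i).
  - by move=> i t _; rewrite lee_fin mulr_ge0 ?A0 ?solver_cov_ge0.
  apply: eq_bigr => i _; rewrite -(hk i) -ge0_integralZl//.
  - by apply/measurable_EFinP; exact: (mmx_solver_covX gZ i i).
  - by move=> t _; rewrite lee_fin solver_cov_ge0.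
  - by rewrite lee_fin A0.
rewrite -ge0_sume_distrl ?sumEFin// => i _; by rewrite lee_fin A0.
Qed.

Lemma gap_over : (d.+1 < n)%N ->
  gap (fun t => linpred (wbar t)) =
  (vxi * (dimA lam phi)%:R / (n%:R - d%:R - 1))%:E.
Proof.
move=> dn.
have dn' : d%:R + 1 < n%:R :> R by rewrite natr1 ltr_nat.
have s2 : 0 < s ^+ 2 by rewrite exprn_gt0.
(* The projection has rank [n - d + 1]; subtracting 2 gives the denominator [n - d - 1]. *)
rewrite (@gap_cov ((s ^+ 2 * (n%:R - d%:R - 1))^-1)%:E); last first.
  move=> i; rewrite (integral_cov_tall s0 i gZ) ?(leq_trans _ dn) 1?ltnW//.
  have d0 : (0 < d)%N by case: (i) => m; exact: leq_ltn_trans.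
  have E : (n - d.-1)%N = (n - d).+1.
    by rewrite -subSn ?(leq_trans _ dn) 1?ltnW// -{2}(prednK d0) subSS.
  rewrite /wish E ifF; last by rewrite ltnS leqNgt ltn_subRL addn1 dn.
  congr ((_ * _)^-1%:E); rewrite -natr1 natrB; last by rewrite ltnW// ltnW.
  by ring.
(* [hat] is the identity, or 0 on degenerate designs; in both cases [A] annihilates the image of
   [theta]. *)
rewrite integral0_eq; last first.
  move=> t _; rewrite /sq_hat.
  have -> : A *m (hat (Xm t) *m theta) = 0.
    have [H|/solver_deg H] := boolP (nondeg (Xm t)).
      by rewrite /hat solver_left ?mul1mx// ltnW// ltnW.
    by rewrite /hat H !mul0mx mulmx0.
  by rewrite /sqn big1// => i _; rewrite mxE expr0n.
rewrite add0e -!EFinM; congr EFin; field.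
by rewrite !gt_eqF//; lra.
Qed.

Lemma gap_under : (n.+1 < d)%N ->
  gap (fun t => linpred (wbar t)) =
  ((dimA lam phi)%:R * (s ^+ 2 * (\sum_(i < d) theta i 0 ^+ 2)
                         * (n%:R * (d%:R - n%:R))
                         / (d%:R * (d%:R - 1) * (d%:R + 2))
                       + vxi * n%:R / (d%:R * (d%:R - n%:R - 1))))%:E.
Proof.
move=> nd.
have nd1 : (n < d)%N by rewrite ltnW.
have d2 : (1 < d)%N by apply: leq_ltn_trans nd; rewrite ltnS.
have nd' : n%:R + 1 < d%:R :> R by rewrite natr1 ltr_nat.
have n0 : 0 <= n%:R :> R by [].
have s2 : 0 < s ^+ 2 by rewrite exprn_gt0.
have dpos : 0 < d%:R :> R by lra.
rewrite (@gap_cov (n%:R / (d%:R * (s ^+ 2 * (d%:R - n%:R - 1))))%:E); last first.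
  move=> i; have K := integral_cov_wide s0 i gZ nd1.
  have K' : (d%:R%:E * \int[P]_t (solver_cov (Xm t) i i)%:E =
     (n%:R / (s ^+ 2 * (d%:R - n%:R - 1)))%:E)%E.
    (* At [n = 0] the truncated predecessor in [wish] would shift the rank by one, but the factor
       [n] makes the product 0. *)
    rewrite K; have [n00|npos] := posnP n; first by rewrite {1 3}n00 mul0e mul0r.
    have E : (d - n.-1)%N = (d - n).+1.
      by rewrite -subSn ?(ltnW nd1)// -{2}(prednK npos) subSS.
    rewrite /wish E ifF; last by rewrite ltnS leqNgt ltn_subRL addn1 nd.
    rewrite -EFinM; congr ((_ * (_ * _)^-1)%:E); rewrite -natr1 natrB ?(ltnW nd1)//.
    by ring.
  have := congr1 (fun x => (d%:R^-1)%:E * x)%E K'.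
  rewrite muleA -EFinM mulVf ?gt_eqF// mul1e => ->; rewrite -EFinM; congr EFin.
  by field; rewrite !gt_eqF//; lra.
have [_ ->] := has_mean_proj_hat s0 gZ nd1 d2 AT AA At.
rewrite -!EFinM (mxtrace_compl ph hl) /hat_offdiag; congr EFin.
by field; rewrite !gt_eqF//; lra.
Qed.

(** Non-invariance of the estimate serves twice: it forces [dimA] to be positive, and it excludes
    the empty sample, where the estimate is 0. The projection rank is then [n - d + 1 <= 2], or
    [d - n + 1 = 2] when [n = d - 1]. *)
Lemma gap_threshold : (d.-1 <= n <= d.+1)%N -> 0 < vxi ->
  ~ {ae P, forall t, G_invariant phi (linpred (w t))} ->
  gap (fun t => linpred (wbar t)) = +oo%E.
Proof.
move=> /andP[n1 n2] v0 nae.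
have s2 : 0 < s ^+ 2 by rewrite exprn_gt0.
have dA0 : (0 < dimA lam phi)%N.
  rewrite lt0n; apply/eqP => dA; apply: nae; apply: aeW => t.
  apply: (invariant_avg ph hl); have := dA; rewrite (dimA_rank ph hl) => /eqP.
  by rewrite mxrank_eq0 subr_eq0 => /eqP <-; rewrite mul1mx.
have d0 : (0 < d)%N.
  by apply: leq_trans dA0 _; rewrite /dimA leq_subr.
rewrite (@gap_cov +oo%E); last first.
  move=> i; have [dn|nd] := leqP d n.
    rewrite (integral_cov_tall s0 i gZ dn) /wish ifT//.
    by rewrite leq_subLR -(prednK d0) addnC in n2 *.
  have K := integral_cov_wide s0 i gZ nd.
  have [n00|npos] := posnP n.
    exfalso; apply: nae; apply: aeW => t.
    have -> : w t = 0.
      apply/matrixP => a b; rewrite !mxE big1// => k _.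
      by case: k => m mn; exfalso; move: (mn); rewrite n00.
    by move=> g x; rewrite /linpred trmx0 !mul0mx.
  have dn1 : d = n.+1 by apply/eqP; rewrite eqn_leq nd andbT -(prednK d0) ltnS.
  have Wy : wish s d n = +oo%E.
    by rewrite /wish ifT// dn1 -{1}(prednK npos) -addn2 addnC -addnBA// subnn.
  rewrite Wy gt0_muley ?lte_fin ?ltr0n// in K.
  have H : (0 <= \int[P]_t (solver_cov (Xm t) i i)%:E)%E.
    by apply: integral_ge0 => t _; rewrite lee_fin solver_cov_ge0.
  by case: (\int[P]_t _)%E H K.
rewrite [X in (_ + _ * X)%E]gt0_muley ?lte_fin ?ltr0n// gt0_muley ?lte_fin//.
rewrite addey ?gt0_muley ?lte_fin//.
rewrite -ltNye; apply: lt_le_trans (integral_ge0 _ _) => //.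
by move=> t _; rewrite lee_fin; exact: sqn_ge0.
Qed.

End gap.

Theorem theorem4p1 (R : realType) (d n : nat)
    (G : compact_group) (phi : G -> 'M[R]_d) (lam : (G -> R) -> R)
    (sX vxi : R) (theta : 'cV[R]_d)
    (dT : measure_display) (T : measurableType dT) (P : probability T R)
    (X : option 'I_n -> T -> 'cV[R]_d) (xi : option 'I_n -> T -> R) :
  orth_rep phi ->
  haar_integral lam ->
  (* X ~ N(0, sX^2 I) : coordinates N(0, sX^2) (independence below) *)
  0 < sX ->
  (forall i j, measurable_fun setT (fun t => X i t j 0)) ->
  (forall i j A, measurable A ->
     P ((fun t => X i t j 0) @^-1` A) = normal_prob 0 sX A) ->
  (* noise: identically distributed, mean 0, variance vxi < oo *)
  (forall i, measurable_fun setT (xi i)) ->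
  (forall i A, measurable A -> P (xi i @^-1` A) = P (xi None @^-1` A)) ->
  P.-integrable setT (EFin \o xi None) ->
  ('E_P[xi None] = 0)%E ->
  ('V_P[xi None] = vxi%:E)%E ->
  (* the test pair and the n training pairs are i.i.d., and X_i indep. of xi_i *)
  mutual_indep P (sample_family X xi) ->
  (* h_theta is G-invariant *)
  G_invariant phi (linpred theta) ->
  let Y := fun i t => linpred theta (X i t) + xi i t in
  let w := fun t => lse (fun k => X (Some k) t) (fun k => Y (Some k) t) in
  let wbar := fun t => Phi lam phi (w t) in
  let risk := fun f : 'cV[R]_d -> R =>
    ('E_P[fun t => ((f (X None t) - Y None t) ^+ 2)%R])%E in
  let gap := fun h' : T -> 'cV[R]_d -> R =>
    (\int[P]_t (risk (linpred (w t)) - risk (h' t)))%E in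
  let dA := (dimA lam phi)%:R : R in
  [/\ (d.+1 < n)%N ->
        let F := vxi * dA / (n%:R - d%:R - 1) in
        gap (fun t => linpred (wbar t)) = F%:E /\
        (forall h' : T -> 'cV[R]_d -> R,
           (forall t, (risk (h' t) <= risk (linpred (wbar t)))%E) ->
           (F%:E <= gap h')%E),
      (d.-1 <= n <= d.+1)%N -> 0 < vxi ->
        ~ {ae P, forall t, G_invariant phi (linpred (w t))} ->
        gap (fun t => linpred (wbar t)) = +oo%E /\
        (forall h' : T -> 'cV[R]_d -> R,
           (forall t, (risk (h' t) <= risk (linpred (wbar t)))%E) ->
           gap h' = +oo%E) &
      (n.+1 < d)%N ->
        let F := dA * (sX ^+ 2 * (\sum_(i < d) theta i 0 ^+ 2)
                         * (n%:R * (d%:R - n%:R))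
                         / (d%:R * (d%:R - 1) * (d%:R + 2))
                       + vxi * n%:R / (d%:R * (d%:R - n%:R - 1))) in
        gap (fun t => linpred (wbar t)) = F%:E /\
        (forall h' : T -> 'cV[R]_d -> R,
           (forall t, (risk (h' t) <= risk (linpred (wbar t)))%E) ->
           (F%:E <= gap h')%E)].
Proof.
move=> ph hl s0 mX nX mxi dxi ixi exi vx ind inv Y w wbar risk gap dA; split.
- move=> dn; split; first exact: (gap_over ph hl s0 mX nX mxi dxi ixi exi vx ind inv dn).
  move=> h' hr; rewrite -(gap_over ph hl s0 mX nX mxi dxi ixi exi vx ind inv dn).
  exact: (le_gap ph hl s0 mX nX mxi dxi ixi exi vx ind inv).
- move=> dn v0 nae; split; first exact: (gap_threshold ph hl s0 mX nX mxi dxi ixi exi vx ind inv dn v0 nae).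
  move=> h' hr; apply/eqP; rewrite -leye_eq.
  rewrite -(gap_threshold ph hl s0 mX nX mxi dxi ixi exi vx ind inv dn v0 nae).
  exact: (le_gap ph hl s0 mX nX mxi dxi ixi exi vx ind inv).
- move=> nd; split; first exact: (gap_under ph hl s0 mX nX mxi dxi ixi exi vx ind inv nd).
  move=> h' hr; rewrite -(gap_under ph hl s0 mX nX mxi dxi ixi exi vx ind inv nd).
  exact: (le_gap ph hl s0 mX nX mxi dxi ixi exi vx ind inv).
Qed.
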